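(* Let $\Gamma$ be a Dynkin diagram of type ADE with an orientation $\vec{o}$. Then the map $\chi$ defines a bijection between $\mathcal{L}$, the set of isomorphism classes of indecomposable objects of $\mathcal{K}^0_0$ up to the shift $\langle1\rangle[1]$, and the set $\Phi^+$ of positive roots of the corresponding root system.
   Context: $\Gamma$ is a connected Dynkin diagram of type ADE with vertex set $I$ and orientation $\vec{o}$. $\Phi^+\subset\mathrm{span}_{\mathbb{N}}\{\alpha_i\}_{i\in I}$ is the set of positive roots of the ADE root system with simple roots $\alpha_i$. Zigzag algebra. Let $\bar\Gamma$ be the quiver obtained by replacing each edge of $\Gamma$ by two opposite arrows; paths are composed from left to right. $A_\Gamma$ is the quotient of the complex path algebra of $\bar\Gamma$ by: length-two paths with distinct endpoints are $0$; all length-two paths starting and ending at the same vertex are equal. (Type $A_1$: $A_\Gamma=\mathbb{C}[x]/(x^2)$; type $A_2$: quotient of the path algebra by all paths of length three.) It is bigraded by path length and by orientation degree (arrows agreeing with $\vec{o}$ have degree $0$, the opposite ones degree $1$; in type $A_1$, $x$ has path length $2$ and orientation degree $1$). Shifts are written $\langle\cdot\rangle$ (path length) and $\{\cdot\}$ (orientation), with the convention that an element of bidegree $(a,b)$ of $M$ has bidegree $(a+k,b+l)$ in $M\langle k\rangle\{l\}$. $P_i=A_\Gamma e_i$, where $e_i$ is the length-zero path at $i$. $\mathcal{K}$ is the homotopy category of bounded complexes of finitely generated bigraded projective left $A_\Gamma$-modules (with bidegree-$0$ maps), $Y[k]^m=Y^{k+m}$. Each object has a minimal complex (a representative without contractible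 summands), unique up to isomorphism. $\mathcal{K}^0_0\subset\mathcal{K}$ (the intersection of the heart of the canonical $t$-structure and the heart of the $\vec{o}$-baric structure) is the full subcategory of objects whose minimal complex has underlying chain group a direct sum of terms $P_i\{0\}\langle-k\rangle[-k]$, i.e. of modules $P_i\{0\}\langle-k\rangle$ placed in cohomological degree $k$. The shift $\langle1\rangle[1]$ preserves $\mathcal{K}^0_0$. $\tilde{\mathcal{L}}$ is the set of isomorphism classes of indecomposable objects of $\mathcal{K}^0_0$ and $\mathcal{L}=\tilde{\mathcal{L}}/\langle1\rangle[1]$. The map $\chi:\mathcal{L}\to\mathrm{span}_{\mathbb{N}}\{\alpha_i\}$ is the additive extension of $\chi(P_i)=\alpha_i$: if the minimal complex has underlying chain group $\bigoplus_{i}\bigoplus_kP_i\langle-k\rangle[-k]\otimes_{\mathbb{C}}N_i(k)$, then $\chi$ sends it to $\sum_i\big(\sum_k\dim N_i(k)\big)\alpha_i$. *)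

(* Defs.v *)
From HB Require Import structures.
From mathcomp Require Import all_boot all_order all_algebra.
From mathcomp Require Import all_classical reals complex zify.

Set Implicit Arguments.
Unset Strict Implicit.
Unset Printing Implicit Defensive.

Import Order.TTheory GRing.Theory Num.Theory.

Local Open Scope classical_set_scope.
Local Open Scope quotient_scope.
Local Open Scope ring_scope.

Section TwoSidedQuotient.
Variables (B : pzRingType) (S : set B).

Definition two_sided_ideal (J : set B) : Prop :=
  [/\ J 0, forall x y, J x -> J y -> J (x - y),
      forall a x, J x -> J (a * x) & forall a x, J x -> J (x * a)].

Definition ideal_gen : set B :=
  [set x | forall J, two_sided_ideal J -> S `<=` J -> J x].

Lemma ideal_genP : two_sided_ideal ideal_gen.
Proof.
split; first by move=> J [].
- by move=> x y Jx Jy J JI SJ; case: (JI) => _ + _ _; apply; [exact: Jx|exact: Jy].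
- by move=> a x Jx J JI SJ; case: (JI) => _ _ + _; apply; exact: Jx.
- by move=> a x Jx J JI SJ; case: (JI) => _ _ _; apply; exact: Jx.
Qed.

Lemma sub_ideal_gen : S `<=` ideal_gen.
Proof. by move=> x Sx J _; apply. Qed.

Definition ideal_pred : {pred B} := fun x => `[< ideal_gen x >].

Lemma ideal_predP x : reflect (ideal_gen x) (x \in ideal_pred).
Proof. exact: asboolP. Qed.

Lemma ideal_pred_zmod_closed : zmod_closed ideal_pred.
Proof.
have [J0 JB _ _] := ideal_genP.
split=> [|x y /ideal_predP Jx /ideal_predP Jy]; apply/ideal_predP => //.
exact: JB.
Qed.
HB.instance Definition _ :=
  GRing.isZmodClosed.Build B ideal_pred ideal_pred_zmod_closed.

Definition quotring := Quotient.quot ideal_pred.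
HB.instance Definition _ := GRing.Zmodule.on quotring.

Definition quot_pi (x : B) : quotring := \pi_quotring x.
Definition quot_mul (x y : quotring) : quotring := quot_pi (repr x * repr y).

Lemma quot_piE x y : quot_pi x = quot_pi y <-> ideal_gen (x - y).
Proof.
split=> [/eqP|Jxy]; first by rewrite -Quotient.idealrBE => /ideal_predP.
by apply/eqP; rewrite -Quotient.idealrBE; apply/ideal_predP.
Qed.

Lemma quot_pi_surj u : exists x, u = quot_pi x.
Proof. by exists (repr u); rewrite /quot_pi reprK. Qed.

Lemma quot_pi0 : quot_pi 0 = 0.
Proof. by rewrite /quot_pi !piE. Qed.

Lemma quot_piD x y : quot_pi (x + y) = quot_pi x + quot_pi y.
Proof. by rewrite /quot_pi !piE. Qed.

Lemma quot_piB x y : quot_pi (x - y) = quot_pi x - quot_pi y.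
Proof. by rewrite /quot_pi !piE. Qed.

Lemma quot_pi_mul x y : quot_mul (quot_pi x) (quot_pi y) = quot_pi (x * y).
Proof.
have [J0 JB JM MJ] := ideal_genP.
have JN a : ideal_gen a -> ideal_gen (- a).
  by move=> Ja; rewrite -sub0r; exact: JB.
have rK z : ideal_gen (repr (quot_pi z) - z).
  by apply/quot_piE; rewrite /quot_pi reprK.
apply/quot_piE; set x' := repr _; set y' := repr _.
have -> : x' * y' - x * y = (x' - x) * y' - - (x * (y' - y)).
  by rewrite opprK mulrBl mulrBr addrA subrK.
by apply: JB; [apply: MJ; exact: rK | apply: JN; apply: JM; exact: rK].
Qed.

Lemma quot_mulA : associative quot_mul.
Proof.
move=> u v w; have [x ->] := quot_pi_surj u; have [y ->] := quot_pi_surj v.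
by have [z ->] := quot_pi_surj w; rewrite !quot_pi_mul mulrA.
Qed.

Lemma quot_mul1l : left_id (quot_pi 1) quot_mul.
Proof. by move=> u; have [x ->] := quot_pi_surj u; rewrite quot_pi_mul mul1r. Qed.

Lemma quot_mul1r : right_id (quot_pi 1) quot_mul.
Proof. by move=> u; have [x ->] := quot_pi_surj u; rewrite quot_pi_mul mulr1. Qed.

Lemma quot_mulDl : left_distributive quot_mul +%R.
Proof.
move=> u v w; have [x ->] := quot_pi_surj u; have [y ->] := quot_pi_surj v.
have [z ->] := quot_pi_surj w.
by rewrite -quot_piD !quot_pi_mul mulrDl quot_piD.
Qed.

Lemma quot_mulDr : right_distributive quot_mul +%R.
Proof.
move=> u v w; have [x ->] := quot_pi_surj u; have [y ->] := quot_pi_surj v.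
have [z ->] := quot_pi_surj w.
by rewrite -quot_piD !quot_pi_mul mulrDr quot_piD.
Qed.

HB.instance Definition _ := GRing.Zmodule_isPzRing.Build quotring
  quot_mulA quot_mul1l quot_mul1r quot_mulDl quot_mulDr.

Lemma quot_piM x y : quot_pi (x * y) = quot_pi x * quot_pi y.
Proof. exact/esym/quot_pi_mul. Qed.

Lemma quot_pi_eq0 x : quot_pi x = 0 <-> ideal_gen x.
Proof. by rewrite -quot_pi0 quot_piE subr0. Qed.

Lemma quot_pi_sum (T : Type) (s : seq T) (F : T -> B) :
  quot_pi (\sum_(i <- s) F i) = \sum_(i <- s) quot_pi (F i).
Proof.
by elim: s => [|i s IHs]; rewrite ?big_nil ?quot_pi0 // !big_cons quot_piD IHs.
Qed.

End TwoSidedQuotient.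

(* A path in the quiver with vertices [I] and at most one arrow from [i] to [j],
   present iff [arr i j], is a pair [(i, s)]: it starts at [i] and visits [s]. *)
Section PathAlgebra.
Variables (K : fieldType) (I : finType) (arr : rel I).

Definition qword := (I * seq I)%type.

(* As [I] is finite, bounded length amounts to finite support. *)
Definition path_fun (f : qword -> K) : Prop :=
  exists N, forall w, f w != 0 -> path arr w.1 w.2 /\ (size w.2 < N)%N.

Definition path_fun_pred : {pred (qword -> K)} := fun f => `[< path_fun f >].

Lemma path_fun_zmod_closed : zmod_closed path_fun_pred.
Proof.
split=> [|f g /asboolP [M fM] /asboolP [N gN]]; apply/asboolP.
  by exists 0%N => w /eqP.
exists (maxn M N) => w fgw.
have [fw0|/fM [? ?]] := eqVneq (f w) 0; last by rewrite leq_max; split=> //; apply/orP; left.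
have /gN [? ?] : g w != 0.
  by apply: contraNneq fgw => gw0; rewrite {1}/GRing.add /= fw0 add0r -[X in X == _]/(- g w) gw0 oppr0.
by rewrite leq_max; split=> //; apply/orP; right.
Qed.
HB.instance Definition _ :=
  GRing.isZmodClosed.Build (qword -> K) path_fun_pred path_fun_zmod_closed.

Record pathalg := PathAlg {
  pa_fun :> qword -> K;
  pa_funP : pa_fun \in path_fun_pred }.

HB.instance Definition _ := [isSub for pa_fun].
HB.instance Definition _ := [Choice of pathalg by <:].
HB.instance Definition _ := [SubChoice_isSubZmodule of pathalg by <:].

Lemma pathalgP (f g : pathalg) : (forall w, f w = g w) <-> f = g.
Proof. by split=> [fg|->//]; apply/val_inj/funext. Qed.

Lemma pa0E w : (0 : pathalg) w = 0. Proof. by []. Qed.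
Lemma paDE (f g : pathalg) w : (f + g) w = f w + g w. Proof. by []. Qed.
Lemma paBE (f g : pathalg) w : (f - g) w = f w - g w. Proof. by []. Qed.
Lemma pa_sumE (T : Type) (s : seq T) (F : T -> pathalg) w :
  (\sum_(i <- s) F i) w = \sum_(i <- s) F i w.
Proof. by elim: s => [|i s IHs]; rewrite ?big_nil // !big_cons paDE IHs. Qed.

Lemma pa_path (f : pathalg) w : f w != 0 -> path arr w.1 w.2.
Proof. by have /asboolP [N fN] := pa_funP f; move=> /fN []. Qed.

Definition path_elt_fun (w v : qword) : K := (path arr w.1 w.2 && (v == w))%:R.

Lemma path_elt_subproof w : (path_elt_fun w) \in path_fun_pred.
Proof.
apply/asboolP; exists (size w.2).+1 => v; rewrite /path_elt_fun.
by case: andP => [[pw /eqP ->]|_] /eqP.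
Qed.

Definition path_elt (w : qword) : pathalg := PathAlg (path_elt_subproof w).

Definition path_mul_fun (f g : qword -> K) (w : qword) : K :=
  \sum_(0 <= n < (size w.2).+1)
     f (w.1, take n w.2) * g (last w.1 (take n w.2), drop n w.2).

Lemma path_mul_subproof (f g : pathalg) : (path_mul_fun f g) \in path_fun_pred.
Proof.
have /asboolP [M fM] := pa_funP f; have /asboolP [N gN] := pa_funP g.
apply/asboolP; exists (M + N)%N => -[x s] fgw.
have [n [_ fn gn]] : exists n, [/\ true, f (x, take n s) != 0 &
    g (last x (take n s), drop n s) != 0].
  apply: contrapT => H; case/eqP: fgw; rewrite /path_mul_fun big1_seq //= => n _.
  have [->|fn] := eqVneq (f (x, take n s)) 0; first by rewrite mul0r.
  have [->|gn] := eqVneq (g (last x (take n s), drop n s)) 0.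
    by rewrite mulr0.
  by case: H; exists n.
have /= [p1 s1] := fM _ fn; have /= [p2 s2] := gN _ gn.
rewrite /= -(cat_take_drop n s) cat_path p1 p2 size_cat; split=> //.
by rewrite -addSn leq_add // ltnW.
Qed.

Definition path_mul (f g : pathalg) : pathalg := PathAlg (path_mul_subproof f g).

Definition path_one_fun (w : qword) : K := (w.2 == [::])%:R.

Lemma path_one_subproof : path_one_fun \in path_fun_pred.
Proof.
apply/asboolP; exists 1%N => -[x s]; rewrite /path_one_fun /=.
by have [->|_ /eqP] := eqVneq s [::].
Qed.

Definition path_one : pathalg := PathAlg path_one_subproof.

Lemma path_mulA : associative path_mul.
Proof.
move=> f g h; apply/pathalgP => -[x s] /=; rewrite /path_mul_fun /=.
set N := (size s).+1.
pose F n m := f (x, take n s) * g (last x (take n s), drop n (take m s)) *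
  h (last x (take m s), drop m s).
transitivity (\sum_(0 <= n < N) \sum_(0 <= m < N | (n <= m)%N) F n m).
  rewrite big_nat [RHS]big_nat; apply: eq_bigr => n /= nN.
  have -> : \sum_(0 <= m < N | (n <= m)%N) F n m =
            \sum_(0 <= j < N - n) F n (j + n)%N.
    by rewrite -[RHS](big_addn 0 N n predT (F n)) [RHS](big_nat_widenl _ 0).
  rewrite mulr_sumr.
  have -> : (size (drop n s)).+1 = (N - n)%N by rewrite size_drop subSn.
  apply: eq_bigr => j _; rewrite /F mulrA.
  by rewrite -take_drop addnC takeD last_cat drop_drop (addnC n j).
rewrite (exchange_big_dep_nat predT) //=.
rewrite big_nat [RHS]big_nat; apply: eq_bigr => m /= mN.
rewrite mulr_suml size_takel //.
rewrite (big_nat_widen 0 m.+1 N) //.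
apply: eq_big => n; first by rewrite ltnS.
by move=> nm; rewrite /F take_takel.
Qed.

Lemma path_mul1r : left_id path_one path_mul.
Proof.
move=> f; apply/pathalgP => -[x s] /=; rewrite /path_mul_fun /=.
rewrite big_nat_recl //= take0 drop0 mul1r big1_seq ?addr0 // => n.
rewrite mem_index_iota /= => ns; rewrite /path_one_fun /=.
by case: s ns => //= y s _; rewrite mul0r.
Qed.

Lemma path_mulr1 : right_id path_one path_mul.
Proof.
move=> f; apply/pathalgP => -[x s] /=; rewrite /path_mul_fun /=.
rewrite big_nat_recr //= take_size drop_size mulr1 big1_seq ?add0r // => n.
rewrite mem_index_iota /= => ns; rewrite /path_one_fun /= -size_eq0 size_drop.
by rewrite subn_eq0 leqNgt ns mulr0.
Qed.

Lemma path_mulDl : left_distributive path_mul +%R.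
Proof.
move=> f g h; apply/pathalgP => w; rewrite paDE /= /path_mul_fun -big_split /=.
by apply: eq_bigr => n _; rewrite -mulrDl.
Qed.

Lemma path_mulDr : right_distributive path_mul +%R.
Proof.
move=> f g h; apply/pathalgP => w; rewrite paDE /= /path_mul_fun -big_split /=.
by apply: eq_bigr => n _; rewrite -mulrDr.
Qed.

HB.instance Definition _ := GRing.Zmodule_isPzRing.Build pathalg
  path_mulA path_mul1r path_mulr1 path_mulDl path_mulDr.

Lemma paME (f g : pathalg) w : (f * g) w = path_mul_fun f g w.
Proof. by []. Qed.

End PathAlgebra.

(* (path length, orientation degree) *)
Notation bideg := (int * int)%type.

Definition bigrading (V : zmodType) (c : bideg -> set V) : Prop :=
  [/\ forall d, c d 0,
      forall d x y, c d x -> c d y -> c d (x - y),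
      forall x, exists (s : seq bideg) (f : bideg -> V),
        (forall d, c d (f d)) /\ x = \sum_(d <- s) f d
    & forall (s : seq bideg) (f : bideg -> V),
        uniq s -> (forall d, c d (f d)) -> \sum_(d <- s) f d = 0 ->
        forall d, d \in s -> f d = 0].

(* For a quotient of a path algebra over K, the image of K lies in the degree 0
   part; graded submodules and module maps are therefore K-linear, and no
   separate K-structure is recorded. *)
Record bgring := BGRing {
  bgring_sort :> pzRingType;
  bgr : bideg -> set bgring_sort;
  bgrP : bigrading bgr;
  bgr1 : bgr 0 1;
  bgrM : forall c d x y, bgr c x -> bgr d y -> bgr (c + d) (x * y) }.

Section GradedPathQuotient.
Variables (K : fieldType) (I : finType) (arr : rel I) (step : I -> I -> bideg).
Local Notation PA := (pathalg K arr).

Fixpoint seq_deg (x : I) (s : seq I) : bideg :=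
  if s is y :: s' then step x y + seq_deg y s' else 0.

Definition path_deg (w : qword I) : bideg := seq_deg w.1 w.2.

Definition path_homog (d : bideg) : set PA :=
  [set f | forall w, f w != 0 -> path_deg w = d].

Lemma seq_deg_cat x s t : seq_deg x (s ++ t) = seq_deg x s + seq_deg (last x s) t.
Proof. by elim: s x => [|y s IHs] x /=; rewrite ?add0r // IHs addrA. Qed.

Lemma path_deg_split n (w : qword I) :
  path_deg w = path_deg (w.1, take n w.2) +
               path_deg (last w.1 (take n w.2), drop n w.2).
Proof. by rewrite /path_deg /= -seq_deg_cat cat_take_drop. Qed.

Lemma path_homogM c d f g :
  path_homog c f -> path_homog d g -> path_homog (c + d) (f * g).
Proof.
move=> fc gd w fgw.
have [n fn gn] : exists2 n, f (w.1, take n w.2) != 0 &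
    g (last w.1 (take n w.2), drop n w.2) != 0.
  apply: contrapT => H; case/eqP: fgw; rewrite paME /path_mul_fun big1_seq //= => n _.
  have [->|fn] := eqVneq (f (w.1, take n w.2)) 0; first by rewrite mul0r.
  have [->|gn] := eqVneq (g (last w.1 (take n w.2), drop n w.2)) 0.
    by rewrite mulr0.
  by case: H; exists n.
by rewrite (path_deg_split n) (fc _ fn) (gd _ gn).
Qed.

Definition path_comp_fun (d : bideg) (f : qword I -> K) (w : qword I) : K :=
  if path_deg w == d then f w else 0.

Lemma path_comp_subproof d (f : PA) : path_comp_fun d f \in path_fun_pred arr.
Proof.
have /asboolP [N fN] := pa_funP f; apply/asboolP; exists N => w.
by rewrite /path_comp_fun; case: (path_deg w =P d) => [_ /fN|_ /eqP].
Qed.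

Definition path_comp d (f : PA) : PA := PathAlg (path_comp_subproof d f).

Lemma path_compE d f w :
  path_comp d f w = if path_deg w == d then f w else 0.
Proof. by []. Qed.

Lemma path_comp_homog d f : path_homog d (path_comp d f).
Proof. by move=> w; rewrite path_compE; case: (path_deg w =P d) => // _ /eqP. Qed.

Lemma homog_path_comp c d f :
  path_homog c f -> path_comp d f = if c == d then f else 0.
Proof.
move=> fc; apply/pathalgP => w; rewrite path_compE.
have [fw0|/fc ->] := eqVneq (f w) 0; last by case: (c == d).
by rewrite fw0; case: (_ == d); case: (c == d); rewrite ?fw0.
Qed.

Lemma path_compB d f g : path_comp d (f - g) = path_comp d f - path_comp d g.
Proof.
by apply/pathalgP => w; rewrite !(path_compE, paBE); case: ifP => // _; rewrite subr0.
Qed.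

Lemma path_comp0 d : path_comp d 0 = 0.
Proof. by apply/pathalgP => w; rewrite path_compE; case: ifP. Qed.

Lemma path_comp_sum d (T : Type) (s : seq T) (F : T -> PA) :
  path_comp d (\sum_(i <- s) F i) = \sum_(i <- s) path_comp d (F i).
Proof.
apply/pathalgP => w; rewrite path_compE !pa_sumE.
under [RHS]eq_bigr do rewrite path_compE.
by case: ifP => // _; rewrite big1.
Qed.

Lemma path_degs (f : PA) : exists2 s : seq bideg, uniq s &
  forall w, f w != 0 -> path_deg w \in s.
Proof.
have /asboolP [N fN] := pa_funP f.
pose ws : seq (qword I) := flatten [seq [seq (xt.1, tval xt.2) |
   xt : I * n.-tuple I] | n <- iota 0 N].
exists (undup (map path_deg ws)); first exact: undup_uniq.
move=> w /fN [_ wN]; rewrite mem_undup; apply: map_f.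
apply/flattenP; exists [seq (xt.1, tval xt.2) | xt : I * (size w.2).-tuple I].
  by apply/mapP; exists (size w.2); rewrite // mem_iota.
by apply/mapP; exists (w.1, in_tuple w.2); rewrite ?mem_enum //; case: w {wN}.
Qed.

Lemma sum_path_comp (f : PA) (s : seq bideg) : uniq s ->
  (forall w, f w != 0 -> path_deg w \in s) -> f = \sum_(d <- s) path_comp d f.
Proof.
move=> us fs; apply/pathalgP => w; rewrite pa_sumE.
under eq_bigr do rewrite path_compE.
have [fw0|fw] := eqVneq (f w) 0; first by rewrite fw0 big1 // => d _; case: ifP.
rewrite (bigD1_seq (path_deg w)) ?fs //= eqxx big1 ?addr0 // => d.
by rewrite eq_sym => /negPf ->.
Qed.

Lemma path_homogB d f g : path_homog d f -> path_homog d g -> path_homog d (f - g).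
Proof.
move=> fd gd w; rewrite paBE => fgw.
have [fw0|/fd //] := eqVneq (f w) 0.
by apply: gd; apply: contraNneq fgw => ->; rewrite fw0 subrr.
Qed.

Variable S : set PA.
Hypothesis S_homog : forall r, S r -> exists c, path_homog c r.

Lemma ideal_gen_comp (f : PA) d : ideal_gen S f -> ideal_gen S (path_comp d f).
Proof.
have [J0 JB JM MJ] := ideal_genP S.
have JD a b : ideal_gen S a -> ideal_gen S b -> ideal_gen S (a + b).
  move=> Ja Jb; rewrite -[b]opprK; apply: (JB _ _ Ja).
  by rewrite -sub0r; apply: JB.
have Jsum (s : seq bideg) (F : bideg -> PA) :
    (forall c, ideal_gen S (F c)) -> ideal_gen S (\sum_(c <- s) F c).
  by move=> JF; elim: s => [|c s IHs]; rewrite ?big_nil // big_cons; apply: JD.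
pose J := [set g : PA | forall c, ideal_gen S (path_comp c g)].
move=> Jf; suff : J f by exact.
apply: Jf; last first.
  move=> r Sr c; have [b rb] := S_homog Sr.
  rewrite (homog_path_comp c rb); case: ifP => // _; exact: sub_ideal_gen.
split=> [c|x y Jx Jy c|a x Jx c|a x Jx c]; first by rewrite path_comp0.
- by rewrite path_compB; apply: JB; [exact: Jx|exact: Jy].
- have [s us as_] := path_degs a.
  have [t ut xt] := path_degs x.
  rewrite (sum_path_comp us as_) mulr_suml path_comp_sum; apply: (Jsum _ _) => b.
  rewrite {1}(sum_path_comp ut xt) mulr_sumr path_comp_sum; apply: (Jsum _ _) => e.
  rewrite (homog_path_comp c (path_homogM (@path_comp_homog b a) (@path_comp_homog e x))).
  case: ifP => // _; apply: JM; exact: Jx.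
- have [s us as_] := path_degs a.
  have [t ut xt] := path_degs x.
  rewrite (sum_path_comp us as_) mulr_sumr path_comp_sum; apply: (Jsum _ _) => b.
  rewrite {1}(sum_path_comp ut xt) mulr_suml path_comp_sum; apply: (Jsum _ _) => e.
  rewrite (homog_path_comp c (path_homogM (@path_comp_homog e x) (@path_comp_homog b a))).
  case: ifP => // _; apply: MJ; exact: Jx.
Qed.

Definition quot_comp (d : bideg) : set (quotring S) := @quot_pi _ S @` path_homog d.

Lemma quot_compP : bigrading quot_comp.
Proof.
split.
- by move=> d; exists 0; rewrite ?quot_pi0 // => w /eqP.
- move=> d _ _ [f fd <-] [g gd <-]; exists (f - g); last by rewrite quot_piB.
  exact: path_homogB.
- move=> u; have [f ->] := quot_pi_surj u; have [s us fs] := path_degs f.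
  exists s, (fun d => quot_pi S (path_comp d f)); split=> [d|].
    by exists (path_comp d f) => //; exact: path_comp_homog.
  by rewrite -quot_pi_sum -sum_path_comp.
- move=> s F us FP.
  have /choice [f fP] : forall d, exists f, path_homog d f /\ quot_pi S f = F d.
    by move=> d; have [f fd fF] := FP d; exists f.
  under eq_bigr do rewrite -(fP _).2.
  rewrite -quot_pi_sum quot_pi_eq0 => Jf d ds; rewrite -(fP d).2 quot_pi_eq0.
  have := ideal_gen_comp d Jf; rewrite path_comp_sum (bigD1_seq d) //=.
  rewrite (homog_path_comp d (fP d).1) eqxx big1 ?addr0 // => c /negPf cd.
  by rewrite (homog_path_comp d (fP c).1) cd.
Qed.

Lemma quot_comp1 : quot_comp 0 1.
Proof.
exists 1 => // -[x s]; rewrite [X in X != _]/(path_one_fun _ _) /path_one_fun /=.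
by have [->|_ /eqP] := eqVneq s [::].
Qed.

Lemma quot_compM c d x y :
  quot_comp c x -> quot_comp d y -> quot_comp (c + d) (x * y).
Proof.
move=> [f fc <-] [g gd <-]; exists (f * g); last by rewrite quot_piM.
exact: path_homogM.
Qed.

Definition path_quot_bgring : bgring := BGRing quot_compP quot_comp1 quot_compM.

End GradedPathQuotient.

Variant ade_family := FamA | FamD | FamE.

Definition ade_rank (t : ade_family) (n : nat) : bool :=
  match t with
  | FamA => (1 <= n)%N
  | FamD => (4 <= n)%N
  | FamE => (6 <= n <= 8)%N
  end.

(* Type D_n: the chain 0 - 1 - ... - (n-2), and n-1 attached to n-3.
   Type E_n: the chain 0 - 1 - ... - (n-2), and n-1 attached to 2. *)
Definition ade_link (t : ade_family) (n i j : nat) : bool :=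
  match t with
  | FamA => j == i.+1
  | FamD => (j == i.+1) && (j < n.-1)%N || (i == n - 3)%N && (j == n.-1)
  | FamE => (j == i.+1) && (j < n.-1)%N || (i == 2%N) && (j == n.-1)
  end.

Definition is_ade (I : finType) (e : rel I) : Prop :=
  exists (t : ade_family) (n : nat), ade_rank t n /\
    exists2 f : I -> 'I_n, bijective f &
      forall i j, e i j = ade_link t n (f i) (f j) || ade_link t n (f j) (f i).

Definition is_orientation (I : finType) (e o : rel I) : Prop :=
  forall i j, (e i j = o i j || o j i) /\ ~~ (o i j && o j i).

Record oriented_dynkin := OrientedDynkin {
  vertex :> finType;
  edge : rel vertex;
  orient : rel vertex;
  edge_ade : is_ade edge;
  orientP : is_orientation edge orient }.

Lemma edge_sym (G : oriented_dynkin) : symmetric (@edge G).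
Proof. by move=> i j; rewrite !(orientP _ _).1 orbC. Qed.

Section ZigzagAlgebra.
Variables (K : fieldType) (G : oriented_dynkin).

(* The arrows of the doubled quiver; in type A_1, where there is no edge, the
   generator x is a loop at the unique vertex. *)
Definition zz_arr : rel G := fun i j => edge i j || (#|G| == 1%N).

(* For three or more vertices only [zz_ends] and [zz_loops] matter; [path_elt w]
   is 0 when [w] is not a path. *)
Inductive zz_rel : pathalg K zz_arr -> Prop :=
| zz_ends i j k of edge i j & edge j k & i != k :
    zz_rel (path_elt K zz_arr (i, [:: j; k]))
| zz_loops i j k of edge i j & edge i k :
    zz_rel (path_elt K zz_arr (i, [:: j; i]) - path_elt K zz_arr (i, [:: k; i]))
| zz_A1 i of #|G| = 1%N :
    zz_rel (path_elt K zz_arr (i, [:: i; i]))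
| zz_A2 i s of #|G| = 2%N & size s = 3%N :
    zz_rel (path_elt K zz_arr (i, s)).

(* In type A_1 the loop x has path length 2 and orientation degree 1. *)
Definition zz_step (i j : G) : bideg :=
  if #|G| == 1%N then (2, 1) else (1, (~~ orient i j)%:Z).

Lemma path_elt_homog w : path_homog zz_step (path_deg zz_step w) (path_elt K zz_arr w).
Proof.
move=> v; rewrite [X in X != _]/(path_elt_fun K zz_arr w v) /path_elt_fun.
by case: andP => [[_ /eqP ->]|_ /eqP].
Qed.

Lemma zz_rel_homog r : zz_rel r -> exists c, path_homog zz_step c r.
Proof.
case=> [i j k _ _ _|i j k ij ik|i _|i s _ _]; try by eexists; exact: path_elt_homog.
exists (path_deg zz_step (i, [:: j; i])); apply: path_homogB.
  exact: path_elt_homog.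
suff -> : path_deg zz_step (i, [:: j; i]) = path_deg zz_step (i, [:: k; i]).
  exact: path_elt_homog.
have E l : edge i l -> path_deg zz_step (i, [:: l; i]) =
    if #|G| == 1%N then (4, 2) else (2, 1).
  rewrite (orientP i l).1; have := (orientP i l).2.
  rewrite /path_deg /= /zz_step; case: (_ == _) => //.
  by case: (orient i l); case: (orient l i).
by rewrite !E.
Qed.

Definition zigzag : bgring := path_quot_bgring zz_rel_homog.

Definition zz_idem (i : G) : zigzag := quot_pi zz_rel (path_elt K zz_arr (i, [::])).

Lemma zz_idem_deg i : bgr 0 (zz_idem i).
Proof. by exists (path_elt K zz_arr (i, [::])) => //; exact: path_elt_homog. Qed.

End ZigzagAlgebra.

Section BigradedModules.
Variable A : bgring.

Record bgmod := BGMod {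
  bgmod_sort :> lmodType A;
  bgm : bideg -> set bgmod_sort;
  bgmP : bigrading bgm;
  bgmZ : forall c d a x, bgr c a -> bgm d x -> bgm (c + d) (a *: x) }.

Definition bghom (M N : bgmod) (f : M -> N) : Prop :=
  linear f /\ forall d x, bgm d x -> bgm d (f x).

Definition finitely_generated (M : bgmod) : Prop :=
  exists (n : nat) (g : 'I_n -> M),
    forall x, exists c : 'I_n -> A, x = \sum_i c i *: g i.

Definition projective (M : bgmod) : Prop :=
  forall (N N' : bgmod) (p : N -> N') (f : M -> N'),
    bghom p -> (forall y, exists x, p x = y) -> bghom f ->
    exists2 g : M -> N, bghom g & forall x, p (g x) = f x.

Section Shift.
Variables (t : bideg) (M : bgmod).

Definition bgshift_comp (d : bideg) : set M := bgm (d - t).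

Lemma bgshift_compP : bigrading bgshift_comp.
Proof.
have [M0 MB Mspan Mindep] := bgmP M.
have im s (f : bideg -> M) :
    \sum_(d <- [seq d + t | d <- s]) f (d - t) = \sum_(d <- s) f d.
  by rewrite big_map; apply: eq_bigr => d _; rewrite addrK.
split; [by move=> d; exact: M0|by move=> d x y; exact: MB|move=> x|].
  have [s [f [fM ->]]] := Mspan x.
  by exists [seq d + t | d <- s], (fun d => f (d - t)); split=> [d|]; [exact: fM|].
move=> s f us fM sf0 d ds; rewrite -[d](subrK t).
apply: (Mindep [seq d - t | d <- s] (fun d => f (d + t))).
- by rewrite map_inj_uniq //; exact: addIr.
- by move=> c; have := fM (c + t); rewrite /bgshift_comp addrK.
- by rewrite big_map -[RHS]sf0; apply: eq_bigr => c _; rewrite subrK.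
- exact: map_f.
Qed.

Lemma bgshift_compZ c d a x :
  bgr c a -> bgshift_comp d x -> bgshift_comp (c + d) (a *: x).
Proof. by move=> ca dx; rewrite /bgshift_comp -addrA; exact: bgmZ. Qed.

(* [bgshift (k, l) M] is M<k>{l}. *)
Definition bgshift : bgmod := BGMod bgshift_compP bgshift_compZ.

End Shift.

Lemma bgshift_hom t (M N : bgmod) (f : M -> N) :
  bghom f -> bghom (f : bgshift t M -> bgshift t N).
Proof. by case=> fl fd; split=> // d x; exact: fd. Qed.

Lemma bgshift_projective t M : projective M -> projective (bgshift t M).
Proof.
move=> Mp N N' p f [pl pd] ps [fl fd].
have [|||g [gl gd] pg] := Mp (bgshift (- t) N) (bgshift (- t) N') p f.
- by split=> // d x; exact: pd.
- exact: ps.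
- split=> // d x dx; rewrite /= /bgshift_comp opprK; apply: fd.
  by rewrite /= /bgshift_comp addrK.
exists g => //; split=> // d x dx; have := gd _ _ dx.
by rewrite /= /bgshift_comp opprK subrK.
Qed.

Section LeftIdeal.
Variable e : A.
Hypothesis e_deg : bgr 0 e.

(* The left ideal A e. *)
Definition lideal_pred : {pred A^o} := fun x => `[< exists y : A, x = y * e >].

Lemma lideal_submod_closed : submod_closed lideal_pred.
Proof.
split=> [|a _ _ /asboolP [y ->] /asboolP [z ->]]; apply/asboolP.
  by exists 0; rewrite mul0r.
by exists (a * y + z); rewrite mulrDl -mulrA.
Qed.
HB.instance Definition _ :=
  GRing.isSubmodClosed.Build A A^o lideal_pred lideal_submod_closed.

Record lideal := LIdeal { lideal_val :> A^o; lideal_valP : lideal_val \in lideal_pred }.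

HB.instance Definition _ := [isSub for lideal_val].
HB.instance Definition _ := [Choice of lideal by <:].
HB.instance Definition _ := [SubChoice_isSubLmodule of lideal by <:].

Lemma lideal_sum (s : seq bideg) (f : bideg -> lideal) :
  lideal_val (\sum_(d <- s) f d) = \sum_(d <- s) lideal_val (f d).
Proof. by elim: s => [|d s IHs]; rewrite ?big_nil // !big_cons -IHs. Qed.

Definition lideal_comp (d : bideg) : set lideal := [set x : lideal | bgr d (lideal_val x)].

Lemma lideal_compP : bigrading lideal_comp.
Proof.
have [A0 AB Aspan Aindep] := bgrP A.
split; [by move=> d; exact: A0|by move=> d x y; exact: AB|move=> x|].
  have /asboolP [y xy] := lideal_valP x.
  have [s [f [fA yf]]] := Aspan y.
  have fe d : (f d * e : A^o) \in lideal_pred by apply/asboolP; exists (f d).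
  exists s, (fun d => LIdeal (fe d)); split=> [d|].
    by have := bgrM (fA d) e_deg; rewrite addr0.
  by apply/val_inj; rewrite /= lideal_sum xy yf mulr_suml.
move=> s f us fA sf0 d ds; apply/val_inj; apply: (Aindep s (fun d => lideal_val (f d)) us) => //.
by rewrite -lideal_sum sf0.
Qed.

Lemma lideal_compZ c d a x :
  bgr c a -> lideal_comp d x -> lideal_comp (c + d) (a *: x).
Proof. exact: bgrM. Qed.

Definition lideal_bgmod : bgmod := BGMod lideal_compP lideal_compZ.

End LeftIdeal.

(* M is the direct sum of the F j: the map (+)_j F j -> M induced by the i j
   is bijective (it is then an isomorphism of bigraded modules). *)
Definition is_dirsum (M : bgmod) (J : finType) (F : J -> bgmod) : Prop :=
  exists i : forall j, F j -> M, (forall j, bghom (i j)) /\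
    forall x, exists! c : (forall j, F j), x = \sum_j i j (c j).

End BigradedModules.

Section Complexes.
Variable A : bgring.

(* All pairs of degrees carry a differential, which vanishes unless l = k + 1. *)
Record cplx := Cplx {
  cterm :> int -> bgmod A;
  cdiff : forall k l, cterm k -> cterm l;
  cdiff_hom : forall k l, bghom (@cdiff k l);
  cdiff_shape : forall k l x, l != k + 1 -> @cdiff k l x = 0;
  cdiffK : forall k l m x, @cdiff l m (@cdiff k l x) = 0;
  cbounded : exists N : nat, forall k, (N < `|k|)%N -> forall x : cterm k, x = 0;
  cterm_fg : forall k, finitely_generated (cterm k);
  cterm_proj : forall k, projective (cterm k) }.

Definition chain_map (X Y : cplx) (f : forall k, X k -> Y k) : Prop :=
  (forall k, bghom (f k)) /\
  forall k l x, f l (cdiff l x) = cdiff l (f k x).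

Definition map_eq (X Y : cplx) (f g : forall k, X k -> Y k) : Prop :=
  forall k x, f k x = g k x.

Definition homotopic (X Y : cplx) (f g : forall k, X k -> Y k) : Prop :=
  exists h : forall k l, X k -> Y l, (forall k l, bghom (h k l)) /\
    forall k x, f k x - g k x =
      cdiff k (h k (k - 1) x) + h (k + 1) k (cdiff (k + 1) x).

Definition iso_K (X Y : cplx) : Prop :=
  exists (f : forall k, X k -> Y k) (g : forall k, Y k -> X k),
  [/\ chain_map f, chain_map g,
      @homotopic X X (fun k x => g k (f k x)) (fun k x => x)
    & @homotopic Y Y (fun k y => f k (g k y)) (fun k y => y)].

Definition contractible (X : cplx) : Prop :=
  @homotopic X X (fun k x => x) (fun k x => 0).

(* X is a biproduct of Y and Z, in the category of complexes for R := map_eq,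
   in the homotopy category for R := homotopic. *)
Definition is_biproduct
    (R : forall X Y : cplx, (forall k, X k -> Y k) -> (forall k, X k -> Y k) -> Prop)
    (X Y Z : cplx) : Prop :=
  exists (i1 : forall k, Y k -> X k) (i2 : forall k, Z k -> X k)
         (p1 : forall k, X k -> Y k) (p2 : forall k, X k -> Z k),
  [/\ chain_map i1 /\ chain_map i2, chain_map p1 /\ chain_map p2,
      R Y Y (fun k y => p1 k (i1 k y)) (fun k y => y) /\
      R Z Z (fun k z => p2 k (i2 k z)) (fun k z => z),
      R Z Y (fun k z => p1 k (i2 k z)) (fun k z => 0) /\
      R Y Z (fun k y => p2 k (i1 k y)) (fun k y => 0)
    & R X X (fun k x => i1 k (p1 k x) + i2 k (p2 k x)) (fun k x => x)].

Definition minimal (X : cplx) : Prop :=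
  forall Y Z, is_biproduct map_eq X Y Z -> contractible Z ->
    forall k (z : Z k), z = 0.

Section ComplexShift.
Variables (t : bideg) (n : int) (X : cplx).

Definition cshift_term (k : int) : bgmod A := bgshift t (X (n + k)).

Definition cshift_diff (k l : int) (x : cshift_term k) : cshift_term l :=
  (-1) ^+ `|n|%N *: cdiff (n + l) (x : X (n + k)).

Lemma cshift_diff_hom k l : bghom (@cshift_diff k l).
Proof.
have [dl dd] := cdiff_hom X (n + k) (n + l).
have dX (x : X (n + k)) d : bgm d x -> bgm d ((-1) ^+ `|n|%N *: cdiff (n + l) x).
  have [M0 MB _ _] := bgmP (X (n + l)).
  rewrite -signr_odd; case: odd => /dd dx; last by rewrite scale1r.
  by rewrite scaleN1r -sub0r; exact: MB.
split=> [a x y|d x]; last exact: dX.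
by rewrite /cshift_diff dl scalerDr !scalerA -commr_sign.
Qed.

Lemma cshift_diff_shape k l (x : cshift_term k) : l != k + 1 -> cshift_diff l x = 0.
Proof.
move=> lk; rewrite /cshift_diff cdiff_shape ?scaler0 //.
by apply: contraNneq lk => /eqP; rewrite -addrA (inj_eq (addrI n)).
Qed.

Lemma cshift_diffK k l m (x : cshift_term k) :
  cshift_diff m (cshift_diff l x) = 0.
Proof.
have [dl _] := cdiff_hom X (n + l) (n + m).
have := dl ((-1) ^+ `|n|%N) (cdiff (n + l) (x : X (n + k))) 0.
rewrite !addr0 cdiffK scaler0 add0r => E; rewrite /cshift_diff E.
by have := dl (-1) 0 0; rewrite scaler0 add0r scaleN1r addNr => ->; rewrite scaler0.
Qed.

Lemma cshift_bounded : exists N : nat, forall k, (N < `|k|)%N ->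
  forall x : cshift_term k, x = 0.
Proof.
have [N XN] := cbounded X; exists (N + `|n|)%N => k Nk x.
by apply: XN; have := leqD_dist k 0 (- n); lia.
Qed.

(* [cshift (a, b) n X] is X<a>{b}[n]. *)
Definition cshift : cplx :=
  @Cplx cshift_term cshift_diff cshift_diff_hom cshift_diff_shape cshift_diffK
    cshift_bounded (fun k => cterm_fg X (n + k))
    (fun k => @bgshift_projective _ t _ (@cterm_proj X (n + k))).

End ComplexShift.

End Complexes.

Section RootSystem.
Variable G : oriented_dynkin.

Definition simple_root (i : G) : {ffun G -> int} := [ffun j => (j == i)%:Z].

Definition coroot_pairing (i : G) (v : {ffun G -> int}) : int :=
  2 * v i - \sum_(j | edge i j) v j.

Definition simple_reflection (i : G) (v : {ffun G -> int}) : {ffun G -> int} :=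
  [ffun j => v j - coroot_pairing i v * simple_root i j].

(* The root system is the orbit of the simple roots under the Weyl group. *)
Inductive is_root : {ffun G -> int} -> Prop :=
| root_simple i : is_root (simple_root i)
| root_reflection i v : is_root v -> is_root (simple_reflection i v).

Definition positive_roots : set {ffun G -> nat} :=
  [set v | is_root [ffun i => (v i)%:Z]].

End RootSystem.

Section HeartK00.
Variables (K : fieldType) (G : oriented_dynkin).
Local Notation cplx := (cplx (zigzag K G)).

Definition zz_proj (i : G) : bgmod (zigzag K G) := lideal_bgmod (zz_idem_deg K i).

(* X^k is the direct sum over i of n i k copies of P_i<-k>{0}. *)
Definition chain_type (X : cplx) (n : G -> int -> nat) : Prop :=
  forall k, @is_dirsum _ (X k) {i : G & 'I_(n i k)}
    (fun j => bgshift (- k, 0) (zz_proj (tag j))).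

Definition in_K00 (X : cplx) : Prop :=
  exists (M : cplx) (n : G -> int -> nat),
    [/\ iso_K X M, minimal M & chain_type M n].

Definition indecomposable_K00 (X : cplx) : Prop :=
  [/\ in_K00 X, ~ contractible X &
      forall Y Z, in_K00 Y -> in_K00 Z -> is_biproduct (@homotopic _) X Y Z ->
        contractible Y \/ contractible Z].

(* The classes of objects up to isomorphism and <1>[1]. They are predicates
   rather than [set]s because [set] lives in a universe below [cplx]. *)
Definition shift_class (X : cplx) : cplx -> Prop :=
  fun Y => exists k : int, iso_K Y (cshift (k, 0) k X).

Definition in_L (c : cplx -> Prop) : Prop :=
  exists2 X, indecomposable_K00 X & c = shift_class X.

(* [has_dim X v]: the minimal complex of X contains, over all cohomological
   degrees, v i summands P_i. The sum over k has finite support by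
   boundedness. *)
Definition has_dim (X : cplx) (v : {ffun G -> nat}) : Prop :=
  exists (M : cplx) (n : G -> int -> nat),
    [/\ iso_K X M, minimal M, chain_type M n &
        forall i, v i = \big[addn/0%N]_(k \in [set: int]) n i k].

Definition chi (c : cplx -> Prop) : {ffun G -> nat} :=
  xget [ffun=> 0%N] (fun v => exists2 X, c X & has_dim X v).

End HeartK00.

Definition bijective_between (T U : Type) (P : T -> Prop) (Q : U -> Prop)
    (f : T -> U) : Prop :=
  [/\ forall x, P x -> Q (f x),
      forall x y, P x -> P y -> f x = f y -> x = y
    & forall y, Q y -> exists2 x, P x & f x = y].

(* Main.v *)
From HB Require Import structures.
Require Import Defs.
From mathcomp Require Import all_boot all_order all_algebra.
From mathcomp Require Import all_classical reals complex.
From mathcomp Require Import zify ring lra.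

(* An object of K^0_0 is determined by the multiplicity spaces of the P_i<-k>[-k].
   For degree reasons its differential has entries in the arrows i -> j of the
   given orientation only, from degree k to degree k + 1; d d = 0 is automatic,
   because such arrows compose to zero, and homotopies vanish. So K^0_0 is
   equivalent to the category of representations of the quiver with vertices
   (k, i) and arrows (k, i) -> (k + 1, j), which is a disjoint union of copies of
   the oriented Dynkin tree permuted by the shift <1>[1]. The theorem is thereby
   Gabriel's theorem, proved with reflection functors: reflecting at a sink i
   applies the simple reflection s_i to the dimension vector of an indecomposable
   other than the simple at i. Running through the vertices by decreasing height
   restores the orientation and applies a Coxeter element, some power of which
   makes any nonzero vector leave the positive cone, so that a simple
   representation is met on the way. *)

Set Implicit Arguments.
Unset Strict Implicit.
Unset Printing Implicit Defensive.

Import Order.TTheory GRing.Theory Num.Theory.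

Local Open Scope ring_scope.

(** * Short exact families of matrices *)

(** Gabriel's theorem is proved one dimension vector at a time: [gabriel_at] bundles existence,
    uniqueness and the root property, so that one induction carries all three through each
    reflection. Indecomposability is expressed by idempotent endomorphisms, hence transfers as soon
    as morphisms correspond. The reflection functor is not built as a function. The record
    [reflection] relates V and V', because dimensions that agree only propositionally would
    otherwise enter the types of matrices. An orientation is encoded by a height function, which
    exists because the diagram is a tree; lowering a sink by two turns it into a source. Positive
    definiteness of the ADE form does two jobs: it makes Coxeter orbits finite, and it excludes
    nonzero fixed vectors. On the homological side everything is done in coordinates: with respect
    to generators fixed by the e_i, bidegree 0 maps are scalar matrices, and isomorphisms,
    idempotents and decompositions in the homotopy category become exact matrix identities. *)

Lemma dep_choice (T : Type) (U : T -> Type) (P : forall t, U t -> Prop) :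
  (forall t, exists u, P t u) -> exists f : forall t, U t, forall t, P t (f t).
Proof. by move=> h; exists (fun t => projT1 (cid (h t))) => t; case: cid. Qed.

(** A value given at [g x] has to be transported to [U t] along [g x = t]. Injectivity of [g] fixes
    [x] and proof irrelevance fixes the equality, so the transport is unambiguous. *)
Lemma inj_extend (S T : Type) (g : S -> T) (U : T -> Type)
    (f : forall x, U (g x)) (f0 : forall t, U t) : injective g ->
  exists2 F : forall t, U t, forall x, F (g x) = f x &
    forall t, (forall x, g x <> t) -> F t = f0 t.
Proof.
move=> ginj; have /dep_choice [F hF] : forall t, exists v : U t,
    (forall x (e : g x = t), v = ecast z (U z) e (f x)) /\ ((forall x, g x <> t) -> v = f0 t).
  move=> t; have [[x0 e0]|nx] := pselect (exists x, g x = t); last first.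
    by exists (f0 t); split=> // x e; case: nx; exists x.
  exists (ecast z (U z) e0 (f x0)); split=> [x e|h]; last by case: (h _ e0).
  have xx : x = x0 by apply: ginj; rewrite e e0.
  by subst x; rewrite (Prop_irrelevance e e0).
exists F => [x|t]; first by rewrite ((hF (g x)).1 x erefl).
exact: (hF t).2.
Qed.

Section ExactFamily.
Variable K : fieldType.

(* 0 -> K^r -> (+)_(P j) K^(d j) -> K^m -> 0 is short exact, where matrices act
   on row vectors. *)
Record exact_family (J : finType) (P : pred J) (d : J -> nat) (r m : nat)
    (B : forall j, 'M[K]_(r, d j)) (A : forall j, 'M[K]_(d j, m)) : Prop := ExactFamily {
  ex_comp : \sum_(j | P j) B j *m A j = 0;
  ex_mono : forall n (X : 'M[K]_(n, r)), (forall j, P j -> X *m B j = 0) -> X = 0;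
  ex_epi : forall n (X : 'M[K]_(m, n)), (forall j, P j -> A j *m X = 0) -> X = 0;
  ex_ker : forall n (X : forall j, 'M[K]_(n, d j)), \sum_(j | P j) X j *m A j = 0 ->
    exists Y, forall j, P j -> X j = Y *m B j;
  ex_coker : forall n (X : forall j, 'M[K]_(d j, n)), \sum_(j | P j) B j *m X j = 0 ->
    exists Y, forall j, P j -> X j = A j *m Y;
  ex_dim : (r + m = \sum_(j | P j) d j)%N }.

(** Transposition exchanges kernels and cokernels, which spares a second construction in
    [exact_family_cokernel]. *)
Lemma exact_family_tr (J : finType) (P : pred J) d r m
    (B : forall j, 'M[K]_(r, d j)) (A : forall j, 'M[K]_(d j, m)) :
  exact_family P B A -> exact_family P (fun j => (A j)^T) (fun j => (B j)^T).
Proof.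
case=> cmp mono epi ker coker dm; split.
- apply: trmx_inj; rewrite linear_sum /= trmx0 -[RHS]cmp.
  by apply: eq_bigr => j _; rewrite trmx_mul !trmxK.
- move=> n X hX; apply: trmx_inj; rewrite trmx0; apply: epi => j Pj.
  by apply: trmx_inj; rewrite trmx_mul trmxK trmx0 hX.
- move=> n X hX; apply: trmx_inj; rewrite trmx0; apply: mono => j Pj.
  by apply: trmx_inj; rewrite trmx_mul trmxK trmx0 hX.
- move=> n X hX; have [|Y hY] := coker n (fun j => (X j)^T).
    apply: trmx_inj; rewrite linear_sum /= trmx0 -[RHS]hX.
    by apply: eq_bigr => j _; rewrite trmx_mul trmxK.
  by exists Y^T => j Pj; apply: trmx_inj; rewrite trmx_mul !trmxK hY.
- move=> n X hX; have [|Y hY] := ker n (fun j => (X j)^T).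
    apply: trmx_inj; rewrite linear_sum /= trmx0 -[RHS]hX.
    by apply: eq_bigr => j _; rewrite trmx_mul trmxK.
  by exists Y^T => j Pj; apply: trmx_inj; rewrite trmx_mul !trmxK hY.
- by rewrite addnC.
Qed.

(** The columns of [H] and of [C] lie in the annihilator of the left kernel of [H]; by comparing
    ranks, those of [H] span it, so [C] factors through [H]. *)
Lemma sub_mulmx_kermx N m n (H : 'M[K]_(N, m)) (C : 'M[K]_(N, n)) :
  kermx H *m C = 0 -> exists Y, C = H *m Y.
Proof.
move=> kC; have sH : (H^T <= kermx (kermx H)^T)%MS.
  by apply/sub_kermxP; rewrite -trmx_mul mulmx_ker trmx0.
have : (kermx (kermx H)^T <= H^T)%MS.
  rewrite -(mxrank_leqif_sup sH).
  by rewrite mxrank_ker !mxrank_tr mxrank_ker subKn // rank_leq_row.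
have : (C^T <= kermx (kermx H)^T)%MS.
  by apply/sub_kermxP; rewrite -trmx_mul kC trmx0.
move=> s1 s2; have /submxP [Y hY] := submx_trans s1 s2.
by exists Y^T; rewrite -[C]trmxK hY trmx_mul trmxK.
Qed.

Lemma exact_family_kernel (J : finType) (P : pred J) (d : J -> nat) m
    (A : forall j, 'M[K]_(d j, m)) :
  (forall n (X : 'M[K]_(m, n)), (forall j, P j -> A j *m X = 0) -> X = 0) ->
  exists r (B : forall j, 'M[K]_(r, d j)), exact_family P B A.
Proof.
move=> epi; pose p (i : 'I_#|P|) := d (enum_val i).
have sumE (M : nmodType) (F : J -> M) : \sum_(j | P j) F j = \sum_(i < #|P|) F (enum_val i).
  exact: (big_enum_val F).
pose H := \mxcol_(i < #|P|) (A (enum_val i) : 'M_(p i, m)).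
pose Bm := row_base (kermx H).
(* The blocks of the kernel basis are indexed by an enumeration of [P]; the family over [J] extends
   them by zero. *)
have [B hB _] := inj_extend (U := fun j => 'M[K]_(\rank (kermx H), d j))
  (fun i => submxrow Bm i) (fun j => 0) (@enum_val_inj _ P).
have BmE : Bm = \mxrow_(i < #|P|) (B (enum_val i) : 'M_(_, p i)).
  by rewrite -[LHS]submxrowK; apply/mxrowP => i; rewrite !mxrowK hB.
have BH : Bm *m H = 0 by apply/sub_kermxP; rewrite eq_row_base.
have Hinj n (X : 'M[K]_(m, n)) : H *m X = 0 -> X = 0.
  rewrite mxcol_mul => HX; apply: epi => j Pj.
  have e0 := enum_rankK_in Pj Pj; rewrite -e0.
  by have := congr1 (fun Z => submxcol Z (enum_rank_in Pj j)) HX; rewrite mxcolK submxcol0.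
(* A rank below [m] would give a nonzero matrix killed by [H], against [Hinj]. *)
have rH : \rank H = m.
  apply/eqP; rewrite eqn_leq rank_leq_col leqNgt; apply/negP => lt.
  have : kermx H^T != 0.
    by rewrite -mxrank_eq0 mxrank_ker mxrank_tr subn_eq0 -ltnNge.
  case/negP; apply/eqP/trmx_inj; rewrite trmx0; apply: Hinj.
  by apply: trmx_inj; rewrite trmx_mul trmxK mulmx_ker trmx0.
exists (\rank (kermx H)), B; split => //.
- rewrite sumE -[LHS](mul_mxrow_mxcol (fun i => B (enum_val i) : 'M_(_, p i))) -BmE.
  exact: BH.
- move=> n X hX; have : X *m Bm = 0.
    by rewrite BmE mul_mxrow; apply/mxrowP => i; rewrite mxrowK submxrow0 hX //;
      exact: (enum_valP i).
  have /row_free_inj inj : row_free Bm := row_base_free _.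
  by move=> XB; apply: inj; rewrite XB mul0mx.
- move=> n X; rewrite sumE => hX.
  pose Xr := \mxrow_(i < #|P|) (X (enum_val i) : 'M_(_, p i)).
  have : (Xr <= Bm)%MS.
    by rewrite eq_row_base; apply/sub_kermxP; rewrite mul_mxrow_mxcol.
  case/submxP => Y; rewrite BmE mul_mxrow => XY; exists Y => j Pj.
  rewrite -(enum_rankK_in Pj Pj); move: (enum_rank_in Pj j) => i.
  by have := congr1 (fun Z => submxrow Z i) XY; rewrite !mxrowK.
- move=> n X; rewrite sumE => hX.
  pose C := \mxcol_(i < #|P|) (X (enum_val i) : 'M_(p i, _)).
  have [|Y CY] := @sub_mulmx_kermx _ _ _ H C.
    have : Bm *m C = 0 by rewrite BmE mul_mxrow_mxcol.
    have /submxP [Z ZB] : (kermx H <= Bm)%MS by rewrite eq_row_base.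
    move=> BC; transitivity (Z *m Bm *m C); first by congr (_ *m C).
    by rewrite -mulmxA BC mulmx0.
  exists Y => j Pj.
  rewrite -(enum_rankK_in Pj Pj); move: (enum_rank_in Pj j) => i.
  by have := congr1 (fun Z => submxcol Z i) CY; rewrite mxcol_mul !mxcolK.
- rewrite mxrank_ker rH subnK; last by rewrite -{1}rH rank_leq_row.
  by rewrite (big_enum_val (A := P) d).
Qed.

Lemma exact_family_cokernel (J : finType) (P : pred J) (d : J -> nat) r
    (B : forall j, 'M[K]_(r, d j)) :
  (forall n (X : 'M[K]_(n, r)), (forall j, P j -> X *m B j = 0) -> X = 0) ->
  exists m (A : forall j, 'M[K]_(d j, m)), exact_family P B A.
Proof.
move=> mono; have [|m [A /exact_family_tr ex]] :=
    @exact_family_kernel _ P d r (fun j => (B j)^T).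
  move=> n X hX; apply: trmx_inj; rewrite trmx0; apply: mono => j Pj.
  by apply: trmx_inj; rewrite trmx_mul trmxK trmx0 hX.
exists m, (fun j => (A j)^T).
suff -> : B = fun j => (B j)^T^T by [].
by apply: functional_extensionality_dep => j; rewrite trmxK.
Qed.

End ExactFamily.

(** * Quiver representations and reflections *)

Lemma dep_update (I : eqType) (U : I -> Type) i (u : U i) (F0 : forall j, U j) :
  exists2 F : forall j, U j, F i = u & forall j, j != i -> F j = F0 j.
Proof.
have [|F Fi F0E] := inj_extend (g := fun _ : unit => i) (fun=> u) F0; first by do 2 case.
by exists F => [|j /eqP ji]; [exact: Fi tt|apply: F0E => _ /esym].
Qed.

(** Matrices are recorded for all pairs, and only those along arrows enter [rhom]; the orientation
    can thus change without a change of type. *)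
Record rep (K : fieldType) (T : Type) := Rep {
  rdim : T -> nat;
  rmap : forall s t, 'M[K]_(rdim s, rdim t) }.

Definition rpull (K : fieldType) (S T : Type) (g : S -> T) (V : rep K T) : rep K S :=
  Rep (fun s t => rmap V (g s) (g t)).

Section Representations.
Variables (K : fieldType) (T : Type) (o : T -> T -> bool).
Implicit Types V W U : rep K T.

Definition rfam V W := forall t, 'M[K]_(rdim V t, rdim W t).

Definition rhom V W (f : rfam V W) : Prop :=
  forall s t, o s t -> rmap V s t *m f t = f s *m rmap W s t.

Definition riso V W : Prop :=
  exists (f : rfam V W) (g : rfam W V),
  [/\ rhom f, rhom g, forall t, f t *m g t = 1%:M & forall t, g t *m f t = 1%:M].

(** Stated by idempotents rather than direct sums, so that it transfers along any correspondence of
    endomorphisms that respects composition. *)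
Definition rindec V : Prop :=
  (exists t, rdim V t != 0%N) /\
  forall e : rfam V V, rhom e -> (forall t, e t *m e t = e t) ->
    (forall t, e t = 0) \/ (forall t, e t = 1%:M).

Lemma rhom_comp V W U (f : rfam V W) (g : rfam W U) :
  rhom f -> rhom g -> rhom (fun t => f t *m g t).
Proof. by move=> hf hg s t st; rewrite mulmxA hf // -!mulmxA hg. Qed.

Lemma rhom1 V : rhom (fun t => 1%:M : 'M_(rdim V t, rdim V t)).
Proof. by move=> s t _; rewrite mulmx1 mul1mx. Qed.

Lemma rhom0 V W : rhom (fun t => 0 : 'M_(rdim V t, rdim W t)).
Proof. by move=> s t _; rewrite mulmx0 mul0mx. Qed.

Lemma riso_sym V W : riso V W -> riso W V.
Proof. by move=> [f [g [? ? ? ?]]]; exists g, f. Qed.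

Lemma mulmx1_dim m n (A : 'M[K]_(m, n)) (B : 'M[K]_(n, m)) :
  A *m B = 1%:M -> B *m A = 1%:M -> m = n.
Proof.
move=> AB BA; apply/eqP; rewrite eqn_leq -{1}(mxrank1 K m) -AB.
rewrite (leq_trans (mxrankM_maxr _ _)) ?rank_leq_row //=.
by rewrite -{1}(mxrank1 K n) -BA (leq_trans (mxrankM_maxr _ _)) // rank_leq_row.
Qed.

Lemma riso_dim V W : riso V W -> forall t, rdim V t = rdim W t.
Proof. by move=> [f [g [_ _ fg gf]]] t; exact: mulmx1_dim (fg t) (gf t). Qed.

End Representations.

(** * Reflection at a sink *)

Section Reflection.
Variables (K : fieldType) (I : finType) (o o' : rel I) (i : I) (N : pred I).
Hypotheses (oi : forall j, o j i = N j) (io : forall j, o i j = false).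
Hypotheses (io' : forall j, o' i j = N j) (oi' : forall j, o' j i = false).
Hypothesis eqo : forall s t, s != i -> t != i -> o s t = o' s t.
Hypothesis Ni : ~~ N i.
Implicit Types V W : rep K I.

Lemma N_neq j : N j -> j != i.
Proof. by apply: contraL => /eqP ->. Qed.

(* i is a sink of o and a source of o', and V' is the image of V under the
   reflection functor at i: V'_i is the kernel of (+)_j V_j -> V_i, and V the
   image of V' under the inverse functor. Away from i the two agree up to the
   isomorphism phi, which avoids an equality of dimensions in types. *)
Record reflection V V' := Reflection {
  rphi : rfam V V';
  rpsi : rfam V' V;
  rker : forall j, 'M[K]_(rdim V' i, rdim V j);
  rphiK : forall j, j != i -> rphi j *m rpsi j = 1%:M;
  rpsiK : forall j, j != i -> rpsi j *m rphi j = 1%:M;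
  rphi_hom : forall s t, s != i -> t != i -> o s t ->
    rmap V s t *m rphi t = rphi s *m rmap V' s t;
  rker_map : forall j, N j -> rker j *m rphi j = rmap V' i j;
  rker_exact : exact_family N rker (fun j => rmap V j i) }.

Lemma rpsi_hom V V' (RV : reflection V V') s t : s != i -> t != i -> o s t ->
  rmap V' s t *m rpsi RV t = rpsi RV s *m rmap V s t.
Proof.
move=> si ti st; have := rphi_hom RV si ti st.
move=> /(congr1 (fun X => rpsi RV s *m X *m rpsi RV t)).
by rewrite -!mulmxA rphiK // mulmx1 => ->; rewrite !mulmxA rpsiK // mul1mx.
Qed.

Lemma rker_psi V V' (RV : reflection V V') j : N j -> rmap V' i j *m rpsi RV j = rker RV j.
Proof. by move=> Nj; rewrite -(rker_map RV) // -mulmxA rphiK ?mulmx1 // N_neq. Qed.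

Section Transfer.
Variables (V V' W W' : rep K I) (RV : reflection V V') (RW : reflection W W').

(** Away from [i] the morphism is conjugated by the identifications; at [i] it is the map induced
    between kernels, which [ex_ker] provides. *)
Lemma reflect_hom (f : rfam V W) : rhom o f ->
  exists2 f' : rfam V' W', rhom o' f' &
    forall j, j != i -> f' j = rpsi RV j *m f j *m rphi RW j.
Proof.
move=> hf.
have [|Y hY] := ex_ker (rker_exact RW) (X := fun j => rker RV j *m f j).
  under eq_bigr => j Nj do rewrite -mulmxA -hf ?oi // mulmxA.
  by rewrite -mulmx_suml (ex_comp (rker_exact RV)) mul0mx.
(* The type of the value depends on [j], so both cases are specified under a condition on [j] and
   chosen together. *)
have /dep_choice [f' hf'] : forall j, exists m : 'M_(rdim V' j, rdim W' j),
   (j != i -> m = rpsi RV j *m f j *m rphi RW j) /\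
   (j = i -> forall l, N l ->
     rmap V' j l *m (rpsi RV l *m f l *m rphi RW l) = m *m rmap W' j l).
  move=> j; have [->|ji] := eqVneq j i; last first.
    by exists (rpsi RV j *m f j *m rphi RW j); split => // /eqP; rewrite (negPf ji).
  exists Y; split=> // _ l Nl.
  by rewrite !mulmxA rker_psi // hY // -mulmxA rker_map.
exists f'; last by move=> j /(hf' j).1.
move=> s t st; have ti : t != i by apply: contraTneq st => ->; rewrite oi'.
rewrite (hf' t).1 //; have [si|si] := eqVneq s i.
  by subst s; apply: (hf' i).2 => //; rewrite -io'.
have st2 : o s t by rewrite eqo.
rewrite (hf' s).1 // !mulmxA rpsi_hom // -!mulmxA -rphi_hom //.
by rewrite ![rmap V s t *m _]mulmxA hf // !mulmxA.
Qed.

(** The space of [W'] at [i] embeds into the sum of the neighbouring spaces, so a morphism into it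
    is determined away from [i]. *)
Lemma reflect_hom_uniq (f' g' : rfam V' W') : rhom o' f' -> rhom o' g' ->
  (forall j, j != i -> f' j = g' j) -> forall j, f' j = g' j.
Proof.
move=> hf hg fg j; have [->|/fg //] := eqVneq j i.
apply/subr0_eq; apply: (ex_mono (rker_exact RW)) => l Nl.
apply/eqP; rewrite mulmxBl subr_eq0; apply/eqP.
have li := N_neq Nl; have := fg _ li => /(congr1 (mulmx (rmap V' i l))).
rewrite hf ?io' // hg ?io' // => /(congr1 (fun X => X *m rpsi RW l)).
by rewrite -!mulmxA rker_psi.
Qed.

(** Dual to [reflect_hom]: the value at [i] is induced between cokernels, by [ex_coker]. *)
Lemma coreflect_hom (f' : rfam V' W') : rhom o' f' ->
  exists2 f : rfam V W, rhom o f &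
    forall j, j != i -> f j = rphi RV j *m f' j *m rpsi RW j.
Proof.
move=> hf'.
have hB l : N l -> rker RV l *m (rphi RV l *m f' l *m rpsi RW l) = f' i *m rker RW l.
  by move=> Nl; rewrite !mulmxA rker_map // hf' ?io' // -(rker_map RW) // -!mulmxA rphiK ?mulmx1 // N_neq.
have [|Y hY] := ex_coker (rker_exact RV)
    (X := fun j => rphi RV j *m f' j *m rpsi RW j *m rmap W j i).
  under eq_bigr => j Nj do rewrite mulmxA hB // -mulmxA.
  by rewrite -mulmx_sumr (ex_comp (rker_exact RW)) mulmx0.
have /dep_choice [f hf] : forall j, exists m : 'M_(rdim V j, rdim W j),
   (j != i -> m = rphi RV j *m f' j *m rpsi RW j) /\
   (j = i -> forall l, N l ->
     rmap V l j *m m = rphi RV l *m f' l *m rpsi RW l *m rmap W l j).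
  move=> j; have [->|ji] := eqVneq j i; last first.
    by exists (rphi RV j *m f' j *m rpsi RW j); split => // /eqP; rewrite (negPf ji).
  by exists Y; split=> // _ l Nl; rewrite -hY.
exists f; last by move=> j /(hf j).1.
move=> s t st; have si : s != i by apply: contraTneq st => ->; rewrite io.
rewrite (hf s).1 //; have [ti|ti] := eqVneq t i.
  by subst t; apply: (hf i).2 => //; rewrite -oi.
have st2 : o' s t by rewrite -eqo.
rewrite (hf t).1 // !mulmxA rphi_hom // -(mulmxA _ (rpsi RW s)).
by rewrite -(rpsi_hom RW si ti st) // !mulmxA -(mulmxA _ (rmap V' s t)) hf' // !mulmxA.
Qed.

Lemma coreflect_hom_uniq (f g : rfam V W) : rhom o f -> rhom o g ->
  (forall j, j != i -> f j = g j) -> forall j, f j = g j.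
Proof.
move=> hf hg fg j; have [->|/fg //] := eqVneq j i.
apply/subr0_eq; apply: (ex_epi (rker_exact RV)) => l Nl.
by rewrite mulmxBr hf ?oi // hg ?oi // fg ?subrr // N_neq.
Qed.

End Transfer.

(** Both composites agree with the identity away from [i], hence everywhere by
    [coreflect_hom_uniq]. *)
Lemma coreflect_riso V V' W W' : reflection V V' -> reflection W W' ->
  riso o' V' W' -> riso o V W.
Proof.
move=> RV RW [f' [g' [hf' hg' fg gf]]].
have [f hf fE] := coreflect_hom RV RW hf'.
have [g hg gE] := coreflect_hom RW RV hg'.
exists f, g; split=> //.
- apply: (coreflect_hom_uniq RV (f := fun t => f t *m g t) (g := fun t => 1%:M));
    [exact: rhom_comp|exact: rhom1|move=> j ji].
  by rewrite fE // gE // !mulmxA -[_ *m rpsi RW j *m _]mulmxA rpsiK // mulmx1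
     -[_ *m f' j *m _]mulmxA fg mulmx1 rphiK.
- apply: (coreflect_hom_uniq RW (f := fun t => g t *m f t) (g := fun t => 1%:M));
    [exact: rhom_comp|exact: rhom1|move=> j ji].
  by rewrite fE // gE // !mulmxA -[_ *m rpsi RV j *m _]mulmxA rpsiK // mulmx1
     -[_ *m g' j *m _]mulmxA gf mulmx1 rphiK.
Qed.

Lemma exact_dim0 V V' : reflection V V' ->
  (forall j, rdim V j = 0%N) <-> (forall j, rdim V' j = 0%N).
Proof.
move=> RV; have dE j : j != i -> rdim V j = rdim V' j.
  by move=> ji; apply: (mulmx1_dim (rphiK RV ji)); exact: rpsiK.
have := ex_dim (rker_exact RV) => dim.
split=> h j; have [->|ji] := eqVneq j i; try by rewrite ?dE // -dE.
  move: dim; rewrite big1 // => /eqP; by rewrite addn_eq0 => /andP[/eqP].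
move: dim; rewrite big1 => [/eqP|l Nl]; last by rewrite dE ?N_neq.
by rewrite addn_eq0 => /andP[_ /eqP].
Qed.

(** An idempotent of [V'] is carried to one of [V], and the alternative between 0 and 1 is carried
    back by uniqueness. *)
Lemma reflect_rindec V V' : reflection V V' -> rindec o V -> rindec o' V'.
Proof.
move=> RV [nz idem]; split.
  apply: contrapT => z; have /(exact_dim0 RV) z' : forall j, rdim V' j = 0%N.
    by move=> j; apply: contrapT => /eqP nj; apply: z; exists j.
  by case: nz => t; rewrite z'.
move=> e' he' ee'; have [e he eE] := coreflect_hom RV RV he'.
have ee : forall t, e t *m e t = e t.
  apply: (coreflect_hom_uniq RV (f := fun t => e t *m e t)) => //; first exact: rhom_comp.
  move=> j ji; rewrite eE // !mulmxA -[_ *m rpsi RV j *m _]mulmxA rpsiK // mulmx1.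
  by rewrite -(mulmxA _ (e' j) (e' j)) ee'.
have e'E j : j != i -> e' j = rpsi RV j *m e j *m rphi RV j.
  by move=> ji; rewrite eE // !mulmxA rpsiK // mul1mx -mulmxA rpsiK // mulmx1.
case: (idem e he ee) => h; [left|right].
  apply: (reflect_hom_uniq RV (g' := fun t => 0)) => //; first exact: rhom0.
  by move=> j ji; rewrite e'E // h mulmx0 mul0mx.
apply: (reflect_hom_uniq RV (g' := fun t => 1%:M)) => //; first exact: rhom1.
by move=> j ji; rewrite e'E // h mulmx1 rpsiK.
Qed.

Lemma coreflect_rindec V V' : reflection V V' -> rindec o' V' -> rindec o V.
Proof.
move=> RV [nz idem]; split.
  apply: contrapT => z; have /(exact_dim0 RV) z' : forall j, rdim V j = 0%N.
    by move=> j; apply: contrapT => /eqP nj; apply: z; exists j.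
  by case: nz => t; rewrite z'.
move=> e he ee; have [e' he' e'E] := reflect_hom RV RV he.
have ee' : forall t, e' t *m e' t = e' t.
  apply: (reflect_hom_uniq RV (f' := fun t => e' t *m e' t)) => //; first exact: rhom_comp.
  move=> j ji; rewrite e'E // !mulmxA -[_ *m rphi RV j *m _]mulmxA rphiK // mulmx1.
  by rewrite -(mulmxA _ (e j) (e j)) ee.
have eE j : j != i -> e j = rphi RV j *m e' j *m rpsi RV j.
  by move=> ji; rewrite e'E // !mulmxA rphiK // mul1mx -mulmxA rphiK // mulmx1.
case: (idem e' he' ee') => h; [left|right].
  apply: (coreflect_hom_uniq RV (g := fun t => 0)) => //; first exact: rhom0.
  by move=> j ji; rewrite eE // h mulmx0 mul0mx.
apply: (coreflect_hom_uniq RV (g := fun t => 1%:M)) => //; first exact: rhom1.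
by move=> j ji; rewrite eE // h mulmx1 rphiK.
Qed.

(* The simple summands at i split off the cokernel of (+)_j V_j -> V_i. *)
Lemma rindec_epi V : rindec o V ->
  (forall n (X : 'M[K]_(rdim V i, n)), (forall j, N j -> rmap V j i *m X = 0) -> X = 0) \/
  (rdim V i = 1%N /\ forall j, j != i -> rdim V j = 0%N).
Proof.
move=> [_ idem]; case: (pselect (forall n (X : 'M[K]_(rdim V i, n)),
  (forall j, N j -> rmap V j i *m X = 0) -> X = 0)) => [h|]; first by left.
move=> /existsNP [n /existsNP [X /not_implyP [hX /eqP X0]]]; right.
have [c Xc] : exists c, col c X != 0.
  apply: contrapT => h; case/negP: X0; apply/eqP/matrixP => a c.
  have /eqP/matrixP /(_ a 0) : col c X == 0 by apply: contrapT => /negP ?; apply: h; exists c.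
  by rewrite !mxE.
set x := col c X in Xc.
have Ax j : N j -> rmap V j i *m x = 0.
  by move=> Nj; rewrite /x colE mulmxA hX // mul0mx.
have [u ux] : exists u : 'rV_(rdim V i), u *m x = 1%:M.
  have : row_full x.
    by rewrite /row_full eqn_leq rank_leq_col lt0n mxrank_eq0.
  by move=> /row_fullP [u ?]; exists u.
(* [x] is a linear form on V_i that vanishes on all images, and [u] a vector where it takes the
   value 1. The projection onto the line of [u] along the kernel of [x], extended by 0, is an
   idempotent endomorphism. *)
have [e ei e0] := dep_update (U := fun j => 'M[K]_(rdim V j)) (x *m u) (fun j => 0).
have he : rhom o e.
  move=> s t st; have si : s != i by apply: contraTneq st => ->; rewrite io.
  rewrite (e0 s) // mul0mx; have [ti|ti] := eqVneq t i.
    by subst t; rewrite ei mulmxA Ax ?mul0mx // -oi.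
  by rewrite e0 // mulmx0.
have ee t : e t *m e t = e t.
  have [->|ti] := eqVneq t i; last by rewrite e0 // mul0mx.
  by rewrite ei mulmxA -[x *m u *m x]mulmxA ux mulmx1.
case: (idem e he ee) => h.
  by move/eqP: Xc; case; rewrite -[x]mulmx1 -ux mulmxA -ei h mul0mx.
split.
  apply: (@mulmx1_dim K _ _ x u) => //; by rewrite -ei.
move=> j ji; have := h j; rewrite e0 // => /esym /(congr1 mxrank).
by rewrite mxrank1 mxrank0.
Qed.

Lemma exact_family_iso (P : pred I) (d d' : I -> nat) r m
    (B : forall j, 'M[K]_(r, d' j)) (A : forall j, 'M[K]_(d' j, m))
    (phi : forall j, 'M[K]_(d j, d' j)) (psi : forall j, 'M[K]_(d' j, d j)) :
  (forall j, P j -> phi j *m psi j = 1%:M) -> (forall j, P j -> psi j *m phi j = 1%:M) ->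
  exact_family P B A -> exact_family P (fun j => B j *m psi j) (fun j => phi j *m A j).
Proof.
move=> phiK psiK [cmp mono epi ker coker dm]; split.
- rewrite -[RHS]cmp; apply: eq_bigr => j Pj.
  by rewrite mulmxA -[_ *m psi j *m _]mulmxA psiK // mulmx1.
- move=> n X hX; apply: mono => j Pj.
  by rewrite -[B j]mulmx1 -(psiK _ Pj) !mulmxA -(mulmxA X) hX // mul0mx.
- move=> n X hX; apply: epi => j Pj.
  by rewrite -[A j]mul1mx -(psiK _ Pj) -!mulmxA (mulmxA (phi j)) hX // mulmx0.
- move=> n X hX; have [|Y hY] := ker n (fun j => X j *m phi j).
    by rewrite -[RHS]hX; apply: eq_bigr => j Pj; rewrite mulmxA.
  by exists Y => j Pj; rewrite mulmxA -hY // -mulmxA phiK // mulmx1.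
- move=> n X hX; have [|Y hY] := coker n (fun j => psi j *m X j).
    by rewrite -[RHS]hX; apply: eq_bigr => j Pj; rewrite mulmxA.
  by exists Y => j Pj; rewrite -mulmxA -hY // mulmxA phiK // mul1mx.
- by rewrite dm; apply: eq_bigr => j Pj; rewrite (mulmx1_dim (phiK _ Pj) (psiK _ Pj)).
Qed.

(** Away from [i] the two dimensions are equal but not convertible, so partial identity matrices
    stand in for identities. *)
Lemma dim_update (d : I -> nat) (r : nat) :
  exists2 d' : I -> nat, d' i = r &
  exists (phi : forall j, 'M[K]_(d j, d' j)) (psi : forall j, 'M[K]_(d' j, d j)),
  (forall j, j != i -> phi j *m psi j = 1%:M) /\ (forall j, j != i -> psi j *m phi j = 1%:M).
Proof.
exists (fun j => if j == i then r else d j); first by rewrite eqxx.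
exists (fun j => pid_mx (d j)), (fun j => pid_mx (d j)).
by split=> j /negPf ->; rewrite !pid_mx_1 mulmx1.
Qed.

Lemma reflection_exists V :
  (forall n (X : 'M[K]_(rdim V i, n)), (forall j, N j -> rmap V j i *m X = 0) -> X = 0) ->
  exists V', inhabited (reflection V V').
Proof.
move=> /exact_family_kernel [r [B ex]].
have [d' di [phi [psi [phiK psiK]]]] := dim_update (rdim V) r; subst r.
have [F Fi F0] := dep_update (U := fun s => forall t, 'M[K]_(d' s, d' t))
  (fun t => B t *m phi t) (fun s t => psi s *m rmap V s t *m phi t).
exists (Rep F); constructor; apply: (@Reflection V (Rep F) phi psi B) => //=.
- by move=> s t si ti st; rewrite F0 // !mulmxA phiK // mul1mx.
- by move=> j _; rewrite Fi.
Qed.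

Lemma coreflection_exists V' :
  (forall n (X : 'M[K]_(n, rdim V' i)), (forall j, N j -> X *m rmap V' i j = 0) -> X = 0) ->
  exists V, inhabited (reflection V V').
Proof.
move=> /exact_family_cokernel [m [A ex]].
have [d di [psi [phi [psiK phiK]]]] := dim_update (rdim V') m; subst m.
(* The target comes first here, because the matrices to be replaced are those of arrows into [i]. *)
have [F Fi F0] := dep_update (U := fun t => forall s, 'M[K]_(d s, d t))
  (fun s => phi s *m A s) (fun t s => phi s *m rmap V' s t *m psi t).
exists (Rep (fun s t => F t s)); constructor.
apply: (@Reflection (Rep (fun s t => F t s)) V' phi psi (fun j => rmap V' i j *m psi j)) => //=.
- by move=> s t si ti st; rewrite F0 // -!mulmxA psiK // mulmx1.
- by move=> j Nj; rewrite -mulmxA psiK ?mulmx1 // N_neq.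
- rewrite Fi; by apply: exact_family_iso ex => j /N_neq; [exact: phiK|exact: psiK].
Qed.

End Reflection.

Section Dual.
Variables (K : fieldType) (T : Type).

Definition rdual (V : rep K T) : rep K T := Rep (fun s t => (rmap V t s)^T).

Lemma rdual_rindec (o : T -> T -> bool) V :
  rindec o V -> rindec (fun s t => o t s) (rdual V).
Proof.
move=> [nz idem]; split=> // e he ee.
case: (idem (fun t => (e t)^T)).
- move=> s t st; apply: trmx_inj; rewrite !trmx_mul !trmxK.
  by have := he t s st => /= ->.
- by move=> t; rewrite -trmx_mul ee.
- by move=> h; left=> t; apply: trmx_inj; rewrite h trmx0.
- by move=> h; right=> t; apply: trmx_inj; rewrite h trmx1.
Qed.

End Dual.

(** Transposition turns the source [i] into a sink, where [rindec_epi] applies. *)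
Lemma rindec_mono (K : fieldType) (I : finType) (o : rel I) i (N : pred I) V :
  (forall j, o i j = N j) -> (forall j, o j i = false) -> rindec o V ->
  (forall n (X : 'M[K]_(n, rdim V i)), (forall j, N j -> X *m rmap V i j = 0) -> X = 0) \/
  (rdim V i = 1%N /\ forall j, j != i -> rdim V j = 0%N).
Proof.
move=> oi io /rdual_rindec/(rindec_epi oi io) [] /= h; [left|by right] => n X hX.
apply: trmx_inj; rewrite trmx0; apply: h => j Nj.
by rewrite -trmx_mul hX // trmx0.
Qed.

(** * Positivity of the ADE forms *)

(** The Tits form of the chain 0 - ... - m without the square of its end vertex, so that more of a
    diagram can be attached there. *)
Definition chain_form (x : nat -> int) (m : nat) : int :=
  \sum_(k < m) (x k ^+ 2 - x k * x k.+1).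

(* The bound -m / (2 (m + 1)) x_m ^+ 2 for chain_form is what an arm of length m
   contributes to its end vertex x_m after completing squares. *)
Lemma chain_form_ge0 x m :
  0 <= 2 * m.+1%:R * chain_form x m + m%:R * x m ^+ 2.
Proof.
elim: m => [|m IHm]; first by rewrite /chain_form big_ord0 mulr0 mul0r.
set y := _ + _ in IHm; have m1 : 0 < m.+1%:R :> int by rewrite ltr0n.
rewrite -(pmulr_rge0 _ m1).
suff -> : m.+1%:R * (2 * m.+2%:R * chain_form x m.+1 + m.+1%:R * x m.+1 ^+ 2) =
   m.+2%:R * y + (m.+2%:R * x m - m.+1%:R * x m.+1) ^+ 2.
  by rewrite addr_ge0 ?sqr_ge0 // mulr_ge0 // ler0n.
rewrite /y /chain_form big_ord_recr /=; move: (\sum_(_ < _) _) => s.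
by rewrite -[m.+2]addn2 -[m.+1]addn1 !natrD; ring.
Qed.

(** Peeling off the end vertex leaves [chain_form x m = - x m ^+ 2], which contradicts the bound of
    [chain_form_ge0] unless [x m = 0]. *)
Lemma chain_form_eq0 x m : x m = 0 -> chain_form x m = 0 ->
  forall k, (k <= m)%N -> x k = 0.
Proof.
elim: m => [|m IHm] xm xf k; first by rewrite leqn0 => /eqP ->.
rewrite leq_eqVlt ltnS => /predU1P[-> //|km].
have := chain_form_ge0 x m.
move: xf; rewrite /chain_form big_ord_recr /= xm mulr0 subr0 -/(chain_form x m).
move=> /eqP; rewrite addr_eq0 => /eqP xf; rewrite xf.
have -> : 2 * m.+1%:R * - x m ^+ 2 + m%:R * x m ^+ 2 = - (m.+2%:R * x m ^+ 2).
  by rewrite -[m.+2]addn2 -[m.+1]addn1 !natrD; ring.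
rewrite oppr_ge0 => le0.
have xm0 : x m = 0.
  apply/eqP; rewrite -sqrf_eq0 eq_le sqr_ge0 andbT.
  by move: le0; rewrite pmulr_rle0 // ltr0n.
by apply: IHm => //; rewrite xf xm0 expr0n oppr0.
Qed.

Lemma sqr_le0 (x : int) : x ^+ 2 <= 0 -> x = 0.
Proof. by move=> h; apply/eqP; rewrite -sqrf_eq0 eq_le h sqr_ge0. Qed.

(* Squares are completed along each arm of the diagram, from its leaf towards the
   branch vertex x2, on which 1/60 x2 ^+ 2 remains. *)
Lemma E8_form_le0 (x0 x1 x2 x3 x4 x5 x6 x7 : int) :
  x0 ^+ 2 + x1 ^+ 2 + x2 ^+ 2 + x3 ^+ 2 + x4 ^+ 2 + x5 ^+ 2 + x6 ^+ 2 + x7 ^+ 2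
   - (x0 * x1 + x1 * x2 + x2 * x3 + x3 * x4 + x4 * x5 + x5 * x6 + x2 * x7) <= 0 ->
  [/\ x0 = 0, x1 = 0, x2 = 0 & x3 = 0] /\ [/\ x4 = 0, x5 = 0, x6 = 0 & x7 = 0].
Proof.
set q := _ - _ => q0.
have : 30 * (2 * x0 - x1) ^+ 2 + 10 * (3 * x1 - 2 * x2) ^+ 2 + 30 * (2 * x7 - x2) ^+ 2
  + 30 * (2 * x6 - x5) ^+ 2 + 10 * (3 * x5 - 2 * x4) ^+ 2 + 5 * (4 * x4 - 3 * x3) ^+ 2
  + 3 * (5 * x3 - 4 * x2) ^+ 2 + 2 * x2 ^+ 2 = 120 * q by rewrite /q; ring.
move=> e; have s1 := sqr_ge0 (2 * x0 - x1); have s2 := sqr_ge0 (3 * x1 - 2 * x2).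
have s3 := sqr_ge0 (2 * x7 - x2); have s4 := sqr_ge0 (2 * x6 - x5).
have s5 := sqr_ge0 (3 * x5 - 2 * x4); have s6 := sqr_ge0 (4 * x4 - 3 * x3).
have s7 := sqr_ge0 (5 * x3 - 4 * x2); have s8 := sqr_ge0 x2.
have h8 : x2 = 0 by apply: sqr_le0; lra.
have h1 : 2 * x0 - x1 = 0 by apply: sqr_le0; lra.
have h2 : 3 * x1 - 2 * x2 = 0 by apply: sqr_le0; lra.
have h3 : 2 * x7 - x2 = 0 by apply: sqr_le0; lra.
have h4 : 2 * x6 - x5 = 0 by apply: sqr_le0; lra.
have h5 : 3 * x5 - 2 * x4 = 0 by apply: sqr_le0; lra.
have h6 : 4 * x4 - 3 * x3 = 0 by apply: sqr_le0; lra.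
have h7 : 5 * x3 - 4 * x2 = 0 by apply: sqr_le0; lra.
clear s1 s2 s3 s4 s5 s6 s7 s8 e q0 q.
by split; split; lia.
Qed.

(* Each ADE diagram is numbered so that every vertex but 0 is joined to exactly
   one vertex of smaller number. *)
Definition ade_parent (t : ade_family) (n l : nat) : nat :=
  match t with
  | FamA => l.-1
  | FamD => if l == n.-1 then (n - 3)%N else l.-1
  | FamE => if l == n.-1 then 2%N else l.-1
  end.

Lemma ade_parent_lt t n l : ade_rank t n -> (0 < l < n)%N -> (ade_parent t n l < l)%N.
Proof. by case: t => /=; try (case: eqP); lia. Qed.

Lemma ade_linkE t n k l : ade_rank t n -> (k < n)%N -> (l < n)%N ->
  ade_link t n k l = (0 < l)%N && (k == ade_parent t n l).
Proof. by case: t => /= *; try case: ifP; move=> *; apply/idP/idP; lia. Qed.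

(** When [p] is the parent function of a rooted tree, this is its Tits form: each edge is counted
    once, at its child. *)
Definition tree_form (p : nat -> nat) (n : nat) (x : nat -> int) : int :=
  \sum_(k < n) x k ^+ 2 - \sum_(1 <= l < n) x l * x (p l).

Lemma chain_formE (x : nat -> int) m :
  \sum_(k < m.+1) x k ^+ 2 - \sum_(1 <= l < m.+1) x l * x l.-1 = chain_form x m + x m ^+ 2.
Proof.
rewrite big_ord_recr /= big_add1 /= big_mkord addrAC; congr (_ + _).
by rewrite /chain_form sumrB; congr (_ - _); apply: eq_bigr => k _; rewrite mulrC.
Qed.

Lemma tree_form_le0 t n x : ade_rank t n -> tree_form (ade_parent t n) n x <= 0 ->
  forall k, (k < n)%N -> x k = 0.
Proof.
case: t => /=.
- case: n => // m _; rewrite /tree_form chain_formE.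
  have := chain_form_ge0 x m; have := sqr_ge0 (x m).
  have -> : m.+1%:R = m%:R + 1 :> int by rewrite -natr1.
  have m0 : 0 <= m%:R :> int by rewrite ler0n.
  move=> s0 c0 q0; have M1 : 0 < m%:R + 1 :> int by lra.
  have q2 : (m%:R + 1) * (chain_form x m + x m ^+ 2) <= 0 by rewrite pmulr_rle0.
  have p2 : 0 <= m%:R * x m ^+ 2 by rewrite mulr_ge0.
  have xm : x m = 0 by apply: sqr_le0; lra.
  have cf : chain_form x m = 0.
    apply/eqP; rewrite eq_le; apply/andP; split; first by move: q0; rewrite xm; lra.
    by move: c0; rewrite xm expr0n mulr0 addr0 pmulr_rge0 //; lra.
  exact: (chain_form_eq0 xm cf).
- move=> n4; have [m ->] : exists m, n = m.+3 by exists (n - 3)%N; lia.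
  rewrite /tree_form !big_ord_recr /= 2?big_nat_recr //= !subSS subn0 eqxx.
  rewrite [m.+1 == m.+2]ltn_eqF //.
  have -> : \sum_(1 <= i < m.+1) x i * x (if i == m.+2 then m else i.-1) =
            \sum_(1 <= i < m.+1) x i * x i.-1.
    apply: eq_big_nat => i /andP[_ im]; rewrite ltn_eqF //; lia.
  have := chain_formE x m; rewrite big_ord_recr /=.
  set a := \sum_(_ < _) _; set b := \sum_(_ <= _ < _) _ => E.
  have := chain_form_ge0 x m; have := sqr_ge0 (x m).
  have := sqr_ge0 (x m - 2 * x m.+1); have := sqr_ge0 (x m - 2 * x m.+2).
  rewrite -[m.+1%:R]/(m.+1%:R : int).
  have m0 : 0 <= m%:R :> int by rewrite ler0n.
  have -> : m.+1%:R = m%:R + 1 :> int by rewrite -natr1.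
  set M : int := m%:R in m0 *; have [C CE] : exists C, C =
    chain_form x m by exists (chain_form x m).
  rewrite -CE in E *.
  set z := x m in E *; set u := x m.+1; set w := x m.+2 => s1 s2 s3 c0 q0.
  (* Four times the form, with squares completed at the two leaves [u] and [w]. Multiplied by
     [M + 1], the rest is at least [2 * z ^+ 2] by [chain_form_ge0], so [z] vanishes at the branch
     vertex. *)
  have q : 4 * C + 2 * z ^+ 2 + (z - 2 * u) ^+ 2 + (z - 2 * w) ^+ 2 <= 0.
    have -> : C = a - b by lra.
    by move: q0; lra.
  have M1 : 0 <= M + 1 by lra.
  have : (M + 1) * (4 * C + 2 * z ^+ 2) <= 0 by apply: mulr_ge0_le0 => //; lra.
  move=> q2; have z0 : z = 0 by apply: sqr_le0; lra.
  have C0 : C = 0.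
    apply/eqP; rewrite eq_le; apply/andP; split; first by move: q; rewrite z0; lra.
    by move: c0; rewrite z0 expr0n mulr0 addr0 pmulr_rge0 //; lra.
  have u0 : z - 2 * u = 0 by apply: sqr_le0; lra.
  have w0 : z - 2 * w = 0 by apply: sqr_le0; lra.
  move=> k; rewrite ltnS leq_eqVlt => /predU1P[->|]; first by move: w0; rewrite -/w z0; lia.
  rewrite ltnS leq_eqVlt => /predU1P[->|]; first by move: u0; rewrite -/u z0; lia.
  by rewrite ltnS; apply: chain_form_eq0; rewrite -?CE.
- move=> n68; have : n \in [:: 6; 7; 8]%N by rewrite !inE; lia.
  rewrite !inE => /or3P[] /eqP ->.
  (* E_6 and E_7 are sub-diagrams of E_8: the missing coordinates of the long arm are set to 0. *)
  + rewrite /tree_form !big_ord_recr big_ord0 /=; do 5 rewrite big_nat_recr //=;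
      rewrite big_geq //= => q0.
    have [|[? ? ? ?] [? ? ? ?]] := E8_form_le0 (x0 := x 0%N) (x1 := x 1%N) (x2 := x 2%N)
      (x3 := x 3%N) (x4 := x 4%N) (x5 := 0) (x6 := 0) (x7 := x 5%N); first by lra.
    by do 6 case=> //.
  + rewrite /tree_form !big_ord_recr big_ord0 /=; do 6 rewrite big_nat_recr //=;
      rewrite big_geq //= => q0.
    have [|[? ? ? ?] [? ? ? ?]] := E8_form_le0 (x0 := x 0%N) (x1 := x 1%N) (x2 := x 2%N)
      (x3 := x 3%N) (x4 := x 4%N) (x5 := x 5%N) (x6 := 0) (x7 := x 6%N); first by lra.
    by do 7 case=> //.
  + rewrite /tree_form !big_ord_recr big_ord0 /=; do 7 rewrite big_nat_recr //=;
      rewrite big_geq //= => q0.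
    have [|[? ? ? ?] [? ? ? ?]] := E8_form_le0 (x0 := x 0%N) (x1 := x 1%N) (x2 := x 2%N)
      (x3 := x 3%N) (x4 := x 4%N) (x5 := x 5%N) (x6 := x 6%N) (x7 := x 7%N); first by lra.
    by do 8 case=> //.
Qed.

(** * Roots *)

(** Integers bounded by [(r + 2) / 2] in absolute value, shifted by [r + 2], fall between 0 and
    [2 * r + 4]; this encodes coroot pairings in a finite type for the pigeonhole argument below. *)
Lemma inord_absz_inj (p q r : int) : 0 <= r -> 2 * `|p| <= r + 2 -> 2 * `|q| <= r + 2 ->
  inord `|(p + r + 2)%R|%N = inord `|(q + r + 2)%R|%N :> 'I_(`|(2 * r + 4)%R|.+1) -> p = q.
Proof.
move=> h0 h1 h2.
have [p0 q0 r0] : [/\ 0 <= p + r + 2, 0 <= q + r + 2 & 0 <= 2 * r + 4] by split; lia.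
move=> /(congr1 val) /=; rewrite !inordK ?ltnS -?lez_nat ?gez0_abs //; try lia.
Qed.

Section Roots.
Variable G : oriented_dynkin.
Implicit Types v w : {ffun G -> int}.

Lemma edge_irr (i : G) : edge i i = false.
Proof. by have [-> /negP] := orientP i i; case: orient => // H; case: H. Qed.

Lemma dynkin_tree : exists (t : ade_family) (n : nat) (f : G -> 'I_n),
  [/\ ade_rank t n, bijective f & forall i j, edge i j =
     (0 < f j)%N && (f i == ade_parent t n (f j) :> nat) ||
     (0 < f i)%N && (f j == ade_parent t n (f i) :> nat)].
Proof.
have [t [n [tn [f bf fE]]]] := edge_ade G; exists t, n, f; split=> // i j.
by rewrite fE !ade_linkE.
Qed.

(** The form (v, v) of the Cartan matrix, equal to twice the Tits form; roots have value 2. *)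
Definition root_form v : int := \sum_i v i * coroot_pairing i v.

Lemma root_form_le0 v : root_form v <= 0 -> v = 0.
Proof.
have [t [n [f [tn [g fK gK] fE]]]] := dynkin_tree.
case: n f g fK gK tn fE => [|n] f g fK gK tn fE; first by case: t tn {fE}.
pose x k := v (g (inord k)).
have xE (k : 'I_n.+1) : x k = v (g k) by rewrite /x inord_val.
pose p := ade_parent t n.+1.
have plt l : (0 < l < n.+1)%N -> (p l < l)%N by exact: ade_parent_lt.
have S1 : \sum_(k < n.+1) \sum_(l < n.+1 | (0 < l)%N && (k == p l :> nat)) x k * x l =
    \sum_(1 <= l < n.+1) x l * x (p l).
  rewrite big_add1 /= big_mkord.
  rewrite (exchange_big_dep (fun l : 'I_n.+1 => (0 < l)%N)) /= => [|k l _ /andP[]//].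
  rewrite big_mkcond big_ord_recl /= add0r; apply: eq_bigr => l _.
  have h : (p l.+1 < n.+1)%N by have := plt l.+1; have := ltn_ord l; lia.
  rewrite (big_pred1 (Ordinal h)) => [|k] /=; first by rewrite mulrC.
  by rewrite -val_eqE /= /bump /= add1n.
(* The adjacency sum meets each edge from both of its endpoints, whence the factor 2. *)
have -> : root_form v = 2 * tree_form p n.+1 x.
  rewrite /root_form /coroot_pairing (reindex g) /=; last by exists f => ? _.
  transitivity (\sum_(k < n.+1) (2 * x k ^+ 2 -
     (\sum_(l < n.+1 | (0 < l)%N && (k == p l :> nat)) x k * x l +
      \sum_(l < n.+1 | (0 < k)%N && (l == p k :> nat)) x k * x l))).
    apply: eq_bigr => k _; rewrite mulrBr -xE mulrCA -expr2; congr (_ - _).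
    rewrite mulr_sumr (reindex g) /=; last by exists f => ? _.
    rewrite [LHS]big_mkcond [X in _ = X + _]big_mkcond [X in _ = _ + X]big_mkcond.
    rewrite -big_split; apply: eq_bigr => l _ /=; rewrite fE !gK -!xE.
    case: (boolP (_ && _)) => [/andP[l0 /eqP kl]|_] /=; last by rewrite add0r.
    case: (boolP (_ && _)) => [/andP[k0 /eqP lk]|_] /=; last by rewrite addr0.
    by exfalso; have := plt l; have := plt k; have := ltn_ord k; have := ltn_ord l;
      rewrite /p in kl lk *; lia.
  rewrite sumrB big_split /= S1.
  have -> : \sum_(k < n.+1) \sum_(l < n.+1 | (0 < k)%N && (l == p k :> nat)) x k * x l =
     \sum_(1 <= l < n.+1) x l * x (p l).
    rewrite -S1; rewrite [RHS](exchange_big_dep predT) //=.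
    by apply: eq_bigr => k _; apply: eq_big => [l|l _] //; rewrite mulrC.
  by rewrite /tree_form -mulr_sumr mulrBr; congr (_ - _); rewrite mulr2n mulrDl mul1r.
rewrite pmulr_rle0 // => /(tree_form_le0 tn) x0.
by apply/ffunP => j; rewrite -[j]fK -xE x0 ?ffunE.
Qed.

Definition add_simple v (c : int) (i : G) : {ffun G ->
  int} := [ffun j => v j + c * simple_root i j].

Lemma coroot_pairingD i j c v :
  coroot_pairing j (add_simple v c i) =
    coroot_pairing j v + c * coroot_pairing j (simple_root i).
Proof.
rewrite /coroot_pairing !ffunE mulrBr mulr_sumr.
under eq_bigr do rewrite ffunE.
by rewrite big_split /=; ring.
Qed.

Lemma coroot_pairing_simple (i j : G) :
  coroot_pairing j (simple_root i) = 2 * (j == i)%:Z - (edge j i)%:Z.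
Proof.
rewrite /coroot_pairing ffunE; congr (_ - _).
rewrite big_mkcond (bigD1 i) //= ffunE eqxx big1 ?addr0 => [|k /negPf ki].
  by case: edge.
by rewrite ffunE ki; case: ifP.
Qed.

(** Polarization, with (alpha_i, alpha_i) = 2. *)
Lemma root_form_add v c i :
  root_form (add_simple v c i) = root_form v + 2 * c * coroot_pairing i v + 2 * c ^+ 2.
Proof.
rewrite /root_form.
under eq_bigr do rewrite coroot_pairingD !ffunE mulrDl mulrDr.
rewrite 2!big_split /= -!addrA; congr (_ + _).
have -> : \sum_j v j * (c * coroot_pairing j (simple_root i)) = c * coroot_pairing i v.
  rewrite {2}/coroot_pairing mulrBr mulr_sumr.
  under eq_bigr do rewrite coroot_pairing_simple mulrBr mulrBr.
  rewrite sumrB; congr (_ - _).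
    rewrite (bigD1 i) //= eqxx big1 ?addr0 => [|k /negPf ki];
      first by rewrite -[Posz true]/(1 : int); ring.
    by rewrite ki !mulr0.
  rewrite [RHS]big_mkcond; apply: eq_bigr => j _; rewrite edge_sym.
  by case: edge; rewrite ?mulr1 ?mulr0 // mulrC.
rewrite (bigD1 i) //= big1 ?addr0 => [|k /negPf ki]; last by rewrite ?ffunE ki ?mulr0 mul0r.
by rewrite coroot_pairing_simple edge_irr eqxx ?ffunE ?eqxx -[Posz true]/(1 : int) -[Posz false]/(0 : int); ring.
Qed.

Lemma simple_reflectionE i v : simple_reflection i v = add_simple v (- coroot_pairing i v) i.
Proof. by apply/ffunP => j; rewrite !ffunE mulNr. Qed.

Lemma root_form_reflection i v : root_form (simple_reflection i v) = root_form v.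
Proof. by rewrite simple_reflectionE root_form_add; ring. Qed.

Lemma simple_reflectionK (i : G) : involutive (simple_reflection i).
Proof.
move=> v; apply/ffunP => j; rewrite !simple_reflectionE coroot_pairingD.
by rewrite coroot_pairing_simple eqxx edge_irr !ffunE -[Posz true]/(1 : int) -[Posz false]/(0 : int); ring.
Qed.

Lemma root_form_simple i : root_form (simple_root i) = 2.
Proof.
rewrite /root_form (bigD1 i) //= big1 ?addr0 => [|k /negPf ki]; last by rewrite ffunE ki mul0r.
by rewrite coroot_pairing_simple ffunE eqxx edge_irr.
Qed.

Lemma root_form_root v : is_root v -> root_form v = 2.
Proof. by elim=> [i|i w _ <-]; [exact: root_form_simple|exact: root_form_reflection]. Qed.

Lemma is_root_reflection i v : is_root (simple_reflection i v) <-> is_root v.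
Proof.
by split=> h; [rewrite -[v](simple_reflectionK i)|]; exact: root_reflection.
Qed.

(** A pairing of at least 2 would give [v - alpha_i] the form value 2 - 4 + 2 = 0 or less, hence
    [v = alpha_i] by definiteness. *)
Lemma coroot_pairing_root_le1 i v : is_root v -> v <> simple_root i -> coroot_pairing i v <= 1.
Proof.
move=> /root_form_root v2 vi; rewrite leNgt; apply/negP => lt.
have /root_form_le0 : root_form (add_simple v (-1) i) <= 0.
  by rewrite root_form_add v2; lia.
move=> e; apply: vi; apply/ffunP => j.
have /ffunP /(_ j) := e; rewrite !ffunE; lia.
Qed.

Lemma root_form_ge0 v : 0 <= root_form v.
Proof.
rewrite leNgt; apply/negP => lt0; have := lt0; rewrite (root_form_le0 (ltW lt0)).
by rewrite /root_form big1 ?ltxx // => i _; rewrite ffunE mul0r.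
Qed.

(** The form is nonnegative at [v + alpha_i] and at [v - alpha_i]. *)
Lemma coroot_pairing_bound i v : 2 * `|coroot_pairing i v| <= root_form v + 2.
Proof.
have := root_form_ge0 (add_simple v 1 i); have := root_form_ge0 (add_simple v (-1) i).
by rewrite !root_form_add; lia.
Qed.

Lemma coroot_pairing_inj v w : (forall i, coroot_pairing i v = coroot_pairing i w) -> v = w.
Proof.
move=> vw; pose u : {ffun G -> int} := [ffun j => v j - w j].
have : root_form u <= 0.
  rewrite /root_form big1 // => i _; suff -> : coroot_pairing i u = 0 by rewrite mulr0.
  rewrite -[RHS](subrr (coroot_pairing i v)) {2}vw /coroot_pairing ffunE.
  by under eq_bigr do rewrite ffunE; rewrite sumrB; ring.
move=> /root_form_le0 /ffunP u0; apply/ffunP => j; apply/eqP.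
by have := u0 j; rewrite !ffunE => /eqP; rewrite subr_eq0.
Qed.

Definition nat_vec (x : G -> nat) : {ffun G -> int} := [ffun i => (x i)%:Z].

Lemma nat_vecP v : (forall i, 0 <= v i) -> exists x, v = nat_vec x.
Proof.
by move=> v0; exists (fun i => `|v i|%N); apply/ffunP => i; rewrite ffunE gez0_abs.
Qed.

Lemma nat_vec_inj x y : nat_vec x = nat_vec y -> forall i, x i = y i.
Proof. by move=> /ffunP xy i; have := xy i; rewrite !ffunE => -[]. Qed.

(** Only the coordinate at [i] changes, by a pairing that is at most 1 and at most [2 * x i]; so it
    stays nonnegative whether or not [x i] is 0. *)
Lemma root_reflection_nat i x : is_root (nat_vec x) -> nat_vec x <> simple_root i ->
  exists y, simple_reflection i (nat_vec x) = nat_vec y.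
Proof.
move=> xr xi; apply: nat_vecP => j; rewrite !ffunE.
have := coroot_pairing_root_le1 xr xi; have [->|ji] := eqVneq j i; last by lia.
suff : (coroot_pairing i (nat_vec x) <= 2 * (x i)%:Z) by lia.
rewrite /coroot_pairing ffunE lerBlDr lerDl sumr_ge0 // => k _.
by rewrite ffunE.
Qed.

Definition coxeter (s : seq G) v := foldl (fun v i => simple_reflection i v) v s.

Lemma coxeter_notin s v j : j \notin s -> coxeter s v j = v j.
Proof.
rewrite /coxeter; elim: s v => //= i s IHs v; rewrite inE negb_or => /andP[/negPf ji js].
by rewrite IHs // !ffunE ji mulr0 subr0.
Qed.

(** Each vertex occurs once in [s], so the coordinate at [a] changes only in the reflection at [a].
    A fixed vector is therefore orthogonal to each simple root in turn. *)
Lemma coxeter_fix s v : uniq s -> (forall i, i \in s) -> coxeter s v = v -> v = 0.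
Proof.
move=> us sall sv.
suff h : forall i, i \in s -> coroot_pairing i v = 0.
  by apply: root_form_le0; rewrite /root_form big1 // => i _; rewrite h ?mulr0.
move: sv {sall}; elim: s v us => //= a s IHs v /andP[as_ us] sv.
have a0 : coroot_pairing a v = 0.
  have := coxeter_notin (simple_reflection a v) as_.
  by rewrite sv !ffunE eqxx; lia.
have av : simple_reflection a v = v by apply/ffunP => j; rewrite !ffunE a0 mul0r subr0.
rewrite av in sv; move=> i; rewrite inE => /predU1P[-> //|]; exact: IHs.
Qed.

Lemma coxeterD s v w : coxeter s [ffun j => v j + w j] = [ffun j =>
  coxeter s v j + coxeter s w j].
Proof.
elim: s v w => [|i s IHs] v w //=; rewrite /coxeter /= -/(coxeter _ _) -IHs.
congr coxeter; apply/ffunP => j; rewrite !ffunE /coroot_pairing !ffunE.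
by under eq_bigr do rewrite ffunE; rewrite big_split /=; ring.
Qed.

Lemma root_form_coxeter s v : root_form (coxeter s v) = root_form v.
Proof. by elim: s v => //= i s IHs v; rewrite /coxeter /= IHs root_form_reflection. Qed.

(* The orbit of a vector under the Coxeter element is finite because the form is
   preserved; summing a cycle of nonnegative vectors would give a fixed vector. *)
Lemma coxeter_not_nat s v : uniq s -> (forall i, i \in s) -> v <> 0 ->
  exists k, forall x, iter k (coxeter s) v <> nat_vec x.
Proof.
move=> us sall v0; apply: contrapT => H.
have pos k : exists x, iter k (coxeter s) v = nat_vec x.
  by apply: contrapT => h; apply: H; exists k => x e; apply: h; exists x.
have form k : root_form (iter k (coxeter s) v) = root_form v.
  by elim: k => //= k IHk; rewrite root_form_coxeter.
have nz k : iter k (coxeter s) v <> 0.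
  move=> z; apply: v0; apply: root_form_le0; rewrite -(form k) z /root_form big1 // => i _.
  by rewrite ffunE mul0r.
(* Along the orbit the pairings stay bounded by [coroot_pairing_bound], and they determine the
   vector by [coroot_pairing_inj]; [F] has one more argument than possible values. *)
pose M := `|(2 * root_form v + 4)%R|%N.
pose F (k : 'I_(#|{ffun G -> 'I_M.+1}|.+1)) : {ffun G -> 'I_M.+1} :=
  [ffun i => inord `|(coroot_pairing i (iter k (coxeter s) v) + root_form v + 2)%R|%N].
have : ~ injective F.
  by move=> /leq_card; rewrite /= card_ord ltnn.
move=> /existsNP [a /existsNP [b /not_implyP [/ffunP Fab ab]]].
have cab : iter a (coxeter s) v = iter b (coxeter s) v.
  apply: coroot_pairing_inj => i; have := Fab i; rewrite !ffunE.
  apply: inord_absz_inj; first exact: root_form_ge0.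
    by have := coroot_pairing_bound i (iter a (coxeter s) v); rewrite form.
  by have := coroot_pairing_bound i (iter b (coxeter s) v); rewrite form.
have cyc (p q : nat) : (p < q)%N -> iter p (coxeter s) v = iter q (coxeter s) v -> False.
  move=> pq e; pose y : {ffun G -> int} := [ffun j => \sum_(p <= k < q) iter k (coxeter s) v j].
  have cy : coxeter s y = [ffun j => \sum_(p <= k < q) iter k.+1 (coxeter s) v j].
    have -> : y = \sum_(p <= k < q) iter k (coxeter s) v.
      by apply/ffunP => j; rewrite ffunE sum_ffunE.
    have -> : [ffun j => \sum_(p <= k < q) iter k.+1 (coxeter s) v j] =
       \sum_(p <= k < q) coxeter s (iter k (coxeter s) v).
      by apply/ffunP => j; rewrite ffunE sum_ffunE.
    apply: (big_morph (coxeter s)) => [u w|].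
      have := coxeterD s u w.
      have -> : [ffun j => u j + w j] = u + w by apply/ffunP => j; rewrite !ffunE.
      by move=> ->; apply/ffunP => j; rewrite !ffunE.
    have := coxeterD s 0 0.
    have -> : [ffun j => (0 : {ffun G -> int}) j + (0 : {ffun G -> int}) j] = 0.
      by apply/ffunP => j; rewrite !ffunE addr0.
    by move=> /ffunP h; apply/ffunP => j; have := h j; rewrite !ffunE; lia.
  have cyy : coxeter s y = y.
    rewrite cy; apply/ffunP => j; rewrite !ffunE.
    have h := telescope_sumr (fun k => iter k (coxeter s) v j) (ltnW pq).
    apply/eqP; rewrite -subr_eq0 -sumrB h -e subrr //.
  have y0 := coxeter_fix us sall cyy.
  apply: (nz p); apply/ffunP => j; rewrite ffunE.
  have ge0 k : 0 <= iter k (coxeter s) v j by have [x ->] := pos k; rewrite ffunE.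
  have := congr1 (fun u : {ffun G -> int} => u j) y0; rewrite !ffunE big_ltn // => /eqP.
  by rewrite paddr_eq0 ?sumr_ge0 // => /andP[/eqP].
have [ltab|ltba|/val_inj //] := ltngtP a b; [exact: cyc cab|exact: cyc (esym cab)].
Qed.

End Roots.

(** * Gabriel's theorem *)

(** On a tree, arbitrary increments along the edges integrate to a function on the vertices,
    starting from the root. *)
Lemma tree_height (p : nat -> nat) (s : nat -> int) n :
  (forall l, (0 < l < n)%N -> (p l < l)%N) ->
  exists h : nat -> int, forall l, (0 < l < n)%N -> h l = h (p l) + s l.
Proof.
elim: n => [|n IHn] plt; first by exists (fun=> 0) => l; rewrite ltn0 andbF.
have [|h hE] := IHn; first by move=> l ln; apply: plt; lia.
exists (fun l => if l == n then h (p n) + s n else h l) => l ln.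
have pl := plt l ln; have [ln'|ln'] := eqVneq l n.
  by subst l; rewrite (ltn_eqF pl).
rewrite [p l == n]ltn_eqF; last by lia.
by apply: hE; lia.
Qed.

(** The increment along an edge is 1 or -1 according to its direction; since the heights of
    neighbours differ by one, comparing them recovers the orientation. *)
Lemma orientation_height (G : oriented_dynkin) :
  exists h : G -> int, forall i j, orient i j = edge i j && (h j == h i + 1).
Proof.
have [t [n [f [tn [g fK gK] fE]]]] := dynkin_tree G.
case: n f g fK gK tn fE => [|n] f g fK gK tn fE; first by case: t tn {fE}.
pose p := ade_parent t n.+1; pose u l := g (inord l).
have [|h hE] := @tree_height p (fun l => if orient (u (p l)) (u l) then 1 else -1) n.+1.
  by move=> l; exact: ade_parent_lt.
have uf i : u (f i) = i by rewrite /u inord_val fK.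
have oh i j : orient i j -> h (f j) = h (f i) + 1.
  move=> ij; have : edge i j by rewrite (orientP i j).1 ij.
  have nji : orient j i = false.
    by have [_] := orientP i j; rewrite ij /= => /negPf.
  rewrite fE -/p => /orP[] /andP[f0 /eqP e].
    by rewrite (hE (f j)) ?f0 ?ltn_ord // -e !uf ij.
  by rewrite (hE (f i)) ?f0 ?ltn_ord // -e !uf nji addrNK.
exists (fun i => h (f i)) => i j; apply/idP/andP => [ij|[ij /eqP hij]].
  by rewrite (orientP i j).1 ij (oh _ _ ij).
by move: ij; rewrite (orientP i j).1 => /orP[// | /oh]; rewrite hij; lia.
Qed.

Section Gabriel.
Variables (K : fieldType) (G : oriented_dynkin).
Implicit Types (o : rel G) (x : G -> nat) (h : G -> int).

Definition gabriel_at o x : Prop :=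
  ((exists2 V : rep K G, rindec o V & forall t, rdim V t = x t) <-> is_root (nat_vec x)) /\
  forall V W : rep K G, rindec o V -> rindec o W ->
    (forall t, rdim V t = x t) -> (forall t, rdim W t = x t) -> riso o V W.

Lemma mx_dim0 (m n : nat) (A B : 'M[K]_(m, n)) : (m == 0)%N || (n == 0)%N -> A = B.
Proof.
move=> h; apply/matrixP => -[a am] [b bn]; exfalso.
by case/orP: h => /eqP h; move: am bn; rewrite h ltn0.
Qed.

Lemma idempotent_dim1 n (e : 'M[K]_n) : n = 1%N -> e *m e = e -> e = 0 \/ e = 1%:M.
Proof.
move=> n1; subst n; rewrite [e]mx11_scalar -scalar_mxM => /matrixP /(_ 0 0).
rewrite !mxE eqxx !mulr1n => /eqP; rewrite -subr_eq0 -{3}[e 0 0]mulr1 -mulrBr mulf_eq0.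
case/orP => [/eqP -> |]; first by left; rewrite raddf0.
by rewrite subr_eq0 => /eqP ->; right.
Qed.

Lemma nat_vec_simple x i : nat_vec x = simple_root i <-> forall t, x t = (t == i).
Proof.
split=> [/ffunP e t|e]; last by apply/ffunP => t; rewrite !ffunE e.
by have := e t; rewrite !ffunE => -[].
Qed.

(** Without loops every arrow starts or ends at a zero space, so all maps along arrows vanish; the
    one-dimensional space at [i] has only the idempotents 0 and 1. *)
Lemma gabriel_simple o x i : (forall s t, o s t -> s != t) ->
  nat_vec x = simple_root i -> gabriel_at o x.
Proof.
move=> irr /nat_vec_simple xi.
have flat (V W : rep K G) (vx : forall t, rdim V t = x t) (wx : forall t, rdim W t = x t)
    s t : o s t -> (rdim V s == 0)%N || (rdim W t == 0)%N.
  move=> /irr st; rewrite vx wx !xi.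
  by have [si|//] := eqVneq s i; have [ti|] := eqVneq t i; rewrite ?orbT // si ti eqxx in st.
split; first split=> [_|_].
- by rewrite (_ : nat_vec x = simple_root i) //; [exact: root_simple|exact/nat_vec_simple].
- exists (Rep (fun s t => 0 : 'M_(x s, x t))) => //; split.
    by exists i; rewrite /= xi eqxx.
  move=> e _ ee; have t0 t : t != i -> forall A B : 'M[K]_(x t), A = B.
    by move=> /negPf ti A B; apply: mx_dim0; rewrite xi ti.
  have [|ei|ei] := @idempotent_dim1 _ (e i) _ (ee i); first by rewrite /= xi eqxx.
    by left=> t; have [->//|ti] := eqVneq t i; exact: t0.
  by right=> t; have [->//|ti] := eqVneq t i; exact: t0.
- move=> V W _ _ vx wx; exists (fun t => pid_mx (x t)), (fun t => pid_mx (x t)); split.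
  + by move=> s t st; apply: mx_dim0; exact: flat.
  + by move=> s t st; apply: mx_dim0; exact: flat.
  + by move=> t; rewrite pid_mx_id ?vx ?wx // -vx pid_mx_1.
  + by move=> t; rewrite pid_mx_id ?vx ?wx // -wx pid_mx_1.
Qed.

Definition height_rel h : rel G := fun i j => edge i j && (h j == h i + 1).

(** The neighbours of a sink [i] have height [h i - 1], which is one above the new height of [i]:
    the sink becomes a source. *)
Definition lower h i : G -> int := fun j => if j == i then h i - 2 else h j.

Section Sink.
Variables (h : G -> int) (i : G).
Hypothesis sink : forall j, edge i j -> h j = h i - 1.
Let o := height_rel h.
Let o' := height_rel (lower h i).
Let N : pred G := edge i.

Let oi j : o j i = N j.
Proof.
rewrite /o /height_rel /N edge_sym; apply/andP/idP => [[]//|ij]; split=> //.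
by rewrite (sink ij) subrK.
Qed.

Let io j : o i j = false.
Proof. by apply/negP => /andP[/sink ->]; lia. Qed.

Let io' j : o' i j = N j.
Proof.
rewrite /o' /height_rel /N /lower eqxx; apply/andP/idP => [[]//|ij]; split=> //.
have -> : (j == i) = false by apply: contraTF ij => /eqP ->; rewrite edge_irr.
by rewrite (sink ij); lia.
Qed.

Let oi' j : o' j i = false.
Proof.
rewrite /o' /height_rel /lower eqxx edge_sym; apply/negP => /andP[ij].
have -> : (j == i) = false by apply: contraTF ij => /eqP ->; rewrite edge_irr.
by rewrite (sink ij); lia.
Qed.

Let eqo s t : s != i -> t != i -> o s t = o' s t.
Proof. by move=> /negPf si /negPf ti; rewrite /o /o' /height_rel /lower si ti. Qed.

Let Ni : ~~ N i.
Proof. by rewrite /N edge_irr. Qed.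

(** Exactness gives dim V'_i as the sum over the neighbours minus dim V_i, which is the formula for
    s_i. *)
Lemma reflection_dim (V V' : rep K G) : reflection o i N V V' ->
  nat_vec (rdim V') = simple_reflection i (nat_vec (rdim V)).
Proof.
move=> RV; apply/ffunP => j; rewrite !ffunE.
have [->|ji] := eqVneq j i; last first.
  by rewrite mulr0 subr0 (mulmx1_dim (rphiK RV ji) (rpsiK RV ji)).
rewrite /coroot_pairing ffunE.
have := ex_dim (rker_exact RV) => dm.
have -> : \sum_(k | edge i k) nat_vec (rdim V) k = (\sum_(k | N k) rdim V k)%N%:Z.
  by rewrite (big_morph Posz PoszD (erefl _)); apply: eq_bigr => k _; rewrite ffunE.
by rewrite -dm; lia.
Qed.

(** When s_i x leaves the positive cone the hypothesis is vacuous, and consistently so: unless x is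
    alpha_i, reflecting an indecomposable or a root of vector x produces a vector in the cone. *)
Lemma gabriel_step x :
  (forall y, simple_reflection i (nat_vec x) = nat_vec y -> gabriel_at o' y) ->
  gabriel_at o x.
Proof.
move=> IH; case: (pselect (nat_vec x = simple_root i)) => [xi|xi].
  by apply: gabriel_simple xi => s t /andP[st _]; apply: contraTneq st => ->; rewrite edge_irr.
have notsimple (V : rep K G) : (forall t, rdim V t = x t) ->
    ~ (rdim V i = 1%N /\ forall j, j != i -> rdim V j = 0%N).
  move=> vx [V1 V0]; apply/xi/nat_vec_simple => t; rewrite -vx.
  by have [->|/V0] := eqVneq t i.
have vecE (V : rep K G) : (forall t, rdim V t = x t) -> nat_vec (rdim V) = nat_vec x.
  by move=> vx; apply/ffunP => t; rewrite !ffunE vx.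
have refl (V : rep K G) : rindec o V -> (forall t, rdim V t = x t) ->
    exists2 V', inhabited (reflection o i N V V') & simple_reflection i (nat_vec x) =
      nat_vec (rdim V').
  move=> Vi vx; case: (rindec_epi oi io Vi) => [epi|/(notsimple _ vx) []].
  have [V' [RV]] := reflection_exists o epi; exists V' => //.
  by rewrite (reflection_dim RV) vecE.
split; first split.
- move=> [V Vi vx]; have [V' [RV] V'x] := refl V Vi vx.
  rewrite -(is_root_reflection i) V'x; apply/(IH _ V'x).1; exists V' => //.
  exact: (reflect_rindec oi io io' eqo Ni RV Vi).
- move=> xr; have [y xy] := root_reflection_nat xr xi.
  have yr : is_root (nat_vec y) by rewrite -xy; apply/is_root_reflection.
  have [V' V'i V'y] := (IH y xy).1.2 yr.
  case: (rindec_mono io' oi' V'i) => [mono|[V1 V0]].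
    have [V [RV]] := coreflection_exists o Ni mono.
    exists V; first exact: (coreflect_rindec oi io' oi' eqo Ni RV V'i).
    apply: nat_vec_inj; rewrite -[LHS](simple_reflectionK i) -(reflection_dim RV).
    rewrite -[RHS](simple_reflectionK i) xy; congr simple_reflection.
    by apply/ffunP => t; rewrite !ffunE V'y.
  (* [V'] cannot be the simple representation at [i]: applying s_i, [x] would be -alpha_i. *)
  have yi : nat_vec y = simple_root i.
    by apply/nat_vec_simple => t; rewrite -V'y; have [->|/V0] := eqVneq t i.
  have := congr1 (fun v : {ffun G -> int} => simple_reflection i v i) xy.
  rewrite yi simple_reflectionK simple_reflectionE !ffunE coroot_pairing_simple.
  by rewrite eqxx edge_irr; lia.
- move=> V W Vi Wi vx wx.
  have [V' [RV] V'x] := refl V Vi vx; have [W' [RW] W'x] := refl W Wi wx.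
  apply: (coreflect_riso oi io io' eqo Ni RV RW).
  apply: (IH _ V'x).2 => //.
  + exact: (reflect_rindec oi io io' eqo Ni RV Vi).
  + exact: (reflect_rindec oi io io' eqo Ni RW Wi).
  + by apply: nat_vec_inj; rewrite -V'x -W'x.
Qed.

End Sink.

(** [p] lists the vertices already reflected, [s] those to come. The head of [s] is a sink: a
    neighbour in [s] is one lower, and a neighbour in [p] was one higher and has been lowered by
    two. *)
Lemma gabriel_run h (p s : seq G) x :
  (forall i j, edge i j -> h j = h i + 1 \/ h i = h j + 1) ->
  uniq (p ++ s) -> (forall i, i \in p ++ s) -> sorted (fun i j => h j <= h i) s ->
  (forall i j, i \in p -> j \in s -> h j <= h i) ->
  (forall y, coxeter s (nat_vec x) = nat_vec y ->
    gabriel_at (height_rel (fun j => h j - 2)) y) ->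
  gabriel_at (height_rel (fun j => if j \in p then h j - 2 else h j)) x.
Proof.
move=> he; elim: s p x => [|i s IHs] p x us all srt ps IH.
  rewrite (_ : (fun j => _) = (fun j => h j - 2)); last first.
    by apply/funext => j; have := all j; rewrite cats0 => ->.
  exact: IH.
have sle j : j \in s -> h j <= h i.
  by move: srt => /=; rewrite path_sortedE => [/andP[/allP + _]|a b c /= ba cb]; [exact|lia].
have ip : i \notin p.
  by move: us; rewrite cat_uniq /= negb_or => /and3P[_ /andP[]].
apply: (@gabriel_step _ i) => [j ij|y xy].
  have ji : j != i by apply: contraTneq ij => ->; rewrite edge_irr.
  rewrite (negPf ip); have := all j; rewrite mem_cat inE (negPf ji) /=.
  case: (boolP (j \in p)) => [jp _|_ /= js].
    by have := ps j i jp (mem_head _ _); case: (he _ _ ij); lia.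
  by have := sle j js; case: (he _ _ ij); lia.
rewrite (_ : lower _ i = (fun j => if j \in rcons p i then h j - 2 else h j)); last first.
  apply/funext => j; rewrite /lower mem_rcons inE (negPf ip).
  by have [->|] := eqVneq j i.
apply: IHs; rewrite ?cat_rcons //.
- exact: path_sorted srt.
- move=> a b; rewrite mem_rcons inE => /predU1P[-> /sle //|ap bs].
  by apply: ps => //; rewrite inE bs orbT.
- by move=> z yz; apply: IH; rewrite /coxeter /= xy.
Qed.

Theorem gabriel x : gabriel_at (@orient G) x.
Proof.
have [h hE] := orientation_height G.
have -> : @orient G = height_rel h by apply/funext => i; apply/funext => j; exact: hE.
have he i j : edge i j -> h j = h i + 1 \/ h i = h j + 1.
  by rewrite (orientP i j).1 => /orP[]; rewrite hE => /andP[_ /eqP]; [left|right].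
pose s := sort (fun i j => h j <= h i) (enum G).
have us : uniq s by rewrite sort_uniq enum_uniq.
have sall i : i \in s by rewrite mem_sort mem_enum.
have shift : height_rel (fun j => h j - 2) = height_rel h.
  apply/funext => i; apply/funext => j; rewrite /height_rel; congr (_ && _); lia.
have run y : (forall z, coxeter s (nat_vec y) = nat_vec z -> gabriel_at (height_rel h) z) ->
    gabriel_at (height_rel h) y.
  move=> hy; apply: (@gabriel_run h [::] s) => //.
    by apply: sort_sorted => i j; exact: le_total.
  by rewrite shift.
(* The Coxeter element fixes 0, so this vector is treated apart: it is neither a root nor the
   dimension vector of an indecomposable. *)
case: (pselect (nat_vec x = 0)) => [x0|x0].
  have noV (V : rep K G) : rindec (height_rel h) V -> ~ forall t, rdim V t = x t.
    move=> [[t tV] _] vx; move: tV; rewrite vx.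
    by have /ffunP /(_ t) := x0; rewrite !ffunE => -[->].
  split; last by move=> V W Vi _ /(noV V Vi).
  split=> [[V Vi /(noV V Vi)] // | /root_form_root].
  by rewrite x0 /root_form big1 // => i _; rewrite ffunE mul0r.
have [k kx] := coxeter_not_nat us sall x0.
(* [k] counts the Coxeter turns after which the vector lies outside the cone; for [k = 0] this is
   absurd, as [nat_vec x] lies in it. *)
elim: k x {x0} kx => [|k IHk] x kx; first by have := kx x.
apply: run => z xz; apply: IHk => y; have := kx y.
by rewrite iterSr xz.
Qed.

End Gabriel.

(** * The zigzag algebra in low degrees *)

Section Monomials.
Variables (K : fieldType) (I : finType) (arr : rel I).
Local Notation PA := (pathalg K arr).

Definition path_mono_fun (c : K) (w v : qword I) : K :=
  if path arr w.1 w.2 && (v == w) then c else 0.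

Lemma path_mono_subproof c w : path_mono_fun c w \in path_fun_pred arr.
Proof.
apply/asboolP; exists (size w.2).+1 => v; rewrite /path_mono_fun.
by case: andP => [[pw /eqP ->]|_ /eqP].
Qed.

Definition path_mono c w : PA := PathAlg (path_mono_subproof c w).

Lemma path_monoE c w v : path_mono c w v = if path arr w.1 w.2 && (v == w) then c else 0.
Proof. by []. Qed.

Lemma path_mono1 w : path_mono 1 w = path_elt K arr w.
Proof.
apply/pathalgP => v; rewrite path_monoE [RHS]/(path_elt_fun K arr w v) /path_elt_fun.
by case: andP.
Qed.

Lemma path_monoB c d w : path_mono (c - d) w = path_mono c w - path_mono d w.
Proof. by apply/pathalgP => v; rewrite paBE !path_monoE; case: ifP => //; rewrite subr0. Qed.

Lemma path_monoM c d x s y t : path_mono c (x, s) * path_mono d (y, t) =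
  if last x s == y then path_mono (c * d) (x, s ++ t) else 0.
Proof.
apply/pathalgP => -[z r]; rewrite paME /path_mul_fun /=.
pose F n := path_mono c (x, s) (z, take n r) * path_mono d (y, t) (last z (take n r), drop n r).
(* In the convolution only the cut after [s], at [n = size s], can contribute. *)
have F0 n : (n < (size r).+1)%N -> F n != 0 ->
    [/\ z = x, r = s ++ t, last x s = y & n = size s] /\ (path arr x s && path arr y t).
  move=> nr; rewrite /F !path_monoE /=.
  case: ifP => [/andP[ps /eqP [zx ns]]|_]; last by rewrite mul0r eqxx.
  case: ifP => [/andP[pt /eqP [yl dt]]|_]; last by rewrite mulr0 eqxx.
  rewrite ps pt; split=> //; split=> //; first by rewrite -ns -dt cat_take_drop.
    by rewrite -zx -ns.
  by rewrite -ns size_takel.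
case: eqP => [xy|xy]; last first.
  rewrite big1_seq // => n; rewrite mem_index_iota /= => nr.
  by have [//|/(F0 _ nr) [[]]] := eqVneq (F n) 0.
rewrite path_monoE /= cat_path xy.
case: ifP => [/andP[/andP[ps pt] /eqP [zx rst]]|h].
  subst z r; rewrite (bigD1_seq (size s)) ?iota_uniq ?mem_index_iota ?size_cat /=; [|lia|by []].
  rewrite big1_seq ?addr0 => [|n /andP[ns]]; last first.
    rewrite mem_index_iota /= => nr.
    have [//|/(F0 n _) []] := eqVneq (F n) 0; first by rewrite size_cat.
    by case=> _ _ _ nE; rewrite nE eqxx in ns.
  by rewrite take_size_cat // drop_size_cat // /path_mono_fun /= ps xy pt !eqxx.
rewrite big1_seq // => n; rewrite mem_index_iota /= => nr.
have [//|/(F0 _ nr) [[zx rst _ _] p]] := eqVneq (F n) 0.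
by move: h; rewrite p zx rst eqxx.
Qed.

End Monomials.

Section ZigzagLowDegree.
Variables (K : fieldType) (G : oriented_dynkin).
Local Notation A := (zigzag K G).
Local Notation PA := (pathalg K (@zz_arr G)).
Local Notation S := (@zz_rel K G).
Implicit Types (i j k : G) (c d : K).

(* The ring zigzag K G carries no K-structure: zz_vert i c and zz_arrow i j c
   stand for c e_i and for c times the arrow from i to j. *)
Definition zz_vert i c : A := quot_pi S (path_mono (@zz_arr G) c (i, [::])).
Definition zz_arrow i j c : A := quot_pi S (path_mono (@zz_arr G) c (i, [:: j])).

Lemma zz_vert1 i : zz_vert i 1 = zz_idem K i.
Proof. by rewrite /zz_vert path_mono1. Qed.

Lemma zz_vertB i c d : zz_vert i (c - d) = zz_vert i c - zz_vert i d.
Proof. by rewrite /zz_vert path_monoB quot_piB. Qed.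

Lemma zz_arrowB i j c d : zz_arrow i j (c - d) = zz_arrow i j c - zz_arrow i j d.
Proof. by rewrite /zz_arrow path_monoB quot_piB. Qed.

Lemma zz_vert0 i : zz_vert i 0 = 0.
Proof. by rewrite -(subrr 0) zz_vertB subrr. Qed.

Lemma zz_arrow0 i j : zz_arrow i j 0 = 0.
Proof. by rewrite -(subrr 0) zz_arrowB subrr. Qed.

Lemma zz_vert_sum i (T : finType) (F : T ->
  K) : zz_vert i (\sum_t F t) = \sum_t zz_vert i (F t).
Proof.
apply: (big_morph (zz_vert i)) => [c d|]; last exact: zz_vert0.
by apply/eqP; rewrite -subr_eq -zz_vertB addrK.
Qed.

Lemma zz_arrow_sum i j (T : finType) (F : T -> K) :
  zz_arrow i j (\sum_t F t) = \sum_t zz_arrow i j (F t).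
Proof.
apply: (big_morph (zz_arrow i j)) => [c d|]; last exact: zz_arrow0.
by apply/eqP; rewrite -subr_eq -zz_arrowB addrK.
Qed.

Lemma zz_vert_mul i j c d : zz_vert i c * zz_vert j d = if i == j then zz_vert i (c * d) else 0.
Proof. by rewrite -quot_piM path_monoM /=; case: eqP => // _; rewrite quot_pi0. Qed.

Lemma zz_vert_arrow i j k c d :
  zz_vert i c * zz_arrow j k d = if i == j then zz_arrow i k (c * d) else 0.
Proof. by rewrite -quot_piM path_monoM /=; case: eqP => [->|_] //; rewrite quot_pi0. Qed.

Lemma zz_arrow_vert i j k c d :
  zz_arrow i j c * zz_vert k d = if j == k then zz_arrow i j (c * d) else 0.
Proof. by rewrite -quot_piM path_monoM /=; case: eqP => // _; rewrite quot_pi0. Qed.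

(* Paths of length at least two span a two-sided ideal containing the relations. *)
Lemma zz_ideal_length (f : PA) w : ideal_gen S f -> (size w.2 <= 1)%N -> f w = 0.
Proof.
move=> Sf; pose J : set PA := fun f => forall w, (size w.2 <= 1)%N -> f w = 0.
suff : J f by apply.
apply: Sf => [|r]; last first.
  have elt v : (1 < size v.2)%N -> J (path_elt K (@zz_arr G) v).
    move=> v2 u u1; rewrite [LHS]/(path_elt_fun K (@zz_arr G) v u) /path_elt_fun.
    by case: andP => // -[_ /eqP e]; move: v2; rewrite -e; lia.
  case=> [i j k _ _ _|i j k _ _|i _|i s _ s3]; try by apply: elt; rewrite //= s3.
  by move=> u u1; rewrite paBE !elt ?subrr.
split=> [w' _|x y Jx Jy w' w1|a x Jx w' w1|a x Jx w' w1] //.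
- by rewrite paBE Jx ?Jy ?subrr.
- rewrite paME /path_mul_fun big1 // => n _; rewrite Jx ?mulr0 //= size_drop; lia.
- rewrite paME /path_mul_fun big1 // => n _; rewrite Jx ?mul0r //=.
  by rewrite size_take; case: ifP; lia.
Qed.

Lemma zz_vert_eq0 i c : zz_vert i c = 0 -> c = 0.
Proof.
move=> /quot_pi_eq0 h; have := zz_ideal_length (w := (i, [::])) h isT.
by rewrite path_monoE /= eqxx.
Qed.

Lemma orient_edge i j : orient i j -> edge i j.
Proof. by rewrite (orientP i j).1 => ->. Qed.

Lemma orient_asym i j : orient i j -> orient j i = false.
Proof. by have [_] := orientP i j; case: (orient i j) => //= /negPf. Qed.

Lemma zz_arrow_eq0 i j c : orient i j -> zz_arrow i j c = 0 -> c = 0.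
Proof.
move=> ij /quot_pi_eq0 h; have := zz_ideal_length (w := (i, [:: j])) h isT.
by rewrite path_monoE /= /zz_arr orient_edge // eqxx.
Qed.

Lemma zz_vert_deg i c : bgr (b := A) 0 (zz_vert i c).
Proof.
exists (path_mono (@zz_arr G) c (i, [::])) => // w.
by rewrite path_monoE; case: andP => [[_ /eqP ->]|_ /eqP].
Qed.

Lemma orient_card i j : orient i j -> #|G| != 1%N.
Proof.
move=> ij; apply/eqP => G1; have : i = j.
  by apply: (@fintype_le1P G _ _ _); rewrite G1.
by move=> e; have := orient_asym ij; rewrite e in ij *; rewrite ij.
Qed.

Lemma zz_step_orient i j : zz_step i j = (1, 0) <-> orient i j.
Proof.
split=> [|ij]; rewrite /zz_step; last by rewrite (negPf (orient_card ij)) ij.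
by case: ifP => // _ [] /eqP; case: orient.
Qed.

Lemma zz_arrow_deg i j c : orient i j -> bgr (b := A) (1, 0) (zz_arrow i j c).
Proof.
move=> ij; exists (path_mono (@zz_arr G) c (i, [:: j])) => // w.
rewrite path_monoE; case: andP => [[_ /eqP ->] _|_ /eqP //].
by rewrite /path_deg /= addr0; apply/zz_step_orient.
Qed.

(** Two consecutive arrows of the orientation never return to their start, so [zz_ends] kills the
    product. This is what makes d d = 0 automatic. *)
Lemma zz_arrow_arrow i j k c d : orient i j -> orient j k ->
  zz_arrow i j c * zz_arrow j k d = 0.
Proof.
move=> ij jk; rewrite -quot_piM path_monoM /= eqxx; apply/quot_pi_eq0.
have -> : path_mono (@zz_arr G) (c * d) (i, [:: j; k]) =
    path_mono (@zz_arr G) (c * d) (i, [::]) * path_elt K (@zz_arr G) (i, [:: j; k]).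
  by rewrite -path_mono1 path_monoM /= eqxx mulr1.
have [_ _ JM _] := ideal_genP S; apply: JM; apply: sub_ideal_gen.
apply: zz_ends; rewrite ?orient_edge //.
by apply: contraTneq jk => <-; rewrite (orient_asym ij).
Qed.

(** Each step has length degree 1, or 2 for the loop of type A_1; hence homogeneous elements of
    small length degree involve only short paths. *)
Lemma path_deg_ge (w : qword G) : ((size w.2)%:Z <= (path_deg (@zz_step G) w).1).
Proof.
case: w => x s; rewrite /path_deg /=; elim: s x => //= y s IHs x.
by have := IHs y; rewrite /zz_step; case: ifP => _ /=; lia.
Qed.

Lemma zz_deg0 (x : A) : bgr 0 x -> exists a : G -> K, x = \sum_i zz_vert i (a i).
Proof.
move=> [f f0 <-]; exists (fun i => f (i, [::])); rewrite -quot_pi_sum; congr quot_pi.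
apply/pathalgP => -[y s]; rewrite pa_sumE; under eq_bigr do rewrite path_monoE /=.
have [->|s0] := eqVneq s [::].
  rewrite (bigD1 y) //= eqxx big1 ?addr0 // => i.
  by rewrite xpair_eqE eq_sym => /negPf ->.
rewrite big1 => [|i _]; last by rewrite xpair_eqE (negPf s0) andbF.
apply/eqP; apply: contraTT isT => /f0 h; have := path_deg_ge (y, s).
by rewrite h /=; case: s s0 {h}.
Qed.

Lemma zz_deg1 (x : A) : bgr (1, 0) x ->
  exists a : G -> G -> K, x = \sum_i \sum_(j | orient i j) zz_arrow i j (a i j).
Proof.
move=> [f f1 <-]; exists (fun i j => f (i, [:: j])).
under eq_bigr do rewrite -big_enum /= -quot_pi_sum big_enum.
rewrite -quot_pi_sum; congr quot_pi.
apply/pathalgP => -[y s]; rewrite pa_sumE.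
under eq_bigr do rewrite -big_enum pa_sumE big_enum /= /path_mono_fun /=.
have [[j [yj ->]]|ns] := pselect (exists j, orient y j /\ s = [:: j]).
  rewrite (bigD1 y) //= [X in _ = _ + X]big1 ?addr0 => [|i]; last first.
    by move=> iy; rewrite big1 // => k _; rewrite xpair_eqE eq_sym (negPf iy) andbF.
  rewrite (bigD1 j) //= big1 ?addr0 => [|k /andP[_ kj]].
    by rewrite /zz_arr orient_edge // eqxx.
  by case: ifP => // /andP[_ /eqP [e]]; rewrite e eqxx in kj.
rewrite big1 => [|i _]; last first.
  rewrite big1 // => j ij; case: ifP => // /andP[_ /eqP [yi sj]].
  by case: ns; exists j; rewrite yi.
apply/eqP; apply: contraTT isT => /f1 h; have := path_deg_ge (y, s).
rewrite h /=; case: s ns h => [|j [|//]] ns //= h _.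
case: ns; exists j; split=> //; apply/zz_step_orient.
by move: h; rewrite /path_deg /= addr0.
Qed.

Lemma zz_degN1 (x : A) : bgr (-1, 0) x -> x = 0.
Proof.
move=> [f f1 <-]; apply/quot_pi_eq0; suff -> : f = 0 by case: (ideal_genP S).
apply/pathalgP => w; apply/eqP; apply: contraTT isT => /f1 h.
by have := path_deg_ge w; rewrite h.
Qed.

End ZigzagLowDegree.

(** * Bigraded modules *)

Lemma sum_support (T : eqType) (V : zmodType) (s q : seq T) (f : T -> V) :
  uniq s -> uniq q -> {subset s <= q} -> (forall d, d \notin s -> f d = 0) ->
  \sum_(d <- s) f d = \sum_(d <- q) f d.
Proof.
move=> us uq sq f0; rewrite [RHS](bigID (mem s)) /= [X in _ = _ + X]big1 ?addr0 => [|e /f0 //].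
rewrite -[RHS]big_filter; apply: perm_big; apply: uniq_perm => //; first by rewrite filter_uniq.
by move=> e; rewrite mem_filter; case: (boolP (e \in s)) => // /sq ->.
Qed.

Section BigradingProjection.
Variables (V : zmodType) (c : bideg -> set V).
Hypothesis cP : bigrading c.

Lemma bigrading0 d : c d 0. Proof. by case: cP => + _ _ _; apply. Qed.

Lemma bigradingB d x y : c d x -> c d y -> c d (x - y).
Proof. by case: cP => _ + _ _; apply. Qed.

Lemma bigradingD d x y : c d x -> c d y -> c d (x + y).
Proof. by move=> dx dy; have := bigradingB dx (bigradingB (bigrading0 d) dy);
  rewrite sub0r opprK. Qed.

Lemma bigrading_sum d (J : Type) (s : seq J) (P : pred J) (F : J -> V) :
  (forall j, P j -> c d (F j)) -> c d (\sum_(j <- s | P j) F j).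
Proof. by move=> cF; elim/big_ind: _ => //; [exact: bigrading0|move=> x y;
  exact: bigradingD]. Qed.

Lemma bigrading_decomposition x : exists (s : seq bideg) (f : bideg -> V),
  [/\ uniq s, forall d, c d (f d), forall d, d \notin s -> f d = 0 & x = \sum_(d <- s) f d].
Proof.
case: cP => _ _ /(_ x) [s [f [cf ->]]] _.
(* A degree repeated in [s] contributes its component once per occurrence; the multiplicity merges
   these. *)
exists (undup s), (fun d => f d *+ count_mem d s); split; first exact: undup_uniq.
- move=> d; elim: (count_mem d s) => [|k IHk]; rewrite ?mulr0n ?mulrS; first exact: bigrading0.
  exact: bigradingD.
- by move=> d; rewrite mem_undup => /count_memPn ->.
- by rewrite -big_undup_iterop_count.
Qed.

Lemma bigrading_decomposition_uniq (s t : seq bideg) (f g : bideg -> V) :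
  uniq s -> uniq t -> (forall d, c d (f d)) -> (forall d, c d (g d)) ->
  (forall d, d \notin s -> f d = 0) -> (forall d, d \notin t -> g d = 0) ->
  \sum_(d <- s) f d = \sum_(d <- t) g d -> forall d, f d = g d.
Proof.
move=> us ut cf cg f0 g0 fg d; pose r := undup (s ++ t).
have [dr|] := boolP (d \in r); last first.
  by rewrite mem_undup mem_cat negb_or => /andP[ds dt]; rewrite f0 ?g0.
have [_ _ _ indep] := cP; apply/eqP; rewrite -subr_eq0; apply/eqP.
apply: (indep r (fun d => f d - g d)) => //; first exact: undup_uniq.
  by move=> e; apply: bigradingB.
rewrite sumrB -(sum_support (f := f) us) ?undup_uniq // -?(sum_support (f :=
  g) ut) ?undup_uniq ?fg ?subrr // => e.
  by rewrite mem_undup mem_cat orbC => ->.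
by rewrite mem_undup mem_cat => ->.
Qed.

(** [bigrading] only asserts that decompositions exist and are independent; the projections turn
    components into additive maps that can be applied through sums. *)
Definition graded_projection (p : bideg -> V -> V) : Prop :=
  [/\ forall d, {morph p d : x y / x + y}, forall d x, c d (p d x),
      forall d e x, c e x -> p d x = if d == e then x else 0 &
      forall x, exists s, [/\ uniq s, x = \sum_(d <- s) p d x & forall d, d \notin s ->
        p d x = 0]].

Lemma bigrading_proj : exists p, graded_projection p.
Proof.
have /choice [p hp] : forall x, exists f : bideg -> V, exists s,
    [/\ uniq s, forall d, c d (f d), forall d, d \notin s -> f d = 0 & x = \sum_(d <- s) f d].
  by move=> x; have [s [f h]] := bigrading_decomposition x; exists f, s.
exists (fun d x => p x d); split.
- move=> d x y; have [s [us cs s0 xE]] := hp x; have [t [ut ct t0 yE]] := hp y.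
  have [r [ur cr r0 xyE]] := hp (x + y); pose q := undup (s ++ t).
  apply: (bigrading_decomposition_uniq (s := r) (t := q) (g := fun d => p x d + p y d)) => //.
  + exact: undup_uniq.
  + by move=> e; apply: bigradingD.
  + by move=> e; rewrite mem_undup mem_cat negb_or => /andP[/s0 -> /t0 ->]; rewrite addr0.
  + rewrite -xyE big_split /= -(sum_support (f :=
      p x) us) ?undup_uniq // -?(sum_support (f := p y) ut) ?undup_uniq //.
    * by rewrite -xE -yE.
    * by move=> e; rewrite mem_undup mem_cat orbC => ->.
    * by move=> e; rewrite mem_undup mem_cat => ->.
- by move=> d x; have [s []] := hp x.
- move=> d e x ex; have [s [us cs s0 xE]] := hp x.
  apply: (bigrading_decomposition_uniq (s := s) (t := [:: e])
      (g := fun d => if d == e then x else 0)) => //.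
  + by move=> d'; case: eqP => [->|_] //; exact: bigrading0.
  + by move=> d'; rewrite inE => /negPf ->.
  + by rewrite -xE big_seq1 eqxx.
- by move=> x; have [s [us cs s0 xE]] := hp x; exists s.
Qed.

End BigradingProjection.

Section GradedModules.
Variable A : bgring.

Lemma bghom0 (M N : bgmod A) (f : M -> N) : linear f -> f 0 = 0.
Proof. by move=> fl; have := fl (-1) 0 0; rewrite scaler0 add0r scaleN1r addNr. Qed.

Lemma bghomD (M N : bgmod A) (f : M -> N) : linear f -> {morph f : x y / x + y}.
Proof. by move=> fl x y; have := fl 1 x y; rewrite !scale1r. Qed.

Lemma bghomZ (M N : bgmod A) (f : M -> N) : linear f -> forall a x, f (a *: x) = a *: f x.
Proof. by move=> fl a x; have := fl a x 0; rewrite (bghom0 fl) !addr0. Qed.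

Lemma bghom_sum (M N : bgmod A) (f : M -> N) : linear f ->
  forall (J : Type) (s : seq J) (P : pred J) (F : J -> M),
  f (\sum_(j <- s | P j) F j) = \sum_(j <- s | P j) f (F j).
Proof. by move=> fl J s P F; apply: (big_morph f); [exact: bghomD|exact: bghom0]. Qed.

Lemma bghom_comp (M N L : bgmod A) (f : M -> N) (g : N -> L) :
  bghom f -> bghom g -> bghom (fun x => g (f x)).
Proof. by move=> [fl fd] [gl gd]; split=> [a x y|d x /fd/gd //]; rewrite fl gl. Qed.

(** The component of degree [d] of any preimage is again a preimage. *)
Lemma bghom_homog_preimage (M N : bgmod A) (p : M -> N) d (y : N) :
  bghom p -> (forall y, exists x, p x = y) -> bgm d y -> exists2 x, bgm d x & p x = y.
Proof.
move=> [pl pd] ps dy; have [x0 x0y] := ps y.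
have [q [qD qd qE qs]] := bigrading_proj (bgmP M).
have [q' [qD' qd' qE' _]] := bigrading_proj (bgmP N).
have q0' e : q' e 0 = 0 by rewrite (qE' _ e) ?if_same //; exact: (bigrading0 (bgmP N)).
have [s [us x0E s0]] := qs x0; exists (q d x0) => //.
have -> : y = q' d y by rewrite (qE' _ d) ?eqxx.
rewrite -x0y {2}x0E (bghom_sum pl) (big_morph _ (qD' d) (q0' d)).
under eq_bigr => e _ do rewrite (qE' d e _ (pd _ _ (qd e x0))).
rewrite -big_mkcond /=; have [ds|ds] := boolP (d \in s).
  by rewrite (big_rem d) //= eqxx big1_seq ?addr0 // => e /andP[/eqP <-]; rewrite mem_rem_uniqF.
rewrite s0 // (bghom0 pl) big1_seq // => e /andP[/eqP <-]; by rewrite (negPf ds).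
Qed.

End GradedModules.

Section VertexBases.
Variables (K : fieldType) (G : oriented_dynkin).
Local Notation A := (zigzag K G).
Local Notation E i := (@zz_vert K G i 1).
Implicit Types (N : bgmod A) (t d : bideg) (i j k : G).

Lemma zz_vert_idem i : E i * E i = E i.
Proof. by rewrite zz_vert_mul eqxx mulr1. Qed.

Lemma zz_vert_deg0 i (x : A) : bgr 0 x -> exists c : K, E i * x = zz_vert i c.
Proof.
move=> /zz_deg0 [a ->]; exists (a i); rewrite mulr_sumr (bigD1 i) //= big1 ?addr0 => [|j ji].
  by rewrite zz_vert_mul eqxx mul1r.
by rewrite zz_vert_mul eq_sym (negPf ji).
Qed.

Lemma zz_vert_deg1 i (x : A) : bgr (1, 0) x ->
  exists c : G -> K, E i * x = \sum_(j | orient i j) zz_arrow i j (c j).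
Proof.
move=> /zz_deg1 [a ->]; exists (a i); rewrite mulr_sumr (bigD1 i) //=.
rewrite [X in _ + X]big1 ?addr0 => [|j ji].
  by rewrite mulr_sumr; apply: eq_bigr => j _; rewrite zz_vert_arrow eqxx mul1r.
by rewrite mulr_sumr big1 // => k _; rewrite zz_vert_arrow eq_sym (negPf ji).
Qed.

(* N is freely generated by elements b i a of bidegree t, with b i a generating
   a copy of P_i. *)
Record gbasis t N (n : G -> nat) (b : forall i, 'I_(n i) -> N) : Prop := GBasis {
  gb_deg : forall i a, bgm t (b i a);
  gb_vert : forall i a, E i *: b i a = b i a;
  gb_span : forall x, exists c : forall i, 'I_(n i) -> A, x = \sum_i \sum_a c i a *: b i a;
  gb_free : forall c : forall i, 'I_(n i) -> A,
    \sum_i \sum_a c i a *: b i a = 0 -> forall i a, c i a * E i = 0 }.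

Section Coordinates.
Variables (t : bideg) (N : bgmod A) (n : G -> nat) (b : forall i, 'I_(n i) -> N).
Hypothesis bP : gbasis t b.
Let lin (c : forall i, 'I_(n i) -> A) : N := \sum_i \sum_a c i a *: b a.

Lemma gb_vert_scale i j (x : K) a : zz_vert i x *: b (i :=
  j) a = if i == j then zz_vert i x *: b a else 0.
Proof.
rewrite -{1}(gb_vert bP) scalerA zz_vert_mul mulr1.
by case: eqP => // _; rewrite scale0r.
Qed.

Lemma gb_arrow_scale i j k (x : K) a :
  zz_arrow i j x *: b (i := k) a = if j == k then zz_arrow i j x *: b a else 0.
Proof.
rewrite -{1}(gb_vert bP) scalerA zz_arrow_vert mulr1.
by case: eqP => // _; rewrite scale0r.
Qed.

(** The coefficients given by [gb_span] need not be homogeneous, but keeping only their parts of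
    degree [d] does not change a homogeneous [x]. *)
Lemma gb_homog d x : bgm (d + t) x ->
  exists2 c : forall i, 'I_(n i) -> A, forall i a, bgr d (c i a) & x = lin c.
Proof.
move=> dx; have [c xc] := gb_span bP x.
have [q [qD qd qE qs]] := bigrading_proj (bgmP N).
have [p [pD pd pE ps]] := bigrading_proj (bgrP A).
have q0 e : q e 0 = 0 by rewrite (qE _ e) ?if_same //; exact: (bigrading0 (bgmP N)).
exists (fun i a => p d (c i a)) => [i a|]; first exact: pd.
have -> : x = q (d + t) x by rewrite (qE _ (d + t)) ?eqxx.
rewrite xc (big_morph _ (qD _) (q0 _)); apply: eq_bigr => i _.
rewrite (big_morph _ (qD _) (q0 _)); apply: eq_bigr => a _.
have [s [us cE s0]] := ps (c i a); rewrite {1}cE scaler_suml (big_morph _ (qD _) (q0 _)).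
under eq_bigr => e _ do rewrite (qE _ (e + t) _ (bgmZ (pd e (c i a)) (gb_deg bP a))) (inj_eq (addIr t)).
rewrite -big_mkcond /=; have [ds|ds] := boolP (d \in s).
  by rewrite (big_rem d) //= eqxx big1_seq ?addr0 // => e /andP[/eqP <-]; rewrite mem_rem_uniqF.
rewrite s0 // scale0r big1_seq // => e /andP[/eqP <-]; by rewrite (negPf ds).
Qed.

(** In degrees 0, (1, 0) and (-1, 0) relative to the basis, coefficients are combinations of
    vertices, combinations of oriented arrows, and 0. With the two lemmas below, this gives the
    coordinates of chain maps, of differentials and of homotopies. *)
Lemma gb_coord_vert i x : bgm t x -> E i *: x = x ->
  exists w : 'I_(n i) -> K, x = \sum_a zz_vert i (w a) *: b a.
Proof.
rewrite -{1}[t]add0r => /gb_homog [c cd ->] Ex.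
have /dep_choice [w wE] : forall j, exists w : 'I_(n j) ->
  K, forall a, E i * c j a = zz_vert i (w a).
  move=> j; have /choice [w wE] : forall a, exists u, E i * c j a = zz_vert i u.
    by move=> a; exact: zz_vert_deg0.
    by exists w.
exists (w i); rewrite -[LHS]Ex /lin scaler_sumr (bigD1 i) //= [X in _ + X]big1 ?addr0 =>
  [|j ji].
  by rewrite scaler_sumr; apply: eq_bigr => a _; rewrite scalerA wE.
rewrite scaler_sumr big1 // => a _.
by rewrite scalerA wE gb_vert_scale eq_sym (negPf ji).
Qed.

Lemma gb_coord_arrow i x : bgm ((1, 0) + t) x -> E i *: x = x ->
  exists w : forall j, 'I_(n j) -> K, x =
    \sum_(j | orient i j) \sum_a zz_arrow i j (w j a) *: b a.
Proof.
move=> /gb_homog [c cd ->] Ex.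
have /dep_choice [w wE] : forall j, exists w : 'I_(n j) -> G -> K,
    forall a, E i * c j a = \sum_(k | orient i k) zz_arrow i k (w a k).
  move=> j; have /choice [w wE] : forall a, exists u : G -> K,
      E i * c j a = \sum_(k | orient i k) zz_arrow i k (u k).
      by move=> a; exact: zz_vert_deg1.
    by exists w.
exists (fun j a => w j a j); rewrite -[LHS]Ex /lin scaler_sumr [RHS]big_mkcond.
apply: eq_bigr => j _; rewrite scaler_sumr.
case: ifP => [ij|ij]; last first.
  rewrite big1 // => a _; rewrite scalerA wE scaler_suml big1 // => k ik.
  by rewrite gb_arrow_scale; case: eqP => // kj; rewrite -kj ik in ij.
apply: eq_bigr => a _; rewrite scalerA wE scaler_suml (bigD1 j) //=.
rewrite [X in _ + X]big1 ?addr0 // => k /andP[_ /negPf kj].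
by rewrite gb_arrow_scale kj.
Qed.

Lemma gb_coord_neg (x : N) : bgm ((-1, 0) + t) x -> x = 0.
Proof.
move=> /gb_homog [c cd ->]; rewrite /lin big1 // => i _; rewrite big1 // => a _.
by rewrite (zz_degN1 (cd i a)) scale0r.
Qed.

Lemma gb_vert_inj i (w w' : 'I_(n i) -> K) :
  \sum_a zz_vert i (w a) *: b a = \sum_a zz_vert i (w' a) *: b a -> forall a, w a = w' a.
Proof.
move=> ww a; have [u ui u0] := dep_update (U := fun j => 'I_(n j) -> K)
  (fun a => w a - w' a) (fun j a => 0).
have h : lin (fun j a => zz_vert i (u j a)) = 0.
  rewrite /lin (bigD1 i) //= [X in _ + X]big1 ?addr0 => [|j ji].
    rewrite ui; under eq_bigr do rewrite zz_vertB scalerBl.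
    by rewrite sumrB ww subrr.
  by rewrite big1 // => c _; rewrite gb_vert_scale eq_sym (negPf ji).
have := gb_free bP h a; rewrite ui zz_vert_mul eqxx mulr1 => /zz_vert_eq0 /eqP.
by rewrite subr_eq0 => /eqP.
Qed.

Lemma gb_arrow_inj i (w w' : forall j, 'I_(n j) -> K) :
  \sum_(j | orient i j) \sum_a zz_arrow i j (w j a) *: b a =
  \sum_(j | orient i j) \sum_a zz_arrow i j (w' j a) *: b a ->
  forall j a, orient i j -> w j a = w' j a.
Proof.
move=> ww j a ij.
pose u k a := if orient i k then zz_arrow i k (w k a - w' k a) else 0.
have h : lin u = 0.
  rewrite /lin (bigID (orient i)) /= [X in _ + X]big1 ?addr0 => [|k /negPf ik]; last first.
    by rewrite big1 // => c _; rewrite /u ik scale0r.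
  move/eqP: ww; rewrite -subr_eq0 -sumrB => /eqP ww; rewrite -[RHS]ww.
  apply: eq_bigr => k ik; rewrite -sumrB; apply: eq_bigr => c _.
  by rewrite /u ik zz_arrowB scalerBl.
have := gb_free bP h a; rewrite /u ij zz_arrow_vert eqxx mulr1 => /(zz_arrow_eq0 ij) /eqP.
by rewrite subr_eq0 => /eqP.
Qed.

Lemma gb_neq0 i (a : 'I_(n i)) : b a <> 0.
Proof.
move=> b0; have := @gb_vert_inj i (fun c => (c == a)%:R) (fun=> 0) _ a.
rewrite eqxx => h; have /eqP := oner_neq0 K; apply; apply: h.
rewrite [RHS]big1 => [|c _]; last by rewrite zz_vert0 scale0r.
rewrite (bigD1 a) //= b0 scaler0 add0r big1 // => c /negPf ->.
by rewrite mulr0n zz_vert0 scale0r.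
Qed.

Lemma gb_hom_exists (M : bgmod A) (y : forall i, 'I_(n i) -> M) :
  (forall i a, bgm t (y i a)) -> (forall i a, E i *: y i a = y i a) ->
  exists2 f : N -> M, bghom f & forall i a, f (b a) = y i a.
Proof.
move=> yd yE; have /choice [c cE] := gb_span bP.
pose ly (c : forall i, 'I_(n i) -> A) : M := \sum_i \sum_a c i a *: y i a.
(* Coefficients are determined only after right multiplication by [E i], which suffices because
   [E i] fixes [y i a]. *)
have wd c1 c2 : lin c1 = lin c2 -> ly c1 = ly c2.
  move=> e; have h : lin (fun i a => c1 i a - c2 i a) = 0.
    move/eqP: e; rewrite -subr_eq0 -sumrB => /eqP e; rewrite -[RHS]e; apply: eq_bigr => i _.
    by rewrite -sumrB; apply: eq_bigr => a _; rewrite scalerBl.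
  apply: eq_bigr => i _; apply: eq_bigr => a _; rewrite -yE !scalerA; congr (_ *: _).
  by apply/eqP; rewrite -subr_eq0 -mulrBl (gb_free bP h).
have fE x e : lin e = x -> ly (c x) = ly e by move=> ex; apply: wd; rewrite ex [RHS]cE.
have lyD c1 c2 u : ly (fun i a => u * c1 i a + c2 i a) = u *: ly c1 + ly c2.
  rewrite scaler_sumr -big_split; apply: eq_bigr => i _; rewrite scaler_sumr -big_split.
  by apply: eq_bigr => j _; rewrite scalerDl scalerA.
exists (fun x => ly (c x)).
  split=> [u x x'|d x]; last first.
    rewrite -{1}[d](subrK t) => /gb_homog [e ed xe]; rewrite (fE _ e) //.
    apply: (bigrading_sum (bgmP M)) => i _; apply: (bigrading_sum (bgmP M)) => k _.
    by rewrite -[d](subrK t); apply: bgmZ.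
  rewrite -lyD; apply: fE; rewrite {2}(cE x) {2}(cE x') scaler_sumr -big_split.
  apply: eq_bigr => i _; rewrite scaler_sumr -big_split.
  by apply: eq_bigr => j _; rewrite scalerDl scalerA.
move=> i a; have [u ui u0] := dep_update (U := fun j => 'I_(n j) -> A)
  (fun e => if e == a then 1 else 0) (fun j e => 0).
have pick (L : bgmod A) (z : forall j, 'I_(n j) -> L) : \sum_j \sum_e u j e *: z j e = z i a.
  rewrite (bigD1 i) //= [X in _ + X]big1 ?addr0 => [|j ji]; last first.
    by rewrite big1 // => e _; rewrite u0 // scale0r.
  rewrite ui (bigD1 a) //= eqxx scale1r big1 ?addr0 // => e /negPf ->.
  by rewrite scale0r.
by rewrite (fE _ u) ?/ly ?/lin ?pick.
Qed.

Lemma gb_hom_ext (M : bgmod A) (f g : N -> M) : linear f -> linear g ->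
  (forall i a, f (b (i := i) a) = g (b a)) -> forall x, f x = g x.
Proof.
move=> fl gl fg x; have [c ->] := gb_span bP x.
rewrite (bghom_sum fl) (bghom_sum gl); apply: eq_bigr => i _.
rewrite (bghom_sum fl) (bghom_sum gl); apply: eq_bigr => a _.
by rewrite (bghomZ fl) (bghomZ gl) fg.
Qed.

(** Images of basis elements are lifted to homogeneous preimages and multiplied by the idempotent;
    [gb_hom_exists] then extends the lift. *)
Lemma gb_projective : projective N.
Proof.
move=> L L' p f pP ps [fl fd].
have /dep_choice [y yP] : forall j : {i : G & 'I_(n i)}, exists y : L,
    [/\ bgm t y, E (tag j) *: y = y & p y = f (b (tagged j))].
  move=> [i a] /=; have [y dy py] := bghom_homog_preimage pP ps (fd _ _ (gb_deg bP a)).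
  exists (E i *: y); split.
  - by rewrite -[t]add0r; apply: bgmZ => //; exact: zz_vert_deg.
  - by rewrite scalerA zz_vert_idem.
  - by rewrite (bghomZ pP.1) py -(bghomZ fl) (gb_vert bP).
have [||g gP gE] := @gb_hom_exists L (fun i a => y (Tagged (fun i => 'I_(n i)) a)).
- by move=> i a; case: (yP (Tagged (fun i => 'I_(n i)) a)).
- by move=> i a; case: (yP (Tagged (fun i => 'I_(n i)) a)).
exists g => //; apply: gb_hom_ext => //.
  by move=> u x x'; rewrite gP.1 pP.1.
by move=> i a; rewrite gE; case: (yP (Tagged (fun i => 'I_(n i)) a)).
Qed.

Lemma gb_finitely_generated : finitely_generated N.
Proof.
pose J : finType := {i : G & 'I_(n i)}.
exists #|J|, (fun m => b (tagged (enum_val m : J))) => x.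
have [c ->] := gb_span bP x; exists (fun m => c _ (tagged (enum_val m : J))).
rewrite sig_big_dep /=.
by rewrite (reindex (enum_val : 'I_#|J| -> J)) //=; apply: onW_bij; exact: enum_val_bij.
Qed.

End Coordinates.

Lemma gb_shift t N n (b : forall i, 'I_(n i) -> N) (u : bideg) :
  gbasis t b -> gbasis (N := bgshift u N) (t + u) b.
Proof.
move=> [bd bE bs bf]; split=> // i a.
by rewrite /= /bgshift_comp addrK.
Qed.

(** Applied with a sign [s], to absorb the sign in the differential of a shifted complex. *)
Lemma gb_signed t N n (b : forall i, 'I_(n i) -> N) (s : A) : s * s = 1 -> bgr 0 s ->
  (forall x, s * x = x * s) -> gbasis t b -> gbasis t (fun i a => s *: b i a).
Proof.
move=> ss s0 sC [bd bE bs bf]; split=> [i a|i a|x|c h i a].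
- by rewrite -[t]add0r; exact: bgmZ.
- by rewrite scalerA -sC -scalerA bE.
- have [c ->] := bs x; exists (fun i a => c i a * s); apply: eq_bigr => i _.
  by apply: eq_bigr => a _; rewrite scalerA -mulrA ss mulr1.
- have := bf (fun i a => c i a * s) _ i a; rewrite -mulrA sC mulrA => h0.
  rewrite -[c i a * _]mulr1 -ss mulrA h0 ?mul0r // -[RHS]h.
  by apply: eq_bigr => j _; apply: eq_bigr => e _; rewrite scalerA.
Qed.

End VertexBases.

Lemma bgr_proj_mulr (A : bgring) p d (x e : A) :
  graded_projection (bgr (b := A)) p -> bgr 0 e -> p d (x * e) = p d x * e.
Proof.
move=> [pD pd pE ps] e0; have [s [us xE s0]] := ps x.
have p0 : p d 0 = 0 by rewrite (pE _ d) ?if_same //; exact: (bigrading0 (bgrP A)).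
have h c : bgr c (p c x * e) by rewrite -[c]addr0; apply: bgrM; rewrite ?addr0.
rewrite {1}xE mulr_suml (big_morph _ (pD d) p0).
under eq_bigr => c _ do rewrite (pE d c _ (h c)).
rewrite -big_mkcond /=; have [ds|ds] := boolP (d \in s).
  by rewrite (big_rem d) //= eqxx big1_seq ?addr0 // => c /andP[/eqP <-]; rewrite mem_rem_uniqF.
by rewrite s0 // mul0r big1_seq // => c /andP[/eqP <-]; rewrite (negPf ds).
Qed.

Section FreeModule.
Variables (A : bgring) (J : finType) (e : J -> A).
Hypotheses (e_deg : forall j, bgr 0 (e j)) (e_idem : forall j, e j * e j = e j).

(** For idempotents [e j] the condition cuts the direct sum of the left ideals A e_j out of the free
    module. *)
Definition free_pred : {pred {ffun J ->
  A^o}} := fun f => `[< forall j, (f j : A) * e j = f j >].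

Lemma free_submod_closed : submod_closed free_pred.
Proof.
split=> [|a f g /asboolP fe /asboolP ge]; apply/asboolP => j; rewrite !ffunE.
  by rewrite mul0r.
by rewrite mulrDl ge; congr (_ + _); rewrite -[LHS]mulrA fe.
Qed.
HB.instance Definition _ :=
  GRing.isSubmodClosed.Build A {ffun J -> A^o} free_pred free_submod_closed.

Record free_mod := FreeMod {
  free_val :> {ffun J -> A^o};
  free_valP : free_val \in free_pred }.

HB.instance Definition _ := [isSub for free_val].
HB.instance Definition _ := [Choice of free_mod by <:].
HB.instance Definition _ := [SubChoice_isSubLmodule of free_mod by <:].

Lemma free_mod_sum (T : Type) (s : seq T) (P : pred T) (f : T -> free_mod) j :
  (\sum_(d <- s | P d) f d : free_mod) j = \sum_(d <- s | P d) f d j.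
Proof. by elim/big_rec2: _ => [|i x y _ <-]; rewrite ffunE. Qed.

Lemma free_mod_scale a (f : free_mod) j : (a *: f : free_mod) j = a * f j.
Proof. by rewrite ffunE. Qed.

Definition free_comp (d : bideg) : set free_mod := fun f => forall j, bgr d (f j : A).

Lemma free_compP : bigrading free_comp.
Proof.
have P := bgrP A; have [p pP] := bigrading_proj P; have [pD pd pE ps] := pP; split.
- by move=> d j; rewrite ffunE; exact: (bigrading0 P).
- by move=> d x y dx dy j; rewrite !ffunE; apply: (bigradingB P); [exact: dx|exact: dy].
- move=> x.
  have /dep_choice [s sP] : forall j, exists s : seq bideg,
    [/\ uniq s, (x j : A) = \sum_(d <- s) p d (x j) & forall d, d \notin s -> p d (x j) = 0].
    by move=> j; exact: ps.
  have pe d : [ffun j => p d (x j) : A^o] \in free_pred.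
    apply/asboolP => j; rewrite ffunE; have /asboolP /(_ j) xe := free_valP x.
    by rewrite -[LHS](bgr_proj_mulr d (x j : A) pP (e_deg j)) xe.
  exists (undup (flatten [seq s j | j : J])), (fun d => FreeMod (pe d)); split=> [d j|].
    by rewrite ffunE.
  apply/val_inj/ffunP => j /=; rewrite free_mod_sum /=.
  have [us xs s0] := sP j.
  under eq_bigr do rewrite ffunE.
  rewrite {1}xs; apply: (sum_support (V := A)) => //; first exact: undup_uniq.
  move=> d ds; rewrite mem_undup; apply/flattenP; exists (s j) => //.
  by apply: map_f; rewrite mem_enum.
- move=> s f us fA sf0 d ds; apply/val_inj/ffunP => j /=; rewrite ffunE.
  have [_ _ _ indep] := P; apply: (indep s (fun d => f d j) us) => // [c|]; first exact: fA.
  by rewrite -free_mod_sum sf0 ffunE.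
Qed.

Lemma free_compZ c d a x : bgr c a -> free_comp d x -> free_comp (c + d) (a *: x).
Proof. by move=> ca dx j; rewrite ffunE; apply: bgrM; last exact: dx. Qed.

Definition free_bgmod : bgmod A := BGMod free_compP free_compZ.

End FreeModule.

Section DirectSums.
Variables (K : fieldType) (G : oriented_dynkin).
Local Notation A := (zigzag K G).
Local Notation E i := (@zz_vert K G i 1).
Implicit Types (N : bgmod A) (t d : bideg) (i : G).

Lemma gbasis_exists t (n : G -> nat) :
  exists (N : bgmod A) (b : forall i, 'I_(n i) -> N), gbasis t b.
Proof.
pose J : finType := {i : G & 'I_(n i)}.
pose T i a : J := Tagged (fun i => 'I_(n i)) (a : 'I_(n i)).
pose e (j : J) : A := E (tag j).
have e0 j : bgr 0 (e j) by exact: zz_vert_deg.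
have ee j : e j * e j = e j by exact: zz_vert_idem.
pose F : bgmod A := free_bgmod e0.
have gen (j : J) : [ffun k => if k == j then e j : A^o else 0] \in free_pred e.
  apply/asboolP => k; rewrite ffunE; case: eqP => [->|_]; first exact: ee.
  exact: mul0r.
pose g (j : J) : F := FreeMod (gen j).
have lin (c : forall i, 'I_(n i) -> A) (k : J) :
    (\sum_i \sum_a c i a *: g (T _ a) : F) k = c (tag k) (tagged k) * e k.
  have gE j l : free_val (g j) l = if l == j then e j : A^o else 0 by rewrite ffunE.
  rewrite sig_big_dep free_mod_sum.
  under eq_bigr => j _ do rewrite free_mod_scale gE.
  rewrite (bigD1 k) //= big1 ?addr0 => [|j jk]; first by case: k => i a /=; rewrite eqxx.
  by case: j jk => i a /= /negPf; rewrite eq_sym => ->; exact: mulr0.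
suff gb : gbasis (N := F) (n := n) 0 (fun i a => g (T _ a)).
  exists (bgshift t F), (fun i a => g (T _ a)).
  by have := gb_shift t gb; rewrite add0r.
split=> [i a k|i a|x|c h i a].
- rewrite ffunE; case: eqP => // _; exact: (bigrading0 (bgrP A)).
- apply/val_inj/ffunP => k /=; rewrite !ffunE; case: eqP => _; last exact: mulr0.
  exact: (ee (T i a)).
- exists (fun i a => x (T _ a)); apply/val_inj/ffunP => k /=.
  have := lin (fun i a => x (T _ a)) k => /= ->.
  by have /asboolP /(_ k) <- := free_valP x; case: k.
- have := lin c (T _ a); rewrite h ffunE /= => <- //.
Qed.

Section DirsumBasis.
Variables (t : bideg) (N : bgmod A) (n : G -> nat).
Local Notation summand j := (bgshift t (zz_proj K (tag (j : {i : G & 'I_(n i)})))).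

Lemma lideal_mulr i (u : lideal (zz_idem K i)) : (lideal_val u : A) * E i = lideal_val u.
Proof.
have /asboolP [y ->] := lideal_valP u; rewrite -zz_vert1.
by rewrite -[LHS]mulrA zz_vert_idem.
Qed.

Lemma lideal_mem i (x : A) : (x * E i : A^o) \in lideal_pred (zz_idem K i).
Proof. by apply/asboolP; exists x; rewrite zz_vert1. Qed.

Lemma gbasis_dirsum (b : forall i, 'I_(n i) -> N) : gbasis t b ->
  is_dirsum N (fun j => summand j).
Proof.
move=> bP; exists (fun j (u : summand j) => (lideal_val u : A) *: b _ (tagged j)); split.
  move=> j; split=> [a u v|d u du]; first by rewrite scalerA -scalerDl.
  by rewrite -[d](subrK t); apply: bgmZ; [exact: du|exact: (gb_deg bP)].
move=> x; have [c xc] := gb_span bP x.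
pose c' (j : {i : G & 'I_(n i)}) : summand j := LIdeal (lideal_mem (tag j) (c _ (tagged j))).
exists c'; split.
  rewrite {1}xc sig_big_dep /=; apply: eq_bigr => j _.
  by rewrite -[RHS]scalerA (gb_vert bP).
move=> u xu; apply: functional_extensionality_dep => j; apply/val_inj => /=.
pose v i (a : 'I_(n i)) : A := lideal_val (u (Tagged (fun i => 'I_(n i)) a)).
have h : \sum_i \sum_a (c i a - v i a) *: b i a = 0.
  rewrite -[RHS](subrr x).
  have xv : x = \sum_i \sum_a v i a *: b i a.
    by rewrite {1}xu [RHS]sig_big_dep /=; apply: eq_bigr => -[i a] _.
  rewrite {1}xc {1}xv -sumrB.
  by apply: eq_bigr => i _; rewrite -sumrB; apply: eq_bigr => a _; rewrite scalerBl.
have /eqP := gb_free bP h (tagged j); rewrite mulrBl subr_eq0 => /eqP ->.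
by case: j => i a; exact: lideal_mulr.
Qed.

(** The basis consists of the images of the generators e_i of the summands. *)
Lemma dirsum_gbasis : is_dirsum N (fun j => summand j) ->
  exists b : forall i, 'I_(n i) -> N, gbasis t b.
Proof.
move=> [f [fP fU]].
pose g i : lideal (zz_idem K i) := LIdeal (lideal_mem i 1).
pose T i a : {i : G & 'I_(n i)} := Tagged (fun i => 'I_(n i)) (a : 'I_(n i)).
pose b i a : N := f (T i a) (g i).
have fE (j : {i : G & 'I_(n i)}) (u : lideal (zz_idem K (tag j))) :
    f j u = (lideal_val u : A) *: b _ (tagged j).
  case: j u => i a u; rewrite /b /= -(bghomZ (fP _).1); congr (f _ _).
  by apply/val_inj; rewrite /= mul1r -[LHS]lideal_mulr.
exists b; split=> [i a|i a|x|c h i a].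
- apply: (fP (T i a)).2; rewrite /= /bgshift_comp subrr /= mul1r.
  exact: zz_vert_deg.
- rewrite /b -(bghomZ (fP _).1); congr (f _ _); apply/val_inj => /=.
  by rewrite mul1r; exact: zz_vert_idem.
- have [u [-> _]] := fU x; exists (fun i a => lideal_val (u (T i a))).
  by rewrite sig_big_dep /=; apply: eq_bigr => -[i a] _; rewrite fE.
(* Freeness: the families 0 and [c i a * E i] both decompose the zero element, so they coincide. *)
- have [u [_ uU]] := fU 0.
  pose z (j : {i : G & 'I_(n i)}) : summand j := 0.
  pose v (j : {i : G & 'I_(n i)}) : summand j := LIdeal (lideal_mem (tag j) (c _ (tagged j))).
  have uz : u = z by apply: uU; rewrite big1 // => j _; exact: (bghom0 (fP _).1).
  have uv : u = v.
    apply: uU; rewrite -[LHS]h sig_big_dep /=; apply: eq_bigr => -[i' a'] _.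
    rewrite fE /= -scalerA; congr (_ *: _); rewrite /b -(bghomZ (fP _).1); congr (f _ _).
    by apply/val_inj; rewrite /= mul1r; exact/esym/zz_vert_idem.
  by have := congr1 (fun w => lideal_val (w (T i a))) (etrans (esym uv) uz).
Qed.

End DirsumBasis.
End DirectSums.

(** * The homotopy category *)

Section HomotopyCategory.
Variable A : bgring.
Implicit Types (M N L : bgmod A) (X Y Z : cplx A).

Lemma bghom_id M : bghom (fun x : M => x).
Proof. by []. Qed.

Lemma bghom_zero M N : bghom (fun _ : M => 0 : N).
Proof. by split=> [a x y|d x _]; rewrite ?scaler0 ?addr0 //; exact: (bigrading0 (bgmP N)). Qed.

Lemma bghom_add M N (f g : M -> N) : bghom f -> bghom g -> bghom (fun x => f x + g x).
Proof.
move=> [fl fd] [gl gd]; split=> [a x y|d x dx].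
  by rewrite fl gl scalerDr addrACA.
by apply: (bigradingD (bgmP N)); [exact: fd|exact: gd].
Qed.

Lemma bghom_opp M N (f : M -> N) : bghom f -> bghom (fun x => - f x).
Proof.
move=> [fl fd]; split=> [a x y|d x dx]; first by rewrite fl opprD scalerN.
by rewrite -sub0r; apply: (bigradingB (bgmP N)); [exact: (bigrading0 (bgmP N))|exact: fd].
Qed.

Lemma bghomB M N (f : M -> N) : linear f -> {morph f : x y / x - y}.
Proof. by move=> fl x y; rewrite (bghomD fl) -scaleN1r (bghomZ fl) scaleN1r. Qed.

Lemma bghomN M N (f : M -> N) : linear f -> {morph f : x / - x}.
Proof. by move=> fl x; rewrite -scaleN1r (bghomZ fl) scaleN1r. Qed.

Lemma cdiffD X k l : {morph @cdiff A X k l : x y / x + y}.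
Proof. exact: bghomD (cdiff_hom X k l).1. Qed.

Definition cfam X Y := forall k, X k -> Y k.

Lemma chain_map_id X : chain_map (fun k (x : X k) => x).
Proof. by split=> // k; exact: bghom_id. Qed.

Lemma chain_map0 X Y : chain_map (fun k (x : X k) => 0 : Y k).
Proof.
split=> [k|k l x]; first exact: bghom_zero.
by rewrite (bghom0 (cdiff_hom Y k l).1).
Qed.

Lemma chain_map_comp X Y Z (f : cfam X Y) (g : cfam Y Z) :
  chain_map f -> chain_map g -> chain_map (fun k x => g k (f k x)).
Proof.
move=> [fh fd] [gh gd]; split=> [k|k l x]; first exact: bghom_comp.
by rewrite fd gd.
Qed.

Lemma map_eq_homotopic X Y (f g : cfam X Y) : map_eq f g -> homotopic f g.
Proof.
move=> fg; exists (fun k l _ => 0); split=> [k l|k x]; first exact: bghom_zero.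
by rewrite fg subrr (bghom0 (cdiff_hom Y _ _).1) addr0.
Qed.

Lemma homotopic_sym X Y (f g : cfam X Y) : homotopic f g -> homotopic g f.
Proof.
move=> [h [hh fg]]; exists (fun k l x => - h k l x); split=> [k l|k x].
  exact: bghom_opp.
by rewrite -opprB fg opprD -(bghomN (cdiff_hom Y (k - 1) k).1).
Qed.

Lemma homotopic_trans X Y (f g u : cfam X Y) : homotopic f g -> homotopic g u -> homotopic f u.
Proof.
move=> [h [hh fg]] [h' [hh' gu]]; exists (fun k l x => h k l x + h' k l x); split=> [k l|k x].
  exact: bghom_add.
by rewrite -(subrKA (g k x)) fg gu cdiffD addrACA.
Qed.

Lemma homotopic_compl X Y Z (f g : cfam X Y) (u : cfam Y Z) :
  chain_map u -> homotopic f g -> homotopic (fun k x => u k (f k x)) (fun k x => u k (g k x)).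
Proof.
move=> [uh ud] [h [hh fg]]; exists (fun k l x => u l (h k l x)); split=> [k l|k x].
  exact: bghom_comp.
by rewrite -(bghomB (uh k).1) fg (bghomD (uh k).1) ud.
Qed.

Lemma homotopic_compr X Y Z (f g : cfam Y Z) (u : cfam X Y) :
  chain_map u -> homotopic f g -> homotopic (fun k x => f k (u k x)) (fun k x => g k (u k x)).
Proof.
move=> [uh ud] [h [hh fg]]; exists (fun k l x => h k l (u k x)); split=> [k l|k x].
  exact: bghom_comp.
by rewrite fg ud.
Qed.

Lemma iso_K_refl X : iso_K X X.
Proof.
exists (fun k x => x), (fun k x => x).
by split; try exact: chain_map_id; exact: map_eq_homotopic.
Qed.

Lemma iso_K_sym X Y : iso_K X Y -> iso_K Y X.
Proof. by move=> [f [g [? ? ? ?]]]; exists g, f. Qed.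

Lemma iso_K_trans X Y Z : iso_K X Y -> iso_K Y Z -> iso_K X Z.
Proof.
move=> [f [g [fc gc fg gf]]] [f' [g' [fc' gc' fg' gf']]].
exists (fun k x => f' k (f k x)), (fun k x => g k (g' k x)); split.
- exact: chain_map_comp.
- exact: chain_map_comp.
- apply: homotopic_trans fg.
  have := homotopic_compr fc fg'; exact: homotopic_compl.
- apply: homotopic_trans gf'.
  have := homotopic_compr gc' gf; exact: homotopic_compl.
Qed.

Lemma contractible_iso X Y : iso_K X Y -> contractible X -> contractible Y.
Proof.
move=> [f [g [fc gc fg gf]]] cX; apply: homotopic_trans (homotopic_sym gf) _.
have h := homotopic_compl fc (homotopic_compr gc cX).
apply: homotopic_trans h _; apply: map_eq_homotopic => k x.
exact: (bghom0 (fc.1 k).1).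
Qed.

Section ShiftMaps.
Variables (t : bideg) (n : int).

Lemma cshift_chain_map X Y (f : cfam X Y) : chain_map f ->
  @chain_map A (cshift t n X) (cshift t n Y) (fun k x => f (n + k) x).
Proof.
move=> [fh fd]; split=> [k|k l x]; first exact: bgshift_hom.
by rewrite /= /cshift_diff (bghomZ (fh _).1) fd.
Qed.

Lemma cshift_homotopic X Y (f g : cfam X Y) : homotopic f g ->
  @homotopic A (cshift t n X) (cshift t n Y) (fun k x => f (n + k) x) (fun k x => g (n + k) x).
Proof.
move=> [h [hh fg]].
(* The degrees [n + (k - 1)] and [n + k - 1] are not convertible, so the homotopy identity is
   restated with degrees given by equations. *)
have fg' m p q (x : X m) : p = m - 1 -> q = m + 1 ->
    f m x - g m x = cdiff m (h m p x) + h q m (cdiff q x).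
  by move=> -> ->.
pose s : A := (-1) ^+ `|n|%N.
exists (fun k l (x : cshift_term t n X k) => s *: h (n + k) (n + l) x : cshift_term t n Y l).
split=> [k l|k x].
  have [hl hd] := hh (n + k) (n + l); split=> [a x y|d x dx].
    by rewrite hl scalerDr !scalerA -commr_sign.
  rewrite /s -signr_odd; case: odd; last by rewrite expr0 scale1r; exact: hd.
  rewrite expr1 scaleN1r -sub0r; apply: (bigradingB (bgmP (Y (n + l)))); last exact: hd.
  exact: (bigrading0 (bgmP (Y (n + l)))).
rewrite (fg' _ (n + (k - 1)) (n + (k + 1))) ?addrA //= /cshift_diff.
have ss : s * s = 1 by rewrite /s -expr2 sqrr_sign.
rewrite (bghomZ (cdiff_hom Y _ _).1) (bghomZ (hh _ _).1) !scalerA ss !scale1r.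
by [].
Qed.

Lemma cshift_iso X Y : iso_K X Y -> iso_K (cshift t n X) (cshift t n Y).
Proof.
move=> [f [g [fc gc fg gf]]]; exists (fun k x => f (n + k) x), (fun k x => g (n + k) x); split.
- exact: cshift_chain_map.
- exact: cshift_chain_map.
- exact: (cshift_homotopic fg).
- exact: (cshift_homotopic gf).
Qed.

End ShiftMaps.

Lemma biproduct_iso X X' Y Z : iso_K X X' ->
  is_biproduct (@homotopic A) X Y Z -> is_biproduct (@homotopic A) X' Y Z.
Proof.
move=> [f [g [fc gc fg gf]]] [i1 [i2 [p1 [p2 [[ci1 ci2] [cp1 cp2] [h1 h2] [h3 h4] h]]]]].
exists (fun k y => f k (i1 k y)), (fun k z => f k (i2 k z)),
  (fun k x => p1 k (g k x)), (fun k x => p2 k (g k x)).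
have mid W W' (i : cfam W X) (p : cfam X W') (u : cfam W W') : chain_map i -> chain_map p ->
    homotopic (fun k y => p k (i k y)) u -> homotopic (fun k y => p k (g k (f k (i k y)))) u.
  move=> ci cp; apply: homotopic_trans.
  exact: (homotopic_compl cp (homotopic_compr ci fg)).
split; try by split; exact: chain_map_comp.
- by split; exact: mid.
- by split; exact: mid.
- apply: homotopic_trans gf.
  have := homotopic_compl fc (homotopic_compr gc h).
  by apply: homotopic_trans; apply: map_eq_homotopic => k x; rewrite (bghomD (fc.1 k).1).
Qed.

End HomotopyCategory.

(** * Complexes and graded representations *)

Section Realization.
Variables (K : fieldType) (G : oriented_dynkin).
Local Notation A := (zigzag K G).
Local Notation cplx := (cplx A).
Local Notation E i := (@zz_vert K G i 1).
Local Notation T := (int * G)%type.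
Implicit Types (M N : cplx) (V W : rep K T) (i j : G).

Definition graded_rel (s t : T) : bool := (t.1 == s.1 + 1) && orient s.2 t.2.

(* The multiplicity space of P_i<-k> in degree k is the space of V at (k, i);
   rows index the source, as in path composition from left to right. *)
Record realization M V (b : forall k i, 'I_(rdim V (k, i)) -> M k) : Prop := Realization {
  rz_basis : forall k, gbasis (n := fun i => rdim V (k, i)) (- k, 0) (b k);
  rz_diff : forall k l i a, l = k + 1 -> cdiff l (b k i a) =
    \sum_(j | orient i j) \sum_c zz_arrow i j (rmap V (k, i) (l, j) a c) *: b l j c }.

Definition mat_of M V (b : forall k i, 'I_(rdim V (k, i)) -> M k)
    N W (b' : forall k i, 'I_(rdim W (k, i)) -> N k) (phi : cfam M N) (f : rfam V W) : Prop :=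
  forall k i a, phi k (b k i a) = \sum_c zz_vert i (f (k, i) a c) *: b' k i c.

Section Pair.
Variables (M N : cplx) (V W : rep K T) (b : forall k i, 'I_(rdim V (k, i)) -> M k)
  (b' : forall k i, 'I_(rdim W (k, i)) -> N k).
Arguments b : clear implicits.
Arguments b' : clear implicits.
Hypotheses (bP : realization b) (bP' : realization b').

Lemma mat_of_exists (phi : cfam M N) : (forall k, bghom (phi k)) -> exists f, mat_of b b' phi f.
Proof.
move=> ph; have [|f fE] := @dep_choice T (fun s => 'M[K]_(rdim V s, rdim W s))
  (fun s => let: (k, i) := s return 'M[K]_(rdim V s, rdim W s) -> Prop in fun m =>
     forall a, phi k (b k i a) = \sum_c zz_vert i (m a c) *: b' k i c).
  move=> -[k i]; have /choice [w wE] : forall a, exists w : 'I_(rdim W (k, i)) -> K,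
      phi k (b k i a) = \sum_c zz_vert i (w c) *: b' k i c.
    move=> a; apply: (gb_coord_vert (rz_basis bP' k)).
      by apply: (ph k).2; exact: (gb_deg (rz_basis bP k)).
    by rewrite -(bghomZ (ph k).1) (gb_vert (rz_basis bP k)).
  exists (\matrix_(a, c) w a c) => a; rewrite wE; apply: eq_bigr => c _.
  by rewrite mxE.
by exists f => k i a; exact: (fE (k, i)).
Qed.

(** Together with [map_after_diff], this writes the two sides of the chain map equation in arrow
    coordinates, where their equality is the condition [rhom]. *)
Lemma diff_after_map (phi : cfam M N) f : (forall k, bghom (phi k)) -> mat_of b b' phi f ->
  forall k i a, cdiff (k + 1) (phi k (b k i a)) =
  \sum_(j | orient i j) \sum_e zz_arrow i j ((f (k, i) *m rmap W (k, i) (k + 1, j)) a e) *: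
     b' (k + 1) j e.
Proof.
move=> ph pf k i a; rewrite pf.
have dl := (cdiff_hom N k (k + 1)).1.
rewrite (bghom_sum dl).
under eq_bigr => c _ do rewrite (bghomZ dl) (rz_diff bP') // scaler_sumr.
rewrite exchange_big; apply: eq_bigr => j ij.
under eq_bigr => c _ do rewrite scaler_sumr.
rewrite exchange_big; apply: eq_bigr => e _.
rewrite mxE zz_arrow_sum scaler_suml; apply: eq_bigr => c _.
by rewrite scalerA zz_vert_arrow eqxx.
Qed.

Lemma map_after_diff (phi : cfam M N) f : (forall k, bghom (phi k)) -> mat_of b b' phi f ->
  forall k i a, phi (k + 1) (cdiff (k + 1) (b k i a)) =
  \sum_(j | orient i j) \sum_e zz_arrow i j ((rmap V (k, i) (k + 1, j) *m f (k + 1, j)) a e) *: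
     b' (k + 1) j e.
Proof.
move=> ph pf k i a; rewrite (rz_diff bP) //.
rewrite (bghom_sum (ph _).1); apply: eq_bigr => j ij.
rewrite (bghom_sum (ph _).1).
under eq_bigr => c _ do rewrite (bghomZ (ph _).1) pf scaler_sumr.
rewrite exchange_big; apply: eq_bigr => e _.
rewrite mxE zz_arrow_sum scaler_suml; apply: eq_bigr => c _.
by rewrite scalerA zz_arrow_vert eqxx.
Qed.

Lemma chain_map_rhom (phi : cfam M N) f : chain_map phi -> mat_of b b' phi f ->
  rhom graded_rel f.
Proof.
move=> [ph pd] pf [k i] [l j] /andP[/eqP /= lk ij]; subst l; apply/matrixP => a e.
have := pd k (k + 1) (b k i a).
rewrite (map_after_diff ph pf) (diff_after_map ph pf).
by move=> /(gb_arrow_inj (rz_basis bP' (k + 1))) ->.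
Qed.

Lemma rhom_chain_map f : rhom graded_rel f ->
  exists2 phi : cfam M N, chain_map phi & mat_of b b' phi f.
Proof.
move=> hf.
have /dep_choice [phi phiP] : forall k, exists p : M k -> N k, bghom p /\
    forall i a, p (b k i a) = \sum_c zz_vert i (f (k, i) a c) *: b' k i c.
  move=> k.
  have [||p ph pE] := gb_hom_exists (rz_basis bP k) (M := N k)
    (y := fun i a => \sum_c zz_vert i (f (k, i) a c) *: b' k i c).
  - move=> i a; apply: (bigrading_sum (bgmP (N k))) => c _.
    rewrite -[(- k, 0)]add0r; apply: bgmZ; first exact: zz_vert_deg.
    exact: (gb_deg (rz_basis bP' k)).
  - move=> i a; rewrite scaler_sumr; apply: eq_bigr => c _.
    by rewrite scalerA zz_vert_mul eqxx mul1r.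
  by exists p.
have ph k : bghom (phi k) := (phiP k).1.
have pf : mat_of b b' phi f by move=> k i a; exact: (phiP k).2.
exists phi => //; split=> // k l; have [->|lk] := eqVneq l (k + 1); last first.
  by move=> x; rewrite !cdiff_shape // (bghom0 (ph l).1).
apply: (gb_hom_ext (rz_basis bP k)) => [||i a].
- by move=> u x y; rewrite (cdiff_hom M _ _).1 (ph _).1.
- by move=> u x y; rewrite (ph _).1 (cdiff_hom N _ _).1.
rewrite (map_after_diff ph pf) (diff_after_map ph pf).
apply: eq_bigr => j ij; apply: eq_bigr => e _.
by rewrite hf // /graded_rel /= eqxx ij.
Qed.

Lemma mat_of_map_eq (phi psi : cfam M N) f g : (forall k, bghom (phi k)) ->
  (forall k, bghom (psi k)) -> mat_of b b' phi f -> mat_of b b' psi g ->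
  (forall s, f s = g s) <-> map_eq phi psi.
Proof.
move=> ph sh pf pg; split=> [fg k|e [k i]].
  apply: (gb_hom_ext (rz_basis bP k)) => [||i a]; [exact: (ph k).1|exact: (sh k).1|].
  by rewrite pf pg fg.
apply/matrixP => a c; have := e k (b k i a).
rewrite pf pg.
by move=> /(gb_vert_inj (rz_basis bP' k)) ->.
Qed.

Lemma graded_map_neg k l (h : M k -> N l) : l = k - 1 -> bghom h -> forall x, h x = 0.
Proof.
move=> lk hh; apply: (gb_hom_ext (rz_basis bP k) (g := fun=> 0)) => [||i a].
- exact: hh.1.
- exact: (bghom_zero (M k) (N l)).1.
apply: (gb_coord_neg (rz_basis bP' l)).
have := hh.2 _ _ (gb_deg (rz_basis bP k) a).
suff -> : (- k, 0) = (-1, 0) + (- l, 0) :> bideg by [].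
by rewrite lk -[RHS]/(-1 - (k - 1), 0 + 0); congr (_, _); lia.
Qed.

(* A homotopy has components P_i<-k> -> P_j<-k+1>, which vanish for degree reasons. *)
Lemma homotopic_map_eq (phi psi : cfam M N) : homotopic phi psi -> map_eq phi psi.
Proof.
move=> [h [hh fg]] k x; apply/eqP; rewrite -subr_eq0 fg.
rewrite (graded_map_neg _ (hh k (k - 1))) // (graded_map_neg _ (hh (k + 1) k)) ?addrK //.
by rewrite (bghom0 (cdiff_hom N _ _).1) addr0.
Qed.

End Pair.

Lemma mat_of_id M V (b : forall k i, 'I_(rdim V (k, i)) -> M k) : realization b ->
  mat_of b b (fun k x => x) (fun s => 1%:M).
Proof.
move=> bP k i a; rewrite (bigD1 a) //= mxE eqxx mulr1n (gb_vert (rz_basis bP k)).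
rewrite big1 ?addr0 // => c /negPf ca; by rewrite mxE eq_sym ca mulr0n zz_vert0 scale0r.
Qed.

Lemma mat_of_0 M V (b : forall k i, 'I_(rdim V (k, i)) -> M k)
    N W (b' : forall k i, 'I_(rdim W (k, i)) -> N k) :
  mat_of b b' (fun k x => 0) (fun s => 0).
Proof. by move=> k i a; rewrite big1 // => c _; rewrite mxE zz_vert0 scale0r. Qed.

Lemma mat_of_add M V (b : forall k i, 'I_(rdim V (k, i)) -> M k)
    N W (b' : forall k i, 'I_(rdim W (k, i)) -> N k) (phi psi : cfam M N) f g :
  mat_of b b' phi f -> mat_of b b' psi g ->
  mat_of b b' (fun k x => phi k x + psi k x) (fun s => f s + g s).
Proof.
move=> pf pg k i a; rewrite pf pg.
transitivity (\sum_c (zz_vert i (f (k, i) a c) *: b' k i c + zz_vert i (g (k, i) a c) *: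
  b' k i c)).
  by rewrite big_split.
apply: eq_bigr => c _; rewrite mxE -scalerDl; congr (_ *: _); apply/eqP;
  rewrite eq_sym -subr_eq -zz_vertB.
by rewrite addrK.
Qed.

Lemma mat_of_comp M V (b : forall k i, 'I_(rdim V (k, i)) -> M k)
    N W (b' : forall k i, 'I_(rdim W (k, i)) -> N k)
    (L : cplx) (U : rep K T) (b'' : forall k i, 'I_(rdim U (k, i)) ->
      L k) (phi : cfam M N) (psi : cfam N L) f g :
  (forall k, bghom (psi k)) -> mat_of b b' phi f -> mat_of b' b'' psi g ->
  mat_of b b'' (fun k x => psi k (phi k x)) (fun s => f s *m g s).
Proof.
move=> sh pf pg k i a; rewrite pf (bghom_sum (sh _).1).
under eq_bigr => c _ do rewrite (bghomZ (sh _).1) pg scaler_sumr.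
rewrite exchange_big; apply: eq_bigr => e _; rewrite mxE zz_vert_sum scaler_suml.
by apply: eq_bigr => c _; rewrite scalerA zz_vert_mul eqxx.
Qed.

End Realization.

Section RealizationExistence.
Variables (K : fieldType) (G : oriented_dynkin).
Local Notation A := (zigzag K G).
Local Notation cplx := (cplx A).
Local Notation E i := (@zz_vert K G i 1).
Local Notation T := (int * G)%type.
Implicit Types (M N : cplx) (V W : rep K T) (i j : G).

Lemma chain_type_realization M (n : G -> int -> nat) : chain_type M n ->
  exists (V : rep K T) (b : forall k i, 'I_(rdim V (k, i)) -> M k),
    realization b /\ forall k i, rdim V (k, i) = n i k.
Proof.
move=> Mn; have /dep_choice [b bP] : forall k, exists b : forall i, 'I_(n i k) -> M k,
    gbasis (n := fun i => n i k) (- k, 0) b.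
  by move=> k; exact: (dirsum_gbasis (n := fun i => n i k) (Mn k)).
have H k l i a : exists w : forall j, 'I_(n j l) -> K, l = k + 1 ->
    cdiff l (b k i a) = \sum_(j | orient i j) \sum_c zz_arrow i j (w j c) *: b l j c.
  have [lk|lk] := eqVneq l (k + 1); last by exists (fun j c => 0) => /eqP; rewrite (negPf lk).
  have [||w wE] := gb_coord_arrow (bP l) (i := i) (x := cdiff l (b k i a)).
  - have := (cdiff_hom M k l).2 _ _ (gb_deg (bP k) a).
    suff -> : (- k, 0) = (1, 0) + (- l, 0) :> bideg by [].
    by rewrite lk -[RHS]/(1 - (k + 1), 0 + 0); congr (_, _); lia.
  - by rewrite -(bghomZ (cdiff_hom M k l).1) (gb_vert (bP k)).
  by exists w.
(* Entries off the arrows of [graded_rel] are left to choice; neither [realization] nor [rhom] reads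
   them. *)
pose V : rep K T := Rep (rdim := fun s => n s.2 s.1) (fun s t =>
  \matrix_(a, c) projT1 (cid (H s.1 t.1 s.2 a)) t.2 c).
exists V, b; split=> //; split=> [k|k l i a lk]; first exact: bP.
rewrite (projT2 (cid (H k l i a)) lk).
apply: eq_bigr => j ij; apply: eq_bigr => c _; by rewrite mxE.
Qed.

Definition rep_bounded V : Prop := exists B : nat, forall s, (B < `|s.1|)%N -> rdim V s = 0%N.

Lemma realization_bounded M V (b : forall k i, 'I_(rdim V (k, i)) -> M k) :
  realization b -> rep_bounded V.
Proof.
move=> bP; have [B MB] := cbounded M; exists B => -[k i] /= Bk.
case r0 : (rdim V (k, i)) => [//|m]; have a : 'I_(rdim V (k, i)) by rewrite r0; exact: ord0.
by case: (gb_neq0 (rz_basis bP k) (MB k Bk (b k i a))).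
Qed.

Lemma realization_exists V : rep_bounded V ->
  exists (M : cplx) (b : forall k i, 'I_(rdim V (k, i)) -> M k), realization b.
Proof.
move=> [B VB].
pose n k i := rdim V (k, i).
have H0 k := gbasis_exists K (- k, 0) (n k).
pose N k : bgmod A := projT1 (cid (H0 k)).
pose b k : forall i, 'I_(n k i) -> N k := projT1 (cid (projT2 (cid (H0 k)))).
have bP k : gbasis (- k, 0) (b k) := projT2 (cid (projT2 (cid (H0 k)))).
move: N b bP => N b bP {H0}.
have H k l : exists d : N k -> N l, [/\ bghom d, l != k + 1 -> forall x, d x = 0 &
    l = k + 1 -> forall i a, d (b k i a) =
      \sum_(j | orient i j) \sum_c zz_arrow i j (rmap V (k, i) (l, j) a c) *: b l j c].
  have [lk|lk] := eqVneq l (k + 1); last first.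
    exists (fun=> 0); split=> //; first exact: bghom_zero.
    by move=> e; rewrite e eqxx in lk.
  have [||d dh dE] := gb_hom_exists (bP k) (M := N l) (y := fun i a =>
    \sum_(j | orient i j) \sum_c zz_arrow i j (rmap V (k, i) (l, j) a c) *: b l j c).
  - move=> i a; apply: (bigrading_sum (bgmP (N l))) => j ij.
    apply: (bigrading_sum (bgmP (N l))) => c _.
    suff -> : (- k, 0) = (1, 0) + (- l, 0) :> bideg.
      by apply: bgmZ; [exact: zz_arrow_deg|exact: (gb_deg (bP l))].
    by rewrite lk -[RHS]/(1 - (k + 1), 0 + 0); congr (_, _); lia.
  - move=> i a; rewrite scaler_sumr; apply: eq_bigr => j ij.
    rewrite scaler_sumr; apply: eq_bigr => c _.
    by rewrite scalerA zz_vert_arrow eqxx mul1r.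
  by exists d; split.
pose d k l := projT1 (cid (H k l)).
have dP k l := projT2 (cid (H k l)).
have dh k l : bghom (d k l) by case: (dP k l).
have d0 k l (x : N k) : l != k + 1 -> d k l x = 0 by move=> lk; case: (dP k l) => _ h _;
  exact: h.
have dE k l i a : l = k + 1 -> d k l (b k i a) =
    \sum_(j | orient i j) \sum_c zz_arrow i j (rmap V (k, i) (l, j) a c) *: b l j c.
  by move=> lk; case: (dP k l) => _ _ h; exact: h.
have dd k l m (x : N k) : d l m (d k l x) = 0.
  have [lk|lk] := eqVneq l (k + 1); last by rewrite (d0 k l) // (bghom0 (dh l m).1).
  have [ml|ml] := eqVneq m (l + 1); last by rewrite d0.
  move: x; apply: (gb_hom_ext (bP k) (g := fun=> 0)) => [||i a].
  - by move=> u x y; rewrite (dh _ _).1 (dh _ _).1.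
  - exact: (bghom_zero (N k) (N m)).1.
  rewrite dE // (bghom_sum (dh _ _).1) big1 // => j ij.
  rewrite (bghom_sum (dh _ _).1) big1 // => c _.
  rewrite (bghomZ (dh _ _).1) dE // scaler_sumr big1 // => j' ij'.
  rewrite scaler_sumr big1 // => c' _.
  by rewrite scalerA zz_arrow_arrow // scale0r.
have bounded : exists B : nat, forall k, (B < `|k|)%N -> forall x : N k, x = 0.
  exists B => k Bk x; have [c ->] := gb_span (bP k) x.
  rewrite big1 // => i _; rewrite big1 // => -[a an].
  by exfalso; move: an; rewrite /n VB.
exists (Cplx dh d0 dd bounded (fun k => gb_finitely_generated (bP k))
  (fun k => gb_projective (bP k))), b.
by split=> [k|k l i a lk]; [exact: bP|exact: dE].
Qed.

Section Properties.
Variables (M : cplx) (V : rep K T) (b : forall k i, 'I_(rdim V (k, i)) -> M k).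
Arguments b : clear implicits.
Hypothesis bP : realization b.

Lemma realization_chain_type : chain_type M (fun i k => rdim V (k, i)).
Proof. by move=> k; apply: gbasis_dirsum; exact: (rz_basis bP k). Qed.

(** A contracting homotopy of a summand Z gives maps from M^m to M^(m-1), which vanish for degree
    reasons; so the homotopy is 0, and with it the identity of Z. *)
Lemma realization_minimal : minimal M.
Proof.
move=> Y Z [i1 [i2 [p1 [p2 [[_ [i2h _]] [_ [p2h _]] [_ pi2] _ _]]]]] [h [hh hE]] k z.
have h0 m l (y : Z m) : l = m - 1 -> h m l y = 0.
  move=> lm; have e (u : Z l) : u = p2 l (i2 l u) by rewrite pi2.
  rewrite [LHS]e -{1}[y]pi2.
  have gr : bghom (fun x : M m => i2 l (h m l (p2 m x))).
    by apply: bghom_comp (i2h l); apply: bghom_comp (hh m l).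
  by rewrite (graded_map_neg bP bP lm gr) (bghom0 (p2h l).1).
by have := hE k z; rewrite subr0 !h0 ?addrK // (bghom0 (cdiff_hom Z _ _).1) addr0.
Qed.

Lemma realization_contractible : contractible M <-> forall s, rdim V s = 0%N.
Proof.
split=> [/(homotopic_map_eq bP bP) M0 [k i]|V0].
  case r0 : (rdim V (k, i)) => [//|m]; have a : 'I_(rdim V (k, i)) by rewrite r0; exact: ord0.
  by case: (gb_neq0 (rz_basis bP k) (M0 k (b k i a))).
apply: map_eq_homotopic => k x; have [c ->] := gb_span (rz_basis bP k) x.
rewrite big1 // => i _; rewrite big1 // => -[a an].
by exfalso; move: an; rewrite V0.
Qed.

End Properties.

Definition rep_shift (m : int) : rep K T -> rep K T := rpull (fun s => (m + s.1, s.2)).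

Lemma realization_shift M V (b : forall k i, 'I_(rdim V (k, i)) -> M k) (m : int) :
  realization b -> exists b' : forall k i, 'I_(rdim (rep_shift m V) (k, i)) ->
    cshift (m, 0) m M k,
    realization b'.
Proof.
(* The differential of the shift by [m] carries the sign (-1)^m; rescaling the basis in degree k by
   (-1)^(m k) removes it. *)
move=> bP; pose s k : A := (-1) ^+ (`|m| * `|k|)%N.
exists (fun k i a => s k *: b (m + k) i a); split=> [k|k l i a lk].
  have := gb_shift (m, 0) (rz_basis bP (m + k)).
  have -> : (- (m + k), 0) + (m, 0) = (- k, 0) :> bideg.
    by rewrite -[LHS]/(- (m + k) + m, 0 + 0); congr (_, _); lia.
  move=> gb; apply: gb_signed gb.
  - by rewrite /s -expr2 sqrr_sign.
  - rewrite /s -signr_odd; case: odd; last exact: (bgr1 A).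
    by rewrite expr1 -sub0r; apply: (bigradingB (bgrP A));
      [exact: (bigrading0 (bgrP A))|exact: bgr1].
  - by move=> x; rewrite /s commr_sign.
rewrite /= /cshift_diff (bghomZ (cdiff_hom M _ _).1) (rz_diff bP); last by rewrite lk addrA.
have ss : (-1) ^+ `|m|%N * s k = s l.
  by rewrite /s -exprD -signr_odd -[RHS]signr_odd lk; congr (_ ^+ (nat_of_bool _)); lia.
rewrite scalerA ss scaler_sumr; apply: eq_bigr => j ij.
rewrite scaler_sumr; apply: eq_bigr => c _.
by rewrite !scalerA /s commr_sign.
Qed.

End RealizationExistence.

(** * Idempotents, and the dictionary between objects and representations *)

Lemma full_rank_idempotent (K : fieldType) n r (C : 'M[K]_(n, r)) (R : 'M[K]_(r, n)) :
  row_full C -> row_free R -> (C *m R) *m (C *m R) = C *m R -> R *m C = 1%:M.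
Proof.
move=> /row_fullP [l lC] /row_freeP [u Ru] /(congr1 (fun X => l *m X *m u)).
by rewrite !mulmxA lC !mul1mx -!mulmxA Ru !mulmx1.
Qed.

Section IdempotentSplitting.
Variables (K : fieldType) (T : Type) (o : T -> T -> bool) (V : rep K T).

(** The rank factorization of [e s] into a column basis and a row basis splits it. *)
Lemma idempotent_split (e : rfam V V) : rhom o e -> (forall s, e s *m e s = e s) ->
  exists (Y : rep K T) (i : rfam Y V) (p : rfam V Y), [/\ rhom o i, rhom o p,
    forall s, i s *m p s = 1%:M, forall s, p s *m i s = e s & forall s, rdim Y s = \rank (e s)].
Proof.
move=> he ee.
have [d [i [p [ip pi dE]]]] : exists (d : T -> nat) (i : forall s, 'M[K]_(d s, rdim V s))
    (p : forall s, 'M[K]_(rdim V s, d s)), [/\ forall s, i s *m p s = 1%:M,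
    forall s, p s *m i s = e s & forall s, d s = \rank (e s)].
  exists (fun s => \rank (e s)), (fun s => row_base (e s)), (fun s => col_base (e s)).
  split=> // s; last exact: mulmx_base.
  apply: full_rank_idempotent (col_base_full (e s)) (row_base_free (e s)) _.
  by rewrite mulmx_base ee.
have ie s : i s *m e s = i s by rewrite -pi mulmxA ip mul1mx.
have ep s : e s *m p s = p s by rewrite -pi -mulmxA ip mulmx1.
exists (Rep (fun s t => i s *m rmap V s t *m p t)), i, p; split=> // s t st /=.
  by rewrite -mulmxA pi -mulmxA he // mulmxA ie.
by rewrite -[i s *m _ *m p t]mulmxA mulmxA pi mulmxA -he // -mulmxA ep.
Qed.

Lemma idempotent_compl (e : rfam V V) : rhom o e -> (forall s, e s *m e s = e s) ->
  rhom o (fun s => 1%:M - e s) /\ forall s, (1%:M - e s) *m (1%:M - e s) = 1%:M - e s.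
Proof.
move=> he ee; split=> [s t st|s]; first by rewrite mulmxBr mulmxBl mulmx1 mul1mx he.
by rewrite mulmxBr mulmx1 mulmxBl mul1mx ee subrr subr0.
Qed.

End IdempotentSplitting.

Lemma mx1_eq0 (K : fieldType) n : (1%:M : 'M[K]_n) = 0 -> n = 0%N.
Proof. by move=> /(congr1 mxrank); rewrite mxrank1 mxrank0. Qed.

Section Models.
Variables (K : fieldType) (G : oriented_dynkin).
Local Notation A := (zigzag K G).
Local Notation cplx := (cplx A).
Local Notation T := (int * G)%type.
Local Notation grel := (@graded_rel G).
Implicit Types (X Y Z M N : cplx) (V W : rep K T) (i j : G).

(** A relation, because an object determines its representation only up to isomorphism. *)
Definition models X V : Prop := exists (M : cplx) (b : forall k i, 'I_(rdim V (k, i)) -> M k),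
  iso_K X M /\ realization b.

Lemma models_bounded X V : models X V -> rep_bounded V.
Proof. by move=> [M [b [_ /realization_bounded]]]. Qed.

Lemma models_iso_K X Y V : models X V -> iso_K Y X -> models Y V.
Proof. by move=> [M [b [XM bP]]] YX; exists M, b; split=> //; exact: iso_K_trans YX XM. Qed.

(** Between realizations homotopic maps are equal, so homotopy inverses are strict inverses, and so
    are their matrices. *)
Lemma models_riso X Y V W : models X V -> models Y W -> iso_K X Y -> riso grel V W.
Proof.
move=> [M [b [XM bP]]] [N [b' [YN bP']]] XY.
have [f [g [fc gc fg gf]]] := iso_K_trans (iso_K_trans (iso_K_sym XM) XY) YN.
have [f' f'E] := mat_of_exists bP bP' fc.1; have [g' g'E] := mat_of_exists bP' bP gc.1.
exists f', g'; split.
- exact: (chain_map_rhom bP bP' fc f'E).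
- exact: (chain_map_rhom bP' bP gc g'E).
- apply/(mat_of_map_eq bP bP _ _ (mat_of_comp gc.1 f'E g'E) (mat_of_id bP)).
  + exact: (chain_map_comp fc gc).1.
  + exact: (chain_map_id M).1.
  exact: (homotopic_map_eq bP bP fg).
- apply/(mat_of_map_eq bP' bP' _ _ (mat_of_comp fc.1 g'E f'E) (mat_of_id bP')).
  + exact: (chain_map_comp gc fc).1.
  + exact: (chain_map_id N).1.
  exact: (homotopic_map_eq bP' bP' gf).
Qed.

Lemma riso_models X Y V W : models X V -> models Y W -> riso grel V W -> iso_K X Y.
Proof.
move=> [M [b [XM bP]]] [N [b' [YN bP']]] [f [g [fh gh fg gf]]].
apply: (iso_K_trans XM); apply: iso_K_trans (iso_K_sym YN).
have [phi phiC phiE] := rhom_chain_map bP bP' fh.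
have [psi psiC psiE] := rhom_chain_map bP' bP gh.
exists phi, psi; split=> //.
- apply: map_eq_homotopic.
  apply/(mat_of_map_eq bP bP _ _ (mat_of_comp psiC.1 phiE psiE) (mat_of_id bP)) => //.
  exact: (chain_map_comp phiC psiC).1.
- apply: map_eq_homotopic.
  apply/(mat_of_map_eq bP' bP' _ _ (mat_of_comp phiC.1 psiE phiE) (mat_of_id bP')) => //.
  exact: (chain_map_comp psiC phiC).1.
Qed.

Lemma models_exists V : rep_bounded V -> exists X, models X V.
Proof.
move=> /realization_exists [M [b bP]]; exists M, M, b; split=> //; exact: iso_K_refl.
Qed.

Lemma models_riso_trans X V W : models X V -> riso grel V W -> models X W.
Proof.
move=> XV VW; have [B VB] := models_bounded XV.
have [|Y YW] := @models_exists W.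
  by exists B => s Bs; rewrite -(riso_dim VW) VB.
exact: (models_iso_K YW (riso_models XV YW VW)).
Qed.

Lemma models_shift X V (m : int) : models X V -> models (cshift (m, 0) m X) (rep_shift m V).
Proof.
move=> [M [b [XM /realization_shift -/(_ m) [b' bP']]]].
by exists (cshift (m, 0) m M), b'; split=> //; exact: cshift_iso.
Qed.

Lemma models_K00 X : in_K00 X <-> exists V, models X V.
Proof.
split=> [[M [n [XM _ Mn]]]|[V [M [b [XM bP]]]]].
  by have [V [b [bP _]]] := chain_type_realization Mn; exists V, M, b.
exists M, (fun i k => rdim V (k, i)); split=> //.
  exact: realization_minimal bP.
exact: realization_chain_type bP.
Qed.

Lemma models_has_dim X V (v : {ffun G -> nat}) : models X V ->
  has_dim X v <-> forall i, v i = \big[addn/0%N]_(k \in [set: int]) rdim V (k, i).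
Proof.
move=> XV; split=> [[M [n [XM _ Mn vE]]] i|vE].
  have [W [b [bP nE]]] := chain_type_realization Mn.
  have XW : models X W by exists M, b.
  have VW := riso_dim (models_riso XV XW (iso_K_refl X)).
  by rewrite vE; apply: eq_fsbigr => k _; rewrite VW nE.
have [M [b [XM bP]]] := XV; exists M, (fun i k => rdim V (k, i)); split=> //.
  exact: realization_minimal bP.
exact: realization_chain_type bP.
Qed.

Lemma rep_shift0 V : rep_shift 0 V = V.
Proof.
rewrite /rep_shift (_ : (fun s : T => _) = id); first by case: V.
by apply/funext => -[k i] /=; rewrite add0r.
Qed.

Lemma shift_class_models X V Y : models X V ->
  shift_class X Y <-> exists m : int, models Y (rep_shift m V).
Proof.
move=> XV; split=> -[m Ym]; exists m; first exact: (models_iso_K (models_shift m XV)).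
have [U US] := models_exists (models_bounded Ym).
have r V' : riso grel V' V'.
  by exists (fun s => 1%:M), (fun s => 1%:M); split; try exact: rhom1; move=> s; rewrite mulmx1.
exact: riso_models Ym (models_shift m XV) (r _).
Qed.

(** [chi] selects a value by [xget], so all members of the class must have the same vector; a shift
    only reindexes the sum over k. *)
Lemma chi_shift_class X (v : {ffun G -> nat}) : in_K00 X -> has_dim X v ->
  chi (shift_class X) = v.
Proof.
move=> /models_K00 [V XV] Xv; apply: xget_unique.
  exists X => //; apply/(shift_class_models _ XV); exists 0; by rewrite rep_shift0.
move=> w [Y /(shift_class_models _ XV) [m Ym] Yw]; apply/ffunP => i.
rewrite ((models_has_dim w Ym).1 Yw) ((models_has_dim v XV).1 Xv).
by rewrite [RHS](reindex_fsbigT (fun k : int => m + k)) //.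
Qed.

(** A biproduct gives the endomorphism [i1 p1] of M, whose matrix is strictly idempotent. If it is
    0, the identity of Y factors through 0 up to homotopy; if it is 1, that of Z factors through
    [p1 i2], which is null-homotopic. *)
Lemma rindec_indecomposable X V : models X V -> rindec grel V -> indecomposable_K00 X.
Proof.
move=> XV [[s sV] idem]; have [M [b [XM bP]]] := XV; split; first by apply/models_K00; exists V.
  by move=> /(contractible_iso XM)/(realization_contractible bP) V0; rewrite V0 in sV.
move=> Y Z _ _ /(biproduct_iso XM)
  [i1 [i2 [p1 [p2 [[ci1 ci2] [cp1 cp2] [h1 h2] [h3 h4] h]]]]].
have ce := chain_map_comp cp1 ci1.
have [e eE] := mat_of_exists bP bP ce.1.
have ee t : e t *m e t = e t.
  move: t; apply/(mat_of_map_eq bP bP _ _ (mat_of_comp ce.1 eE eE) eE).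
  - exact: (chain_map_comp ce ce).1.
  - exact: ce.1.
  apply: (homotopic_map_eq bP bP).
  exact: (homotopic_compl ci1 (homotopic_compr cp1 h1)).
case: (idem e (chain_map_rhom bP bP ce eE) ee) => [e0|e1]; [left|right].
  have ip0 : map_eq (fun k x => i1 k (p1 k x)) (fun k x => 0).
    by apply/(mat_of_map_eq bP bP ce.1 (chain_map0 M M).1 eE (mat_of_0 _ _)).
  have a := homotopic_compl cp1 (homotopic_compr ci1 (map_eq_homotopic ip0)).
  have a1 := homotopic_compl cp1 (homotopic_compl ci1 h1).
  apply: homotopic_trans (homotopic_sym h1) _.
  apply: homotopic_trans (homotopic_sym a1) _.
  apply: homotopic_trans a _; apply: map_eq_homotopic => k y.
  exact: (bghom0 (cp1.1 k).1).
have ip1 : map_eq (fun k x => i1 k (p1 k x)) (fun k x => x).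
  by apply/(mat_of_map_eq bP bP ce.1 (chain_map_id M).1 eE (mat_of_id bP)).
apply: homotopic_trans (homotopic_sym h2) _.
have a := homotopic_compl cp2 (homotopic_compr ci2 (map_eq_homotopic ip1)).
apply: homotopic_trans (homotopic_sym a) _.
have a1 := homotopic_compl cp2 (homotopic_compl ci1 h3).
apply: homotopic_trans a1 _; apply: map_eq_homotopic => k y.
by rewrite (bghom0 (ci1.1 k).1) (bghom0 (cp2.1 k).1).
Qed.

(** An idempotent [e] and its complement [1 - e] split through their images. Realizing both images
    decomposes M, and contractibility of one of them means that its idempotent is 0. *)
Lemma indecomposable_rindec X V : models X V -> indecomposable_K00 X -> rindec grel V.
Proof.
move=> XV [_ Xnc Xind]; have [M [b [XM bP]]] := XV; split.
  apply: contrapT => z; apply: Xnc; apply: (contractible_iso (iso_K_sym XM)).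
  by apply/(realization_contractible bP) => s; apply: contrapT => /eqP ns; apply: z; exists s.
move=> e he ee; have [he' ee'] := idempotent_compl he ee.
have [Y [i [p [hi hp ip pi Yd]]]] := idempotent_split he ee.
have [Z [j [q [hj hq jq qj Zd]]]] := idempotent_split he' ee'.
have [B VB] := models_bounded XV.
have bounded (U : rep K T) : (forall s, (rdim U s <= rdim V s)%N) -> rep_bounded U.
  by move=> UV; exists B => s Bs; apply/eqP; rewrite -leqn0 -(VB s Bs).
have [|NY [bY bYP]] := @realization_exists _ _ Y.
  by apply: bounded => s; rewrite Yd rank_leq_row.
have [|NZ [bZ bZP]] := @realization_exists _ _ Z.
  by apply: bounded => s; rewrite Zd rank_leq_row.
have [i1 ci1 i1E] := rhom_chain_map bYP bP hi.
have [i2 ci2 i2E] := rhom_chain_map bZP bP hj.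
have [p1 cp1 p1E] := rhom_chain_map bP bYP hp.
have [p2 cp2 p2E] := rhom_chain_map bP bZP hq.
have jp s : j s *m p s = 0.
  have je : j s *m e s = 0.
    have : j s *m (1%:M - e s) = j s by rewrite -qj mulmxA jq mul1mx.
    by rewrite mulmxBr mulmx1 => /eqP; rewrite subr_eq -subr_eq0 opprD addNKr oppr_eq0 => /eqP.
  by rewrite -[p s]mulmx1 -(ip s) (mulmxA (p s)) pi mulmxA je mul0mx.
have iq s : i s *m q s = 0.
  have ie : i s *m (1%:M - e s) = 0 by rewrite mulmxBr mulmx1 -pi mulmxA ip mul1mx subrr.
  by rewrite -[q s]mulmx1 -(jq s) (mulmxA (q s)) qj mulmxA ie mul0mx.
have bip : is_biproduct (@homotopic A) M NY NZ.
  exists i1, i2, p1, p2; split=> //; try split; apply: map_eq_homotopic.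
  - apply/(mat_of_map_eq bYP bYP _ _ (mat_of_comp cp1.1 i1E p1E) (mat_of_id bYP)) => //.
    exact: (chain_map_comp ci1 cp1).1.
  - apply/(mat_of_map_eq bZP bZP _ _ (mat_of_comp cp2.1 i2E p2E) (mat_of_id bZP)) => //.
    exact: (chain_map_comp ci2 cp2).1.
  - apply/(mat_of_map_eq bZP bYP _ _ (mat_of_comp cp1.1 i2E p1E) (mat_of_0 _ _)) => //.
      exact: (chain_map_comp ci2 cp1).1.
    exact: (chain_map0 NZ NY).1.
  - apply/(mat_of_map_eq bYP bZP _ _ (mat_of_comp cp2.1 i1E p2E) (mat_of_0 _ _)) => //.
      exact: (chain_map_comp ci1 cp2).1.
    exact: (chain_map0 NY NZ).1.
  - apply/(mat_of_map_eq bP bP _ _ (mat_of_add (mat_of_comp ci1.1 p1E i1E)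
      (mat_of_comp ci2.1 p2E i2E)) (mat_of_id bP)) => //.
      move=> k; apply: bghom_add; [exact: (chain_map_comp cp1 ci1).1|exact: (chain_map_comp cp2 ci2).1].
    by move=> s; rewrite pi qj addrC subrK.
have K00 (N : cplx) (U : rep K T) (c : forall k i, 'I_(rdim U (k, i)) -> N k) :
    realization c -> in_K00 N.
  by move=> cP; apply/models_K00; exists U, N, c; split=> //; exact: iso_K_refl.
have rank0 (U : rep K T) s (f : 'M[K]_(rdim V s)) : (forall s, rdim U s = 0%N) ->
    rdim U s = \rank f -> f = 0.
  by move=> U0; rewrite U0 => /esym/eqP; rewrite mxrank_eq0 => /eqP.
case: (Xind NY NZ (K00 _ _ _ bYP) (K00 _ _ _ bZP) (biproduct_iso (iso_K_sym XM) bip)).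
  move=> /(realization_contractible bYP) Y0; left=> s; exact: rank0 Y0 (Yd s).
move=> /(realization_contractible bZP) Z0; right=> s.
by apply/esym/eqP; rewrite -subr_eq0; apply/eqP; exact: rank0 Z0 (Zd s).
Qed.

End Models.

(** * The correspondence with positive roots *)

(* As the quiver is a tree, a graded representation is a direct sum of
   representations carried by the lines k = h i + c, where h increases by one
   along each arrow. *)
Section Lines.
Variables (K : fieldType) (G : oriented_dynkin) (h : G -> int).
Hypothesis hE : forall i j : G, orient i j -> h j = h i + 1.
Local Notation T := (int * G)%type.
Local Notation grel := (@graded_rel G).
Implicit Types (V W : rep K T) (U : rep K G) (c : int) (i j : G) (s t : T).

Definition line c i : T := (h i + c, i).

Definition on_line c V : Prop := forall s, (forall i, line c i <> s) -> rdim V s = 0%N.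

Lemma line_inj c : injective (line c).
Proof. by move=> i j []. Qed.

Lemma line_rel c i j : orient i j -> grel (line c i) (line c j).
Proof. by move=> ij; rewrite /graded_rel /= (hE ij) ij andbT; lia. Qed.

Lemma rhom_line c V W (f : rfam V W) : rhom grel f ->
  rhom (@orient G) (fun i => f (line c i) : 'M_(rdim (rpull (line c) V) i, rdim (rpull (line c) W) i)).
Proof. by move=> hf i j ij; apply: hf; exact: line_rel. Qed.

(** Arrows do not leave a line and [V] vanishes off it, so extension by zero is a morphism. *)
Lemma line_extend c V W (f : rfam (rpull (line c) V) (rpull (line c) W)) :
  on_line c V -> rhom (@orient G) f ->
  exists2 F : rfam V W, rhom grel F & forall i, F (line c i) = f i.
Proof.
move=> Vc hf; have [F Ff F0] := inj_extend (U := fun s => 'M[K]_(rdim V s, rdim W s)) (g :=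
  line c)
  f (fun s => 0) (@line_inj c).
exists F => // s t st; have [[i si]|ns] := pselect (exists i, line c i = s); last first.
  by apply: mx_dim0; rewrite Vc // => i si; apply: ns; exists i.
subst s; case: t st => l j /andP[/eqP /= lE ij].
have -> : (l, j) = line c j by rewrite /line (hE ij) lE; congr (_, _); lia.
by rewrite !Ff; exact: hf.
Qed.

Lemma on_line_eq c V W (f g : rfam V W) : on_line c V ->
  (forall i, f (line c i) = g (line c i)) -> forall s, f s = g s.
Proof.
move=> Vc fg s; have [[i <-] //|ns] := pselect (exists i, line c i = s).
by apply: mx_dim0; rewrite Vc // => i si; apply: ns; exists i.
Qed.

(** Arrows preserve [k - h i], so the projection to a line is an idempotent endomorphism; for a line
    that meets the support it must be the identity. *)
Lemma rindec_on_line V : rindec grel V -> exists c, on_line c V.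
Proof.
move=> [[[k0 i0] V0] idem]; exists (k0 - h i0).
pose e s : 'M[K]_(rdim V s) := if s.1 == h s.2 + (k0 - h i0) then 1%:M else 0.
case: (idem e) => [s t /andP[/eqP ts /hE ht]|s|e0|e1 s ns].
- rewrite /e ts ht (_ : (s.1 + 1 == _) = (s.1 == h s.2 + (k0 - h i0))); last by lia.
  by case: ifP; rewrite ?mulmx1 ?mul1mx ?mulmx0 ?mul0mx.
- by rewrite /e; case: ifP; rewrite ?mulmx1 ?mulmx0.
- have := e0 (k0, i0); rewrite /e /= addrC subrK eqxx => /mx1_eq0 z.
  by rewrite z in V0.
- have := e1 s; rewrite /e; case: eqP => [se|_ /esym/mx1_eq0 //].
  by case: (ns s.2); case: s se {ns} => k i /= ->.
Qed.

Lemma rindec_line c V : on_line c V -> rindec grel V <-> rindec (@orient G) (rpull (line c) V).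
Proof.
move=> Vc; split=> [[[s sV] idem]|[[i iV] idem]]; split.
- have [[i si]|ns] := pselect (exists i, line c i = s); first by exists i; rewrite /= si.
  by move: sV; rewrite Vc // => i si; apply: ns; exists i.
- move=> e he ee; have [F hF Fe] := line_extend Vc he.
  have FF : forall s, F s *m F s = F s.
    by apply: (on_line_eq (f := fun s => F s *m F s) Vc) => i; rewrite Fe ee.
  by case: (idem F hF FF) => F01; [left|right] => i; rewrite -Fe F01.
- by exists (line c i).
- move=> e he ee; case: (idem (fun i => e (line c i)) (rhom_line c he)) => [i'|e0|e1].
  + exact: ee.
  + by left; apply: (on_line_eq (g := fun=> 0) Vc).
  + by right; apply: (on_line_eq (g := fun=> 1%:M) Vc).
Qed.

Lemma riso_line c V W : on_line c V -> on_line c W ->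
  riso (@orient G) (rpull (line c) V) (rpull (line c) W) -> riso grel V W.
Proof.
move=> Vc Wc [f [g [hf hg fg gf]]].
have [F hF Ff] := line_extend Vc hf; have [F' hF' Fg] := line_extend Wc hg.
exists F, F'; split=> //.
  by apply: (on_line_eq (f := fun s => F s *m F' s) (g := fun=> 1%:M) Vc) => i;
    rewrite Ff Fg fg.
by apply: (on_line_eq (f := fun s => F' s *m F s) (g := fun=> 1%:M) Wc) => i; rewrite Ff Fg gf.
Qed.

Lemma line_exists c U : exists2 V, on_line c V & rpull (line c) V = U.
Proof.
case: U => d0 m.
have [d dE dz] := inj_extend (U := fun=> nat) d0 (fun=> 0%N) (@line_inj c).
(* Substituting this equation makes the dimensions convertible, so that the pullback equals [U] and
   is not merely isomorphic to it. *)
have d0E : d0 = fun i => d (line c i) by apply/funext => i.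
subst d0.
have pinj : injective (fun p : G * G => (line c p.1, line c p.2)).
  by move=> [i j] [i' j'] [_ -> _ ->].
have [F FE _] := inj_extend (g := fun p : G * G => (line c p.1, line c p.2))
  (U := fun p => 'M[K]_(d p.1, d p.2)) (fun p => m p.1 p.2) (fun p => 0) pinj.
exists (Rep (rdim := d) (fun s t => F (s, t))) => //.
congr Rep; apply: functional_extensionality_dep => i.
by apply: functional_extensionality_dep => j; exact: (FE (i, j)).
Qed.

Lemma on_line_shift c m V : on_line c V -> on_line (c - m) (rep_shift m V).
Proof.
move=> Vc [k i] ns; rewrite /= Vc // => j [ji jk]; apply: (ns j).
by rewrite /line -jk; congr (_, _); lia.
Qed.

Lemma rep_shift_riso m V W : riso grel V W -> riso grel (rep_shift m V) (rep_shift m W).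
Proof.
move=> [f [g [hf hg fg gf]]].
have sh s t : grel s t -> grel (m + s.1, s.2) (m + t.1, t.2).
  by move=> /andP[/eqP ts st]; rewrite /graded_rel /= ts st addrA eqxx.
exists (fun s => f (m + s.1, s.2)), (fun s => g (m + s.1, s.2)); split.
- by move=> s t /sh; exact: hf.
- by move=> s t /sh; exact: hg.
- by move=> s; exact: fg.
- by move=> s; exact: gf.
Qed.

Lemma rep_shiftD m k V : rep_shift k (rep_shift m V) = rep_shift (m + k) V.
Proof.
rewrite /rep_shift; set g := fun s : T => (m + _, _); set g' := fun s : T => (k + _, _).
rewrite -[LHS]/(rpull (fun s => g (g' s)) V); congr rpull.
by apply/funext => s; rewrite /g /g' /= addrA.
Qed.

Lemma rpull_line_shift c m V : rpull (line (c - m)) (rep_shift m V) = rpull (line c) V.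
Proof.
rewrite /rep_shift; set g := fun s : T => _.
rewrite -[LHS]/(rpull (fun i => g (line (c - m) i)) V); congr rpull.
by apply/funext => i; rewrite /g /line /=; congr (_, _); lia.
Qed.

Lemma on_line_bounded c V : on_line c V -> rep_bounded V.
Proof.
move=> Vc; exists (\sum_i `|(h i + c)%R|)%N => s Bs; apply: Vc => i si; move: Bs.
by rewrite -si /= (bigD1 i) //=; lia.
Qed.

Lemma on_line_sum c V i : on_line c V ->
  \big[addn/0%N]_(k \in [set: int]) rdim V (k, i) = rdim V (line c i).
Proof.
move=> Vc; rewrite -(fsbig_widen [set h i + c]%classic) ?fsbig_set1 // => k [_ /= kc].
by rewrite Vc // => j [jk ji]; apply: kc; rewrite -ji -jk.
Qed.

Lemma models_line_has_dim X c V (v : {ffun G -> nat}) : models X V -> on_line c V ->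
  has_dim X v <-> forall i, rdim (rpull (line c) V) i = v i.
Proof.
move=> XV Vc; rewrite (models_has_dim v XV).
by split=> vE i; [rewrite vE|rewrite -vE]; rewrite (on_line_sum i Vc).
Qed.

End Lines.

(** The first conjunct ties [chi], which is defined by choice with a default value, to actual
    dimension vectors. *)
Theorem theorem2p7 (R : realType) (G : oriented_dynkin) :
  (forall (X : cplx (zigzag R[i] G)) (v : {ffun G -> nat}),
     indecomposable_K00 X -> has_dim X v -> chi (shift_class X) = v) /\
  bijective_between (@in_L R[i] G) (@positive_roots G) (@chi R[i] G).
Proof.
have chiE (X : cplx (zigzag R[i] G)) (v : {ffun G -> nat}) :
    indecomposable_K00 X -> has_dim X v -> chi (shift_class X) = v.
  by move=> [X0 _ _]; exact: chi_shift_class.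
split=> //.
have [h hE0] := orientation_height G.
have hE (i j : G) : orient i j -> h j = h i + 1 by rewrite hE0 => /andP[_ /eqP].
have model (X : cplx (zigzag R[i] G)) : indecomposable_K00 X -> exists c V,
    [/\ models X V, on_line h c V, rindec (@orient G) (rpull (line h c) V) &
        forall i, rdim (rpull (line h c) V) i = chi (shift_class X) i].
  move=> Xi; have [X0 _ _] := Xi; have [V XV] := (models_K00 X).1 X0.
  have Vi := indecomposable_rindec XV Xi.
  have [c Vc] := rindec_on_line hE Vi; exists c, V; split=> //.
    exact/(rindec_line hE Vc).
  pose v : {ffun G -> nat} := [ffun i => rdim (rpull (line h c) V) i].
  have Xv : has_dim X v by apply/(models_line_has_dim v XV Vc) => i; rewrite ffunE.
  by move=> i; rewrite (chiE X v) // ffunE.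
split.
- move=> _ [X Xi ->]; have [c [V [_ _ Vi Vd]]] := model X Xi.
  apply/(gabriel R[i] (chi (shift_class X))).1.
  by exists (rpull (line h c) V).
- move=> _ _ [X Xi ->] [Y Yi ->] XY.
  have [c [V [XV Vc Vi Vd]]] := model X Xi; have [c' [W [YW Wc Wi Wd]]] := model Y Yi.
  (* The shift by [m] moves line [c] to line [c']; there both models restrict to indecomposables of
     the same dimension vector, which Gabriel's theorem identifies. *)
  pose m := c - c'.
  have c'E : c' = c - m by rewrite /m; lia.
  have sW : riso (@graded_rel G) (rep_shift m V) W.
    apply: (riso_line hE (on_line_shift (m := m) Vc)); first by rewrite -c'E.
    rewrite rpull_line_shift -c'E.
    by apply: (gabriel R[i] (chi (shift_class Y))).2 => // i; rewrite Vd XY.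
  apply/funext => Z; apply/propext.
  rewrite (shift_class_models Z XV) (shift_class_models Z YW); split=> -[k Zk].
    exists (k - m); apply: (models_riso_trans Zk).
    have := rep_shift_riso (k - m) sW; rewrite rep_shiftD.
    by have -> : m + (k - m) = k by lia.
  exists (m + k); rewrite -rep_shiftD; apply: (models_riso_trans Zk).
  exact/riso_sym/rep_shift_riso.
- move=> v /(gabriel R[i] v).1 [U Ui Ud].
  (* The choice of line is immaterial, since shifts permute the lines. *)
  have [V Vc VU] := line_exists h 0 U.
  have [X XV] := models_exists (on_line_bounded Vc).
  have Xi : indecomposable_K00 X.
    by apply: (rindec_indecomposable XV); apply/(rindec_line hE Vc); rewrite VU.
  exists (shift_class X); first by exists X.
  by apply: chiE => //; apply/(models_line_has_dim v XV Vc); rewrite VU.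
Qed.
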